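(* Let $M$ be a closed $4$-manifold containing pairwise disjoint square-zero tori $R_1,\dots,R_r$ and put $W=M\setminus\operatorname{int}(\nu R_1\cup\cdots\cup\nu R_r)$. On each $\partial\nu R_i$ choose a primitive basis $(\lambda_i,\eta_i,\rho_i)$, with $\rho_i$ the meridian of $R_i$. Let $C_i$, $1\le i\le r$, be torus exteriors with a primitive boundary basis $(\mu_i,u_i,v_i)$ such that $\mu_i$ is the geometric meridian and $v_i=1$ in $\pi_1(C_i)$. Glue the $C_i$ to $W$ by $$\lambda_i\mapsto u_i,\qquad\eta_i\mapsto\mu_i,\qquad\rho_i\mapsto v_i.$$ Assume that, after the original fillings $W\to M$, the classes $\eta_i$ are trivial in $\pi_1(M)$ and that $\pi_1(M)/\langle\!\langle\lambda_1,\dots,\lambda_r\rangle\!\rangle=1$. Then the resulting closed manifold is simply connected.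
   Context: All manifolds are smooth, connected and oriented; a square-zero torus is an embedded oriented torus with self-intersection $0$, so $\nu R_i\cong\mathbb T^2\times\mathbb D^2$ and $\partial\nu R_i\cong\mathbb T^3$. $\langle\!\langle\cdot\rangle\!\rangle$ denotes normal closure; boundary classes are regarded in $\pi_1(M)$ via inclusion (up to conjugacy). A torus exterior is $C_T=\mathbb S^4\setminus\operatorname{int}\nu T$ for a smoothly embedded oriented torus $T\subset\mathbb S^4$, with $\pi_1(\partial C_T)\cong\mathbb Z^3$; the geometric meridian bounds a normal disk of $T$. Gluing maps are prescribed on bases, with one target basis element inverted if necessary so that the diffeomorphism is orientation reversing. *)

(* Defs.v *)
From HB Require Import structures.
From Stdlib Require Import Relation_Operators.
From mathcomp Require Import all_boot all_order all_algebra generic_quotient.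
From mathcomp Require Import all_classical all_reals all_analysis.

Set Implicit Arguments.
Unset Strict Implicit.
Unset Printing Implicit Defensive.

Import Order.TTheory GRing.Theory Num.Theory.
Import numFieldNormedType.Exports.

Local Open Scope classical_set_scope.
Local Open Scope ring_scope.

(* f is of class C^k on the open set U, through iterated partial derivatives
   along the vectors of the standard basis. *)
Fixpoint Ck (R : realType) (m n k : nat) (U : set 'rV[R]_m)
    (f : 'rV[R]_m -> 'rV[R]_n) : Prop :=
  match k with
  | 0 => forall x, U x -> {for x, continuous f}
  | k'.+1 => forall i : 'I_m,
      (forall x, U x -> derivable f x (delta_mx 0 i)) /\
      Ck k' U (fun x => 'D_(delta_mx 0 i) f x)
  end.

Definition smooth_on (R : realType) (m n : nat) (U : set 'rV[R]_m)
    (f : 'rV[R]_m -> 'rV[R]_n) : Prop := forall k, Ck k U f.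

(* The data of a manifold: a space with a collection of pairs (domain, chart).
   The axioms are in [oriented_manifold]. *)
Record charted_space (R : realType) (n : nat) := ChartedSpace {
  carrier :> topologicalType;
  atlas : set (set carrier * (carrier -> 'rV[R]_n)) }.

Arguments atlas {R n} c.

(* A homeomorphism of U onto an open subset of R^n. *)
Definition is_chart (R : realType) (n : nat) (X : topologicalType)
    (U : set X) (c : X -> 'rV[R]_n) : Prop :=
  [/\ open U, {in U &, injective c}, forall x, U x -> {for x, continuous c} &
      forall V, open V -> V `<=` U -> open (c @` V)].

(* 'J g y is the matrix of the differential of g at y acting on row vectors. *)
Definition oriented_transition (R : realType) (n : nat) (X : topologicalType)
    (a b : set X * (X -> 'rV[R]_n)) : Prop :=
  exists g : 'rV[R]_n -> 'rV[R]_n,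
    [/\ forall x, (a.1 `&` b.1) x -> g (a.2 x) = b.2 x,
        smooth_on (a.2 @` (a.1 `&` b.1)) g &
        forall y, (a.2 @` (a.1 `&` b.1)) y -> 0 < \det (jacobian g y)].

Definition oriented_manifold (R : realType) (n : nat)
    (M : charted_space R n) : Prop :=
  [/\ hausdorff_space M, @second_countable M, connected [set: M],
      (forall a, atlas M a -> is_chart a.1 a.2) /\
        (forall x : M, exists2 a, atlas M a & a.1 x) &
      forall a b, atlas M a -> atlas M b -> oriented_transition a b].

Definition closed_oriented_manifold (R : realType) (n : nat)
    (M : charted_space R n) : Prop :=
  oriented_manifold M /\ compact [set: M].

Definition smooth_map (R : realType) (m n : nat) (M : charted_space R n)
    (f : 'rV[R]_m -> M) : Prop :=
  continuous f /\
  forall a, atlas M a ->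
    smooth_on (f @^-1` a.1) (a.2 \o f).

Definition sqnorm (R : realType) (n : nat) (x : 'rV[R]_n) : R :=
  \sum_(i < n) x 0 i ^+ 2.

(* The 4-sphere, with the two stereographic charts; the second one is composed
   with a reflection of R^4 so that the two charts agree on the orientation. *)
Definition sphere4 (R : realType) : set 'rV[R]_5 := [set x | sqnorm x = 1].

Definition height (R : realType) (h : R) : set (set_type (@sphere4 R)) :=
  [set x | (set_val x : 'rV[R]_5) 0 ord_max = h].

Definition stereo_north (R : realType) (x : set_type (@sphere4 R)) : 'rV[R]_4 :=
  let y := set_val x in
  \row_(j < 4) (y 0 (widen_ord (leqnSn 4) j) / (1 - y 0 ord_max)).

Definition stereo_south (R : realType) (x : set_type (@sphere4 R)) : 'rV[R]_4 :=
  let y := set_val x in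
  \row_(j < 4) ((-1) ^+ (j == ord_max) *
                (y 0 (widen_ord (leqnSn 4) j) / (1 + y 0 ord_max))).

Definition S4 (R : realType) : charted_space R 4 :=
  @ChartedSpace R 4 (set_type (@sphere4 R))
    [set (~` height (1 : R), @stereo_north R);
         (~` height (-1 : R), @stereo_south R)].

(* Paths are functions on R of which only the restriction to [0, 1] matters.
   Loops and homotopies are taken inside a subset A of the ambient space, so
   that these are the paths, homotopies, ... of the subspace A. *)
Definition path_in (R : realType) (X : topologicalType) (A : set X) (p q : X)
    (l : R -> X) : Prop :=
  [/\ {within `[0, 1], continuous l}, l @` `[0, 1] `<=` A, l 0 = p & l 1 = q].

Definition loop_in (R : realType) (X : topologicalType) (A : set X) (p : X)
    (l : R -> X) : Prop := path_in A p p l.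

Definition path_cat (R : realType) (X : Type) (l l' : R -> X) : R -> X :=
  fun t => if t <= 2^-1 then l (2 * t) else l' (2 * t - 1).

Definition path_rev (R : realType) (X : Type) (l : R -> X) : R -> X :=
  fun t => l (1 - t).

Definition loop_pow (R : realType) (X : Type) (l : R -> X) (z : int) : R -> X :=
  match z with
  | Posz n => iter n (path_cat l) (cst (l 0))
  | Negz n => iter n.+1 (path_cat (path_rev l)) (cst (l 0))
  end.

Definition is_homotopy (R : realType) (X : topologicalType) (A : set X)
    (l l' : R -> X) (H : R * R -> X) : Prop :=
  [/\ {within `[0, 1] `*` `[0, 1], continuous H},
      H @` (`[0, 1] `*` `[0, 1]) `<=` A,
      {in `[0, 1], forall t, H (0, t) = l t} &
      {in `[0, 1], forall t, H (1, t) = l' t}].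

Definition homotopic (R : realType) (X : topologicalType) (A : set X)
    (l l' : R -> X) : Prop :=
  exists2 H, is_homotopy A l l' H &
    {in `[0, 1], forall s, H (s, 0) = l 0 /\ H (s, 1) = l 1}.

Definition free_homotopic (R : realType) (X : topologicalType) (A : set X)
    (l l' : R -> X) : Prop :=
  exists2 H, is_homotopy A l l' H &
    {in `[0, 1], forall s, H (s, 0) = H (s, 1)}.

Definition pi1_trivial_class (R : realType) (X : topologicalType) (A : set X)
    (l : R -> X) : Prop := homotopic A l (cst (l 0)).

(* (l1, l2, l3) is a Z-basis of pi_1(A, p), for an A with abelian fundamental
   group. *)
Definition pi1_basis (R : realType) (X : topologicalType) (A : set X) (p : X)
    (l1 l2 l3 : R -> X) : Prop :=
  [/\ loop_in A p l1, loop_in A p l2, loop_in A p l3 &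
   forall l, loop_in A p l ->
     exists! z : int * int * int, homotopic A l
       (path_cat (path_cat (loop_pow l1 z.1.1) (loop_pow l2 z.1.2))
                 (loop_pow l3 z.2))].

(* The loops at x0 with class in the normal closure in pi_1(X, x0) of the
   classes of the loops in S. The latter may have other base points, and so
   define elements of pi_1(X, x0) up to conjugacy: all the connecting paths p
   are used. *)
Inductive normal_closure (R : realType) (X : topologicalType) (x0 : X)
    (S : set (R -> X)) : (R -> X) -> Prop :=
| nc_one : normal_closure x0 S (cst x0)
| nc_gen l p : S l -> path_in [set: X] x0 (l 0) p ->
    normal_closure x0 S (path_cat p (path_cat l (path_rev p)))
| nc_mul l l' : normal_closure x0 S l -> normal_closure x0 S l' ->
    normal_closure x0 S (path_cat l l')
| nc_inv l : normal_closure x0 S l -> normal_closure x0 S (path_rev l)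
| nc_homotopic l l' : normal_closure x0 S l -> homotopic [set: X] l l' ->
    normal_closure x0 S l'.

(* pi_1(X, x0) / <<S>> = 1 *)
Definition pi1_quotient_trivial (R : realType) (X : topologicalType) (x0 : X)
    (S : set (R -> X)) : Prop :=
  forall l, loop_in [set: X] x0 l -> normal_closure x0 S l.

Definition simply_connected (R : realType) (X : topologicalType) : Prop :=
  [/\ [set: X] !=set0,
      forall p q : X, exists l : R -> X, path_in [set: X] p q l &
      forall (p : X) (l : R -> X),
        loop_in [set: X] p l -> pi1_trivial_class [set: X] l].

(* Maps out of T^2 = R^2 / Z^2 are Z^2-periodic maps out of R^2. *)
Definition torus_eq (R : realType) (n : nat) (x y : 'rV[R]_n) : Prop :=
  exists z : 'rV[int]_n, y = x + map_mx intr z.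

Definition torus_periodic (R : realType) (n : nat) (X : Type)
    (f : 'rV[R]_n -> X) : Prop := forall x y, torus_eq x y -> f x = f y.

(* A smooth embedding T^2 -> M; the torus is oriented by the parametrization. *)
Definition embedded_torus (R : realType) (n : nat) (M : charted_space R n)
    (f : 'rV[R]_2 -> M) : Prop :=
  [/\ smooth_map f,
      forall x y, f x = f y <-> torus_eq x y &
      forall a x, atlas M a -> a.1 (f x) ->
        row_free (jacobian (a.2 \o f) x)].

Definition torus_homotopic (R : realType) (X : topologicalType)
    (f h : 'rV[R]_2 -> X) : Prop :=
  exists F : R * 'rV[R]_2 -> X,
    [/\ {within `[0, 1] `*` [set: 'rV[R]_2], continuous F},
        {in `[0, 1], forall s, torus_periodic (fun x => F (s, x))},
        forall x, F (0, x) = f x & forall x, F (1, x) = h x].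

(* Pairs of points of T^2, represented in the half-open unit square, at which
   f and h meet. *)
Definition intersections (R : realType) (X : Type) (f h : 'rV[R]_2 -> X) :
    set ('rV[R]_2 * 'rV[R]_2) :=
  [set p : 'rV[R]_2 * 'rV[R]_2 |
    [/\ forall j, 0 <= p.1 0 j < 1, forall j, 0 <= p.2 0 j < 1 &
        f p.1 = h p.2]].

(* The self-intersection number of the torus f is k: f meets some perturbation h
   (a map homotopic to f) transversely, and the signed number of intersection
   points is k. *)
Definition self_intersection (R : realType) (M : charted_space R 4)
    (f : 'rV[R]_2 -> M) (k : int) : Prop :=
  exists (h : 'rV[R]_2 -> M) (sign : 'rV[R]_2 * 'rV[R]_2 -> int),
    [/\ smooth_map h,
        torus_homotopic f h,
        finite_set (intersections f h),
        forall p, intersections f h p ->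
          forall a, atlas M a -> a.1 (f p.1) ->
            let d := \det (col_mx (jacobian (a.2 \o f) p.1)
                                  (jacobian (a.2 \o h) p.2) : 'M[R]_4) in
            d != 0 /\ sign p = sgz d &
        \sum_(p \in intersections f h) sign p = k].

Definition square_zero_torus (R : realType) (M : charted_space R 4)
    (f : 'rV[R]_2 -> M) : Prop :=
  embedded_torus f /\ self_intersection f 0.

(* phi is an orientation preserving diffeomorphism of T^2 x R^2 onto an open
   subset of M that extends f on T^2 x 0. The closed tubular neighbourhood
   proper is [tube phi], the image of T^2 x D^2. *)
Definition tubular_nbhd (R : realType) (M : charted_space R 4)
    (f : 'rV[R]_2 -> M) (phi : 'rV[R]_(2 + 2) -> M) : Prop :=
  [/\ smooth_map phi,
      forall x y, phi x = phi y <->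
        torus_eq (lsubmx x) (lsubmx y) /\ rsubmx x = rsubmx y,
      forall V, open V -> open (phi @` V),
      forall a x, atlas M a -> a.1 (phi x) ->
        0 < \det (jacobian (a.2 \o phi) x : 'M[R]_4) &
      forall x, phi (row_mx x 0) = f x].

Definition tube (R : realType) (X : Type) (phi : 'rV[R]_(2 + 2) -> X) : set X :=
  phi @` [set x | sqnorm (rsubmx x) <= 1].

Definition tube_boundary (R : realType) (X : Type)
    (phi : 'rV[R]_(2 + 2) -> X) : set X :=
  phi @` [set x | sqnorm (rsubmx x) = 1].

Definition unit_circle (R : realType) (t : R) : 'rV[R]_2 :=
  \row_(j < 2) (if j == 0 then cos (2 * pi * t) else sin (2 * pi * t)).

(* The parametrization of the 3-torus tube_boundary phi by R^3 / Z^3. *)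
Definition boundary_param (R : realType) (X : Type)
    (phi : 'rV[R]_(2 + 2) -> X) (x : 'rV[R]_(2 + 1)) : X :=
  phi (row_mx (lsubmx x) (unit_circle (rsubmx x 0 0))).

(* The boundary of a normal disk, with either orientation. *)
Definition is_meridian (R : realType) (X : topologicalType)
    (phi : 'rV[R]_(2 + 2) -> X) (l : R -> X) : Prop :=
  let m := fun t : R => phi (row_mx 0 (unit_circle t)) in
  free_homotopic (tube_boundary phi) l m \/
  free_homotopic (tube_boundary phi) l (path_rev m).

Definition boundary_basis (R : realType) (X : topologicalType)
    (phi : 'rV[R]_(2 + 2) -> X) (l1 l2 l3 : R -> X) : Prop :=
  exists2 p, tube_boundary phi p & pi1_basis (tube_boundary phi) p l1 l2 l3.

Definition exterior (R : realType) (X : topologicalType) (r : nat)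
    (phi : 'I_r -> 'rV[R]_(2 + 2) -> X) : set X :=
  ~` (\bigcup_i tube (phi i))°.

Definition torus_exterior (R : realType) (X : topologicalType)
    (phi : 'rV[R]_(2 + 2) -> X) : set X := ~` (tube phi)°.

(* g restricts to a diffeomorphism between the boundary 3-tori, and reverses the
   orientations they have as boundaries of the exteriors. Both phi and psi
   preserve the orientation and both boundaries have the orientation opposite
   to that of the boundary of the tube, so that the condition is on the sign of
   the Jacobian in the coordinates of T^3; H is a lift of g to R^3. *)
Definition gluing_diffeo (R : realType) (X Y : Type)
    (phi : 'rV[R]_(2 + 2) -> X) (psi : 'rV[R]_(2 + 2) -> Y)
    (g : X -> Y) : Prop :=
  set_bij (tube_boundary phi) (tube_boundary psi) g /\
  exists H : 'rV[R]_(2 + 1) -> 'rV[R]_(2 + 1),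
    [/\ smooth_on [set: 'rV[R]_(2 + 1)] H,
        forall x, g (boundary_param phi x) = boundary_param psi (H x) &
        forall x, \det (jacobian H x) < 0].

Definition loop_orient (R : realType) (X : Type) (e : bool) (l : R -> X) :=
  if e then path_rev l else l.

(* g maps the classes a1, a2, a3 to b1, b2, b3, with at most one of the latter
   inverted. The fundamental group of the target 3-torus being abelian, its
   elements are the free homotopy classes of loops. *)
Definition maps_basis (R : realType) (X : Type) (Y : topologicalType)
    (B : set Y) (g : X -> Y) (a1 a2 a3 : R -> X) (b1 b2 b3 : R -> Y) : Prop :=
  exists e1 e2 e3 : bool,
    [/\ (e1 + e2 + e3 <= 1)%N,
        free_homotopic B (g \o a1) (loop_orient e1 b1),
        free_homotopic B (g \o a2) (loop_orient e2 b2) &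
        free_homotopic B (g \o a3) (loop_orient e3 b3)].

Section Gluing.
Local Open Scope quotient_scope.
Context (X Y : topologicalType) (r : nat) (W : set X) (C : 'I_r -> set Y)
  (D : 'I_r -> set X) (g : 'I_r -> X -> Y).

Definition piece (k : option 'I_r) : topologicalType :=
  match k with
  | None => set_type W
  | Some i => set_type (C i)
  end.

Inductive glue_step : {k & piece k} -> {k & piece k} -> Prop :=
| GlueStep (i : 'I_r) (x : set_type W) (y : set_type (C i)) :
    D i (set_val x) -> g i (set_val x) = set_val y ->
    glue_step (existT piece None x) (existT piece (Some i) y).

Definition glue_rel (a b : {k & piece k}) : bool :=
  `[< clos_refl_sym_trans {k & piece k} glue_step a b >].

Lemma glue_rel_refl : reflexive glue_rel.
Proof. by move=> a; apply/asboolP; exact: rst_refl. Qed.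

Lemma glue_rel_sym : symmetric glue_rel.
Proof. by move=> a b; apply/asboolP/asboolP; exact: rst_sym. Qed.

Lemma glue_rel_trans : transitive glue_rel.
Proof.
move=> b a c /asboolP ab /asboolP bc; apply/asboolP.
exact: rst_trans ab bc.
Qed.

Canonical glue_equiv :=
  EquivRel glue_rel glue_rel_refl glue_rel_sym glue_rel_trans.

(* The disjoint union of W and the C i, modulo x ~ g i x for x in D i. *)
Definition glued_space : topologicalType :=
  quotient_topology {eq_quot glue_equiv}.

End Gluing.

(* Main.v *)
(* Fundamental groups are replaced by local systems: on a connected and locally
   nice space X, the universal local system with group pi_1(X) has a global
   parallel section only if X is simply connected, so it is enough that all the
   local systems on the glued manifold be trivial. On C_i the holonomy along v_i
   is trivial, hence so is the holonomy along rho_i on W, and the local system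
   extends from W over the tubes of the R_i to M. There it has trivial holonomy
   along eta_i, hence along mu_i, so that the local system on C_i extends to S^4
   and is trivial. In particular its holonomy along u_i, that is along lambda_i,
   is trivial; as the lambda_i normally generate pi_1(M), the local system on M is
   trivial. Since the seams are connected, the parallel sections on W and on the
   C_i match after translation of the latter. *)
From HB Require Import structures.
From Stdlib Require Import Relation_Operators.
Require Import Defs.
From mathcomp Require Import all_boot all_order all_algebra generic_quotient.
From mathcomp Require Import all_classical all_reals all_analysis.
From mathcomp Require Import ring lra.
Import Order.TTheory GRing.Theory Num.Theory.
Import numFieldNormedType.Exports.
Set Implicit Arguments.
Unset Strict Implicit.
Unset Printing Implicit Defensive.
Local Open Scope classical_set_scope.
Local Open Scope ring_scope.

(** Working with sections instead of groups replaces amalgamated products by gluing along connected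
    overlaps. The structure group is arbitrary, in general not abelian, so only the triviality of a
    holonomy is ever carried from one loop to another: it survives conjugation and inversion, hence
    changes of base point, free homotopies, an inverted basis element and both orientations of a
    meridian. Two points need real constructions. Radial projection pulls the transport back to a
    tube minus its core torus but has no continuous extension to the core. There the transport is
    written down by means of a section over the universal cover of the boundary 3-torus, which is
    periodic in the angle exactly because the meridian has trivial holonomy. The criterion for
    simple connectivity requires small contractible neighbourhoods in the glued space. Off the seams
    they come from the pieces. On a seam the tube chart of one side is continued into the other side
    by inverting the radius. *)

(** * Local systems and their parallel sections *)

Lemma locally_constant_connected (Z : topologicalType) (T : Type) (A : set Z)
    (f : Z -> T) :
  connected A ->
  (forall z, A z -> \forall z' \near z, A z' -> f z' = f z) ->
  forall x y, A x -> A y -> f y = f x.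
Proof.
move=> cA fA x y Ax Ay.
pose B := A `&` [set z | f z = f x].
suff BA : B = A by have [] : B y by rewrite BA.
apply: cA.
- by exists x.
- exists (interior [set z | A z -> f z = f x]); first exact: open_interior.
  apply/seteqP; split => [z [Az fz]|z [Az /interior_subset]].
    split=> //; have := fA z Az; rewrite /interior/=.
    by apply: filterS => w fw Aw; rewrite fw.
  by move=> /(_ Az).
- exists (~` interior [set z | A z -> f z <> f x]).
    by apply: open_closedC; exact: open_interior.
  apply/seteqP; split => [z [Az fz]|z [Az] /= zB].
    split=> // /interior_subset /(_ Az); exact.
  split=> //; apply: contrapT => fz; apply: zB.
  rewrite /interior/=; have := fA z Az.
  by apply: filterS => w fw Aw; rewrite fw.
Qed.

(* A local system with structure group G is encoded by its parallel transport
   [c z z'] from z to nearby points z': only the germ of [c z] at z matters. *)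
Section parallel.
Context (G : groupType).
Local Open Scope group_scope.

Definition parallel (Z : topologicalType) (A : set Z) (c : Z -> Z -> G)
    (h : Z -> G) : Prop :=
  forall z, A z -> \forall z' \near z, A z' -> h z' = h z * c z z'.

(** Only local sections are required: no cocycle identity is imposed on [c], whose values away from
    the diagonal are arbitrary. *)
Definition flat (Z : topologicalType) (A : set Z) (c : Z -> Z -> G) : Prop :=
  forall z, A z -> exists U h, nbhs z U /\ parallel (A `&` U) c h.

Definition pull (Y Z : Type) (f : Y -> Z) (c : Z -> Z -> G) : Y -> Y -> G :=
  fun y y' => c (f y) (f y').

Context (Z : topologicalType).
Implicit Types (A B : set Z) (c : Z -> Z -> G) (h : Z -> G).

Lemma parallel_sub A B c h : A `<=` B -> parallel B c h -> parallel A c h.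
Proof.
move=> AB Bh z Az; have := Bh z (AB _ Az).
by apply: filterS => w hw Aw; apply: hw; exact: AB.
Qed.

Lemma flat_sub A B c : A `<=` B -> flat B c -> flat A c.
Proof.
move=> AB Bh z Az; have [U [h [zU Uh]]] := Bh z (AB _ Az).
by exists U, h; split=> //; apply: parallel_sub Uh; exact: setSI.
Qed.

Lemma eq_parallel A c c' h h' : (forall z z', A z -> A z' -> c z z' = c' z z') ->
  (forall z, A z -> h z = h' z) -> parallel A c h -> parallel A c' h'.
Proof.
move=> cc' hh' Ah z Az; have := Ah z Az.
by apply: filterS => w hw Aw; rewrite -!hh'// -cc'// hw.
Qed.

Lemma parallel_mull A c h a : parallel A c h -> parallel A c (fun z => a * h z).
Proof.
move=> Ah z Az; have := Ah z Az.
by apply: filterS => w hw Aw; rewrite hw// mulgA.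
Qed.

(** Transport acts on the right, so it cancels in [h' z * (h z)^-1]. This ratio is locally constant,
    and sections over a connected set differ by a left translation. *)
Lemma parallel_unique A c h h' : connected A -> parallel A c h ->
  parallel A c h' -> exists a, forall z, A z -> h' z = a * h z.
Proof.
move=> cA Ah Ah'; have [[x Ax]|A0] := pselect (A !=set0); last first.
  by exists 1 => z Az; exfalso; apply: A0; exists z.
exists (h' x * (h x)^-1) => z Az.
rewrite -(@locally_constant_connected _ _ A (fun z => h' z * (h z)^-1) cA _ x z)//.
  by rewrite mulgVK.
move=> w Aw; have := Ah w Aw; have := Ah' w Aw.
apply: filterS2 => v h'v hv Av.
by rewrite h'v// hv// invgM mulgA mulgK.
Qed.

Lemma parallel_unique_eq A c h h' x : connected A -> parallel A c h ->
  parallel A c h' -> A x -> h x = h' x -> forall z, A z -> h z = h' z.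
Proof.
move=> cA Ah Ah' Ax hx z Az; have [a ha] := parallel_unique cA Ah Ah'.
rewrite ha//; suff -> : a = 1 by rewrite mul1g.
by apply: (mulIg (h x)); rewrite mul1g -ha.
Qed.

(* The hypotheses on A and B hold when both are closed, and when both are open. *)
Lemma parallel_glue_eq A B c h h' :
  (forall z, A z -> ~ B z -> \forall z' \near z, B z' -> A z') ->
  (forall z, B z -> ~ A z -> \forall z' \near z, A z' -> B z') ->
  parallel A c h -> parallel B c h' -> (forall z, A z -> B z -> h z = h' z) ->
  exists k, [/\ parallel (A `|` B) c k, forall z, A z -> k z = h z &
    forall z, B z -> k z = h' z].
Proof.
move=> AB BA Ah Bh hh'.
pose k z := if pselect (A z) then h z else h' z.
have kA z : A z -> k z = h z by rewrite /k; case: pselect.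
have kB z : B z -> k z = h' z by rewrite /k; case: pselect => // Az Bz; exact: hh'.
have [kAp kBp] : parallel A c k /\ parallel B c k.
  by split; [apply: eq_parallel Ah => // z /kA|apply: eq_parallel Bh => // z /kB].
exists k; split=> // z ABz.
have [Az|Az] := pselect (A z); have [Bz|Bz] := pselect (B z).
- have := kAp z Az; have := kBp z Bz.
  by apply: filterS2 => w kBw kAw [Aw|Bw]; [exact: kAw|exact: kBw].
- have := kAp z Az; have := AB z Az Bz.
  by apply: filterS2 => w wBA kAw [Aw|/wBA Aw]; exact: kAw.
- have := kBp z Bz; have := BA z Bz Az.
  by apply: filterS2 => w wBA kAw [/wBA Aw|Aw]; exact: kAw.
- by case: ABz.
Qed.

(** Connectedness of the overlap makes the discrepancy between the two sections a single constant
    there, which is absorbed into the second one. *)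
Lemma parallel_glue A B c h h' :
  (forall z, A z -> ~ B z -> \forall z' \near z, B z' -> A z') ->
  (forall z, B z -> ~ A z -> \forall z' \near z, A z' -> B z') ->
  connected (A `&` B) -> parallel A c h -> parallel B c h' ->
  exists k, parallel (A `|` B) c k.
Proof.
move=> AB BA cAB Ah Bh'.
have [|||a ah] := @parallel_unique (A `&` B) c h' h => //.
- by apply: parallel_sub Bh'; exact: subIsetr.
- by apply: parallel_sub Ah; exact: subIsetl.
- have [|k [kP _ _]] := parallel_glue_eq AB BA Ah (parallel_mull a Bh').
    by move=> z Az Bz; rewrite ah.
  by exists k.
Qed.

Lemma closed_separated A B : closed A -> closed B ->
  (forall z, A z -> ~ B z -> \forall z' \near z, B z' -> A z') /\
  (forall z, B z -> ~ A z -> \forall z' \near z, A z' -> B z').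
Proof.
move=> clA clB; split=> z _.
- have oB : open (~` B) by exact: closed_openC.
  by move=> Bz; have := open_nbhs_nbhs (conj oB Bz); apply: filterS.
- have oB : open (~` A) by exact: closed_openC.
  by move=> Bz; have := open_nbhs_nbhs (conj oB Bz); apply: filterS.
Qed.

Lemma open_separated A B : open A -> open B ->
  (forall z, A z -> ~ B z -> \forall z' \near z, B z' -> A z') /\
  (forall z, B z -> ~ A z -> \forall z' \near z, A z' -> B z').
Proof.
move=> oA oB; split=> z Az _.
- by have := open_nbhs_nbhs (conj oA Az); apply: filterS.
- by have := open_nbhs_nbhs (conj oB Az); apply: filterS.
Qed.

End parallel.

(** * Relative continuity and pullback of local systems *)

Lemma within_continuousP (X Y : topologicalType) (A : set X) (f : X -> Y) :
  {within A, continuous f} <->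
  forall x (P : set Y), A x -> nbhs (f x) P -> \forall x' \near x, A x' -> P (f x').
Proof.
rewrite subspace_continuousP; split => [cf x P Ax|cf x Ax P]; first exact: cf.
exact: cf.
Qed.

Section within_continuous.
Context (X Y Z : topologicalType).

Lemma within_continuous_compose (A : set X) (B : set Y) (f : X -> Y) (g : Y -> Z) :
  {within A, continuous f} -> f @` A `<=` B -> {within B, continuous g} ->
  {within A, continuous (g \o f)}.
Proof.
move=> /within_continuousP cf fAB /within_continuousP cg.
apply/within_continuousP => x P Ax gP.
have := cf x _ Ax (cg _ _ (fAB _ (imageP f Ax)) gP).
by apply: filterS => w wP Aw; apply: wP => //; apply: fAB; exists w.
Qed.

Lemma within_continuous_eq (A : set X) (f g : X -> Y) :
  (forall x, A x -> f x = g x) -> {within A, continuous f} ->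
  {within A, continuous g}.
Proof.
move=> fg /within_continuousP cf; apply/within_continuousP => x P Ax.
by rewrite -fg// => /(cf _ _ Ax); apply: filterS => w wP Aw; rewrite -fg//; exact: wP.
Qed.

Lemma within_continuous_at (A : set X) (f : X -> Y) :
  (forall x, A x -> {for x, continuous f}) -> {within A, continuous f}.
Proof.
move=> cf; apply/within_continuousP => x P Ax fP.
have : nbhs x (f @^-1` P) by exact: cf x Ax P fP.
by apply: filterS => w Pw _.
Qed.

Lemma within_continuous_sub (A B : set X) (f : X -> Y) :
  A `<=` B -> {within B, continuous f} -> {within A, continuous f}.
Proof. by move=> AB; exact: continuous_subspaceW. Qed.

End within_continuous.

Section pullback.
Context (G : groupType) (Y Z : topologicalType).
Local Open Scope group_scope.

Lemma within_continuous_near (A : set Y) (f : Y -> Z) y (P : set Z) :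
  {within A, continuous f} -> A y -> nbhs (f y) P ->
  \forall y' \near y, A y' -> P (f y').
Proof. by move=> /subspace_continuousP /(_ y) + Ay => /(_ Ay); exact. Qed.

Lemma parallel_pull (A : set Y) (B : set Z) (f : Y -> Z) (c : Z -> Z -> G) h :
  {within A, continuous f} -> f @` A `<=` B -> parallel B c h ->
  parallel A (pull f c) (h \o f).
Proof.
move=> cf fAB Bh y Ay; have By : B (f y) by apply: fAB; exists y.
have := within_continuous_near cf Ay (Bh _ By).
by apply: filterS => w hw Aw /=; apply: hw => //; apply: fAB; exists w.
Qed.

Lemma flat_pull (A : set Y) (B : set Z) (f : Y -> Z) (c : Z -> Z -> G) :
  {within A, continuous f} -> f @` A `<=` B -> flat B c -> flat A (pull f c).
Proof.
move=> cf fAB Bc y Ay; have By : B (f y) by apply: fAB; exists y.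
have [U [h [yU Uh]]] := Bc _ By.
exists [set y | A y -> U (f y)], (h \o f); split.
  exact: within_continuous_near.
apply: parallel_pull Uh; first exact: continuous_subspaceW cf.
by move=> _ [w [Aw Uw] <-]; split; [apply: fAB; exists w|exact: Uw].
Qed.

End pullback.

Lemma cvg_to_pair (X : Type) (Y Z : topologicalType) (F : set_system X)
    (FF : Filter F) (f : X -> Y) (g : X -> Z) (y : Y) (z : Z) :
  f @ F --> y -> g @ F --> z -> (fun t => (f t, g t)) @ F --> (y, z).
Proof. by move=> fF gF; apply: (@cvg_pair X Y Z F (nbhs y) (nbhs z)). Qed.

(** * Local systems on the interval and on the square *)

(** A supremum argument that stands in for Lebesgue numbers: [P] is additive on adjacent intervals
    and holds on all short intervals around a given point, so the set of [t] with [P 0 t] cannot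
    stop before 1. *)
Lemma interval_induction (R : realType) (P : R -> R -> Prop) :
  (forall a b c, 0 <= a -> a <= b -> b <= c -> c <= 1 ->
    P a b -> P b c -> P a c) ->
  (forall x, 0 <= x <= 1 -> exists2 e, 0 < e &
    forall a b, 0 <= a -> a <= x -> x <= b -> b <= 1 ->
      x - e < a -> b < x + e -> P a b) ->
  P 0 1.
Proof.
move=> Padd Ploc.
pose S := [set t : R | 0 <= t <= 1 /\ P 0 t].
have S0 : S 0.
  split; first lra.
  have [|e e0] := Ploc 0; first lra.
  by apply => //; lra.
have hS : has_sup S by split; [exists 0|exists 1 => t [] /andP[]].
have s0 : 0 <= sup S by apply: sup_upper_bound.
have s1 : sup S <= 1 by apply: ge_sup; [exists 0|move=> t [] /andP[]].
have [|e e0 Pe] := Ploc (sup S); first lra.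
have [t [/andP[t0 t1] Pt] st] := sup_adherent e0 hS.
have ts : t <= sup S by apply: sup_upper_bound => //; split => //; lra.
(* The interval is pushed beyond [sup S] and cut at 1. As [b] still belongs to [S], the cut must
   have been effective. *)
pose b := Num.min (sup S + e / 2) 1.
have [bs b1] : sup S <= b /\ b <= 1.
  by rewrite /b; split; [rewrite le_min; lra|rewrite ge_min lexx orbT].
have be : b < sup S + e by rewrite /b gt_min; apply/orP; left; lra.
have Pb : P 0 b.
  apply: (Padd _ t) => //; first lra.
  by apply: Pe => //; lra.
have bS : b <= sup S by apply: sup_upper_bound => //; split => //; lra.
suff <- : b = 1 by [].
move: bS; rewrite /b ge_min => /orP[|]; first lra.
by move=> ?; apply/min_idPr; lra.
Qed.

Section parallel_square.
Context (R : realType) (G : groupType).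
Local Open Scope group_scope.
Local Open Scope ring_scope.

Lemma parallel_interval (c : R -> R -> G) :
  @flat G R `[0, 1] c -> exists h, @parallel G R `[0, 1] c h.
Proof.
move=> fc.
apply: (@interval_induction R (fun a b => exists h, @parallel G R `[a, b] c h)).
  move=> x y z x0 xy yz z1 [h hP] [h' h'P].
  have [AB BA] := @closed_separated R `[x, y] `[y, z]
    (@itv_closed _ _ x y) (@itv_closed _ _ y z).
  have [|k kP] := parallel_glue AB BA _ hP h'P.
    have -> : `[x, y] `&` `[y, z] = [set y].
      apply/seteqP; split => t /=; rewrite !in_itv/=; first by move=> ?; lra.
      by move=> ->; lra.
    exact: connected1.
  exists k; apply: parallel_sub kP => t /=; rewrite !in_itv/=.
  by move=> /andP[? ?]; have [ty|ty] := leP t y; [left|right]; rewrite /= ?in_itv/= ?andbT; lra.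
move=> x x01; have [|U [h [xU hP]]] := fc x; first by rewrite /= in_itv.
have /nbhs_ballP[e /= e0 eU] := xU.
exists e => // a b a0 ax xb b1 ae be; exists h.
apply: parallel_sub hP => t /=; rewrite !in_itv/= => /andP[ta tb]; split; first by lra.
by apply: eU; rewrite /ball/= ltr_norml; lra.
Qed.

Lemma connected_setX1l (x a b : R) : connected ([set x] `*` `[a, b] : set (R * R)).
Proof.
have -> : ([set x] `*` `[a, b] : set (R * R)) = (fun t : R => (x, t)) @` `[a, b].
  apply/seteqP; split => [[u v] /= [-> vab]|_ [t tab <-]]; last by [].
  by exists v.
apply: connected_continuous_connected; first exact: segment_connected.
by apply: continuous_subspaceT => t; apply: cvg_to_pair; [exact: cvg_cst|exact: cvg_id].
Qed.

Lemma connected_setX1r (x a b : R) : connected (`[a, b] `*` [set x] : set (R * R)).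
Proof.
have -> : (`[a, b] `*` [set x] : set (R * R)) = (fun t : R => (t, x)) @` `[a, b].
  apply/seteqP; split => [[u v] /= [vab ->]|_ [t tab <-]]; last by [].
  by exists u.
apply: connected_continuous_connected; first exact: segment_connected.
by apply: continuous_subspaceT => t; apply: cvg_to_pair; [exact: cvg_id|exact: cvg_cst].
Qed.

Lemma closed_rectangle (a b c d : R) : closed (`[a, b] `*` `[c, d] : set (R * R)).
Proof.
have -> : (`[a, b] `*` `[c, d] : set (R * R)) = fst @^-1` `[a, b] `&` snd @^-1` `[c, d] by [].
apply: closedI; apply: closed_comp; [|exact: itv_closed| |exact: itv_closed].
  by move=> [t u] _; exact: cvg_fst.
by move=> [t u] _; exact: cvg_snd.
Qed.

(** Two nested inductions. Over a fixed first coordinate [x] the inner one climbs the vertical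
    segment, keeping a positive width at each stage; the outer one glues the strips so obtained
    along vertical segments, which are connected. *)
Lemma parallel_square (c : R * R -> R * R -> G) :
  @flat G (R * R)%type (`[0, 1] `*` `[0, 1]) c ->
  exists h, @parallel G (R * R)%type (`[0, 1] `*` `[0, 1]) c h.
Proof.
move=> fc.
apply: (@interval_induction R (fun a b => exists h, @parallel G (R * R)%type (`[a, b] `*` `[0, 1]) c h)).
  move=> x y z x0 xy yz z1 [h hP] [h' h'P].
  have [AB BA] := @closed_separated (R * R)%type (`[x, y] `*` `[0, 1]) (`[y, z] `*` `[0, 1])
    (@closed_rectangle _ _ _ _) (@closed_rectangle _ _ _ _).
  have [|k kP] := parallel_glue AB BA _ hP h'P.
    have -> : (`[x, y] `*` `[0, 1] : set (R * R)) `&` (`[y, z] `*` `[0, 1]) = [set y] `*` `[0, 1].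
      apply/seteqP; split => -[t u] /=; rewrite !in_itv/=.
        by move=> [[? ?] [? _]]; split=> //; lra.
      by move=> [-> ?]; rewrite !lexx xy yz.
    exact: connected_setX1l.
  exists k; apply: parallel_sub kP => -[t u] /=; rewrite !in_itv/=.
  by move=> [/andP[? ?] ?]; have [ty|ty] := leP t y; [left|right]; split; rewrite /= ?in_itv/= ?andbT; lra.
move=> x x01.
have [h [e e0 hP]] : exists h, exists2 e, 0 < e &
    @parallel G (R * R)%type ((`[0, 1] `&` `]x - e, x + e[) `*` `[0, 1]) c h; last first.
  exists e => // a b a0 ax xb b1 ae be; exists h; apply: parallel_sub hP => -[t u] /=.
  by rewrite !in_itv/= => -[/andP[ta tb] ?]; split => //; split; lra.
have : exists2 e, 0 < e & exists h,
    @parallel G (R * R)%type ((`[0, 1] `&` `[x - e, x + e]) `*` `[0, 1]) c h.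
  apply: (@interval_induction R (fun a b => exists2 e, 0 < e & exists h,
    @parallel G (R * R)%type ((`[0, 1] `&` `[x - e, x + e]) `*` `[a, b]) c h)).
    move=> p q s p0 pq qs s1 [e e0 [h hP]] [e' e'0 [h' h'P]].
    (* The lower and the upper box have different widths; both are cut down to the smaller one.
       Their common base is then written as one segment [I], to which the facts on rectangles
       apply. *)
    pose d := Num.min e e'.
    have [de de'] : d <= e /\ d <= e' by rewrite /d !ge_min !lexx orbT.
    pose I : set R := `[Num.max 0 (x - d), Num.min 1 (x + d)]%classic.
    have IE : I `<=` `[0, 1] `&` `[x - d, x + d].
      by move=> t; rewrite /I/= ?in_itv/= le_min ge_max => /andP[/andP[? ?] /andP[? ?]]; split; lra.
    have EI : `[0, 1] `&` `[x - d, x + d] `<=` I.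
      by move=> t [] /=; rewrite /I/= !in_itv/= le_min ge_max; lra.
    have hP' : @parallel G (R * R)%type (I `*` `[p, q]) c h.
      by apply: parallel_sub hP => -[t u] [/IE []]/=; rewrite !in_itv/=; split=> //; split=> //; lra.
    have h'P' : @parallel G (R * R)%type (I `*` `[q, s]) c h'.
      by apply: parallel_sub h'P => -[t u] [/IE []]/=; rewrite !in_itv/=; split=> //; split=> //; lra.
    have [AB BA] := @closed_separated (R * R)%type (I `*` `[p, q]) (I `*` `[q, s])
      (@closed_rectangle _ _ _ _) (@closed_rectangle _ _ _ _).
    have [|k kP] := parallel_glue AB BA _ hP' h'P'.
      have -> : (I `*` `[p, q]) `&` (I `*` `[q, s]) = I `*` [set q].
        apply/seteqP; split => -[t u] /=; rewrite !in_itv/=.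
          by move=> [[? ?] [? ?]]; split=> //; lra.
        by move=> [? ->]; rewrite !lexx pq qs.
      exact: connected_setX1r.
    exists d; first by rewrite /d lt_min e0.
    exists k; apply: parallel_sub kP => -[t u] [/EI ?] /=; rewrite !in_itv/=.
    by move=> /andP[? ?]; have [ty|ty] := leP u q; [left|right]; split => //; rewrite /= ?in_itv/= ?andbT; lra.
  move=> y y01; have [|U [h [xU hP]]] := fc (x, y); first by split; rewrite /= in_itv.
  have /nbhs_ballP[e /= e0 eU] := xU.
  (* Half of the radius, so that the closed strip lies in the open ball. *)
  exists e => // a b a0 ax xb b1 ae be; exists (e / 2); first lra.
  exists h; apply: parallel_sub hP => -[t u] /=; rewrite !in_itv/=.
  move=> [[? ?] ?]; split; first by split; rewrite /= ?in_itv/=; lra.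
  by apply: eU; split; rewrite /ball/= ltr_norml; lra.
move=> [e e0 [h hP]]; exists h, e => //; apply: parallel_sub hP => -[t u] /=.
by rewrite !in_itv/= => -[[? ?] ?]; split=> //; split=> //; lra.
Qed.

End parallel_square.

(** * Paths and holonomy *)

Section paths.
Context (R : realType) (X : topologicalType).
Implicit Types (A : set X) (l : R -> X).

Lemma halves_cover : (`[0, 1]%classic : set R) `<=` `[0, 2^-1] `|` `[2^-1, 1].
Proof.
move=> t /=; rewrite !in_itv/= => /andP[? ?].
by have [?|?] := leP t 2^-1; [left|right]; rewrite ?andbT; lra.
Qed.

Lemma path_cat_left l l' (t : R) : `[0, 2^-1]%classic t -> path_cat l l' t = l (2 * t).
Proof. by rewrite /= in_itv/= /path_cat => /andP[_ ->]. Qed.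

Lemma path_cat_right l l' (t : R) : l 1 = l' 0 -> `[2^-1, 1]%classic t ->
  path_cat l l' t = l' (2 * t - 1).
Proof.
rewrite /= in_itv/= /path_cat => ll' /andP[t2 _].
case: ifPn => // t2'; have -> : t = 2^-1 by lra.
by rewrite mulfV// subrr.
Qed.

Lemma continuous_double : continuous (fun t : R => 2 * t).
Proof. by move=> t; apply: cvgM; [exact: cvg_cst|exact: cvg_id]. Qed.

Lemma continuous_double_sub1 : continuous (fun t : R => 2 * t - 1).
Proof. by move=> t; apply: cvgB; [exact: continuous_double|exact: cvg_cst]. Qed.

Lemma continuous_flip : continuous (fun t : R => 1 - t).
Proof. by move=> t; apply: cvgB; [exact: cvg_cst|exact: cvg_id]. Qed.

Lemma double_itv : (fun t : R => 2 * t) @` `[0, 2^-1] `<=` `[0, 1].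
Proof. by move=> _ [t /= + <-]; rewrite !in_itv/=; lra. Qed.

Lemma double_sub1_itv : (fun t : R => 2 * t - 1) @` `[2^-1, 1] `<=` `[0, 1].
Proof. by move=> _ [t /= + <-]; rewrite !in_itv/=; lra. Qed.

Lemma flip_itv : (fun t : R => 1 - t) @` `[0, 1] `<=` `[0, 1].
Proof. by move=> _ [t /= + <-]; rewrite !in_itv/=; lra. Qed.

Lemma itv01P (t : R) : 0 <= t <= 1 -> `[0, 1]%classic t.
Proof. by rewrite /= in_itv. Qed.

Lemma path_cat0 l l' : path_cat l l' 0 = l 0.
Proof. by rewrite /path_cat invr_ge0 ler0n mulr0. Qed.

Lemma path_cat1 l l' : path_cat l l' 1 = l' 1.
Proof.
rewrite /path_cat ifF; last by apply/negbTE; lra.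
by congr (l' _); lra.
Qed.

Lemma path_in_cat A p q s l l' : path_in A p q l -> path_in A q s l' ->
  path_in A p s (path_cat l l').
Proof.
move=> [cl lA l0 l1] [cl' l'A l'0 l'1].
have ll' : l 1 = l' 0 by rewrite l1 l'0.
split; last 2 first.
- by rewrite path_cat0.
- by rewrite path_cat1.
- apply: within_continuous_sub halves_cover _.
  apply: withinU_continuous; [exact: itv_closed|exact: itv_closed| |].
  + apply: within_continuous_eq (_ : {within _, continuous (l \o (fun t => 2 * t))}).
      by move=> t ?; rewrite path_cat_left.
    apply: (within_continuous_compose _ double_itv cl).
    by apply: continuous_subspaceT; exact: continuous_double.
  + apply: within_continuous_eq (_ : {within _, continuous (l' \o (fun t => 2 * t - 1))}).
      by move=> t ?; rewrite path_cat_right.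
    apply: (within_continuous_compose _ double_sub1_itv cl').
    by apply: continuous_subspaceT; exact: continuous_double_sub1.
- move=> _ [t /halves_cover [] tI <-].
  + rewrite path_cat_left//; apply: lA; exists (2 * t) => //.
    by apply: double_itv; exists t.
  + rewrite path_cat_right//; apply: l'A; exists (2 * t - 1) => //.
    by apply: double_sub1_itv; exists t.
Qed.

Lemma path_in_rev A p q l : path_in A p q l -> path_in A q p (path_rev l).
Proof.
move=> [cl lA l0 l1]; split; rewrite /path_rev ?subr0 ?subrr//.
- apply: (within_continuous_compose (f := fun t : R => 1 - t) _ flip_itv cl).
  by apply: continuous_subspaceT; exact: continuous_flip.
- move=> _ [t tI <-]; apply: lA; exists (1 - t) => //.
  by apply: flip_itv; exists t.
Qed.

Lemma path_in_cst A p : A p -> path_in A p p (cst p : R -> X).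
Proof.
move=> Ap; split => //; first by apply: continuous_subspaceT => t; exact: cvg_cst.
by move=> _ [t _ <-].
Qed.

Lemma path_in_sub A B p q l : A `<=` B -> path_in A p q l -> path_in B p q l.
Proof. by move=> AB [? lA ? ?]; split=> //; exact: subset_trans lA AB. Qed.

Lemma path_in_comp (Y : topologicalType) (A : set X) (B : set Y) (f : X -> Y) p q l :
  {within A, continuous f} -> f @` A `<=` B -> path_in A p q l ->
  path_in B (f p) (f q) (f \o l).
Proof.
move=> cf fAB [cl lA <- <-]; split=> //; first exact: within_continuous_compose cl lA cf.
by move=> _ [t tI <-]; apply: fAB; exists (l t) => //; apply: lA; exists t.
Qed.

Lemma path_in_mem A p q l (t : R) : path_in A p q l -> `[0, 1]%classic t -> A (l t).
Proof. by move=> [_ lA _ _] tI; apply: lA; exists t. Qed.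

End paths.

Section holonomy.
Context (R : realType) (G : groupType) (Z : topologicalType).
Implicit Types (A : set Z) (c : Z -> Z -> G) (l : R -> Z).
Local Open Scope group_scope.

(** A relation and not a function, since a section along [l] exists only when [c] is flat and [l]
    continuous. The initial value [h 0] is free: left translation changes it without changing
    [a]. *)
Definition holonomy c l (a : G) : Prop :=
  exists2 h, @parallel G R `[0%R, 1%R] (pull l c) h & h 1%R = h 0%R * a.

Lemma flat_refl A c z : flat A c -> A z -> c z z = 1.
Proof.
move=> Ac Az; have [U [h [zU Uh]]] := Ac z Az.
have /nbhs_singleton/(_ (conj Az (nbhs_singleton zU))) := Uh z (conj Az (nbhs_singleton zU)).
by move=> e; apply: (mulgI (h z)); rewrite -e mulg1.
Qed.

Lemma path_parallel A c p q l : flat A c -> path_in A p q l ->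
  exists h, @parallel G R `[0%R, 1%R] (pull l c) h.
Proof.
move=> Ac [cl lA _ _]; apply: parallel_interval.
exact: flat_pull cl lA Ac.
Qed.

Lemma path_holonomy A c p q l : flat A c -> path_in A p q l ->
  exists a, holonomy c l a.
Proof.
move=> Ac lP; have [h hP] := path_parallel Ac lP.
by exists ((h 0%R)^-1 * h 1%R), h => //; rewrite mulVKg.
Qed.

Lemma parallel_holonomy c l a h : holonomy c l a ->
  @parallel G R `[0%R, 1%R] (pull l c) h -> h 1%R = h 0%R * a.
Proof.
move=> [h' h'P h'a] hP.
have [b hb] := parallel_unique (@segment_connected R _ _) h'P hP.
by rewrite !hb ?h'a ?mulgA//; apply: itv01P; lra.
Qed.

Lemma holonomy_unique c l a b : holonomy c l a -> holonomy c l b -> a = b.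
Proof.
move=> la [h hP hb]; have := parallel_holonomy la hP.
by rewrite hb => /mulgI.
Qed.

Lemma holonomy_parallel A c h p q l : parallel A c h -> path_in A p q l ->
  holonomy c l ((h p)^-1 * h q).
Proof.
move=> hP [cl lA <- <-]; exists (h \o l); last by rewrite mulVKg.
exact: parallel_pull cl lA hP.
Qed.

Lemma holonomy_cst A c z : flat A c -> A z -> holonomy c (cst z) 1.
Proof.
move=> Ac Az; exists (cst 1); last by rewrite mulg1.
by move=> t _; near=> s; rewrite /pull /cst (flat_refl Ac Az) mulg1.
Unshelve. all: by end_near. Qed.

(** The section along [l'] is translated so as to continue the one along [l], and the holonomies
    multiply in the order of travel. *)
Lemma holonomy_cat c l l' a b : l 1%R = l' 0%R -> holonomy c l a ->
  holonomy c l' b -> holonomy c (path_cat l l') (a * b).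
Proof.
move=> ll' [h hP ha] [h' h'P h'b].
pose k t := h (2 * t)%R; pose k' t := h 1%R * (h' 0%R)^-1 * h' (2 * t - 1)%R.
have kP : @parallel G R `[0%R, (2^-1)%R] (pull (path_cat l l') c) k.
  apply: eq_parallel (parallel_pull (f := fun t : R => (2 * t)%R) _ (@double_itv R) hP) => //.
    by move=> s t sI tI; rewrite /pull !path_cat_left.
  by apply: continuous_subspaceT; exact: continuous_double.
have k'P : @parallel G R `[(2^-1)%R, 1%R] (pull (path_cat l l') c) k'.
  apply: parallel_mull.
  apply: eq_parallel (parallel_pull (f := fun t : R => (2 * t - 1)%R) _ (@double_sub1_itv R) h'P) => //.
    by move=> s t sI tI; rewrite /pull !path_cat_right.
  by apply: continuous_subspaceT; exact: continuous_double_sub1.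
have [AB BA] := @closed_separated R `[0%R, (2^-1)%R] `[(2^-1)%R, 1%R]
  (@itv_closed _ _ _ _) (@itv_closed _ _ _ _).
have kk' (t : R) : `[0%R, (2^-1)%R]%classic t -> `[(2^-1)%R, 1%R]%classic t -> k t = k' t.
  rewrite /= !in_itv/= => /andP[_ t2] /andP[t2' _].
  have -> : t = (2^-1)%R by lra.
  by rewrite /k /k' mulfV// subrr mulgVK.
have [K [KP K0 K1]] := parallel_glue_eq AB BA kP k'P kk'.
exists K; first exact: parallel_sub (@halves_cover R) KP.
have -> : K 1%R = k' 1%R by apply: K1; rewrite /= in_itv/=; lra.
have -> : K 0%R = k 0%R by apply: K0; rewrite /= in_itv/=; lra.
rewrite /k /k' mulr0 mulr1 (_ : 2 - 1 = 1)%R; last by lra.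
by rewrite h'b ha !mulgA mulgVK.
Qed.

Lemma holonomy_rev c l a : holonomy c l a -> holonomy c (path_rev l) a^-1.
Proof.
move=> [h hP ha]; exists (h \o (fun t => 1 - t)%R); last first.
  by rewrite /= subr0 subrr ha mulgK.
apply: (parallel_pull _ (@flip_itv R) hP).
by apply: continuous_subspaceT; exact: continuous_flip.
Qed.

(** Take a section over the whole square. Its restrictions to the sides [t = 0] and [t = 1] are
    sections along the same path, and they agree at [s = 0] because [l] has trivial holonomy; hence
    they agree at [s = 1]. A free homotopy conjugates holonomies, so this is special to the value
    1. *)
Lemma free_homotopic_holonomy A c l l' : flat A c -> free_homotopic A l l' ->
  holonomy c l 1 -> holonomy c l' 1.
Proof.
move=> Ac [H [cH HA Hl Hl'] Hs] l1.
have [h hP] := parallel_square (flat_pull cH HA Ac).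
have I0 : `[0%R, 1%R]%classic (0%R : R) by apply: itv01P; lra.
have I1 : `[0%R, 1%R]%classic (1%R : R) by apply: itv01P; lra.
have vert s : `[0%R, 1%R]%classic s ->
    @parallel G R `[0%R, 1%R] (pull (fun t => H (s, t)) c) (fun t => h (s, t)).
  move=> sI; apply: (parallel_pull (f := fun t : R => (s, t)) _ _ hP).
    apply: continuous_subspaceT => t.
    by apply: cvg_to_pair; [exact: cvg_cst|exact: cvg_id].
  by move=> _ [t tI <-].
have horiz t : `[0%R, 1%R]%classic t ->
    @parallel G R `[0%R, 1%R] (pull (fun s => H (s, t)) c) (fun s => h (s, t)).
  move=> tI; apply: (parallel_pull (f := fun s : R => (s, t)) _ _ hP).
    apply: continuous_subspaceT => s.
    by apply: cvg_to_pair; [exact: cvg_id|exact: cvg_cst].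
  by move=> _ [s sI <-].
have h0P : @parallel G R `[0%R, 1%R] (pull l c) (fun t => h (0%R, t)).
  by apply: eq_parallel (vert _ I0) => // s t sI tI; rewrite /pull !Hl// inE.
have h0 : h (0%R, 0%R) = h (0%R, 1%R).
  by have /= -> := parallel_holonomy l1 h0P; rewrite mulg1.
exists (fun t => h (1%R, t)).
  by apply: eq_parallel (vert _ I1) => // s t sI tI; rewrite /pull !Hl'// inE.
have h1P : @parallel G R `[0%R, 1%R] (pull (fun s => H (s, 0%R)) c) (fun s => h (s, 1%R)).
  by apply: eq_parallel (horiz _ I1) => // s t sI tI; rewrite /pull !Hs// inE.
rewrite mulg1.
by have <- := parallel_unique_eq (@segment_connected R _ _) (horiz _ I0) h1P I0 h0 I1.
Qed.

Lemma homotopic_free A l l' : l 0%R = l 1%R -> homotopic A l l' -> free_homotopic A l l'.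
Proof.
by move=> l01 [H HP Hs]; exists H => // s /Hs [-> ->].
Qed.

Lemma path_rev_inv l : path_rev (path_rev l) = l.
Proof. by apply: funext => t; rewrite /path_rev; congr l; lra. Qed.

Lemma holonomy_rev1 c l : holonomy c (path_rev l) 1 -> holonomy c l 1.
Proof. by move=> /holonomy_rev; rewrite path_rev_inv invg1. Qed.

Lemma is_homotopy_sym A l l' H : is_homotopy A l l' H ->
  is_homotopy A l' l (fun st => H (1 - st.1, st.2)%R).
Proof.
move=> [cH HA H0 H1]; split => /=.
- apply: (within_continuous_compose (f := fun st : R * R => (1 - st.1, st.2)%R) _ _ cH).
    apply: continuous_subspaceT => -[s t]; apply: cvg_to_pair; last exact: cvg_snd.
    by apply: cvgB; [exact: cvg_cst|exact: cvg_fst].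
  move=> _ [[s t] [sI tI] <-]; split => //=; apply: flip_itv; by exists s.
- move=> _ [[s t] [sI tI] <-]; apply: HA; exists (1 - s, t)%R => //.
  by split => //=; apply: flip_itv; exists s.
- by move=> t tI; rewrite subr0 H1.
- by move=> t tI; rewrite subrr H0.
Qed.

Lemma free_homotopic_sym A l l' : free_homotopic A l l' -> free_homotopic A l' l.
Proof.
move=> [H HP Hs]; exists (fun st => H (1 - st.1, st.2)%R); first exact: is_homotopy_sym HP.
move=> s sI /=; apply: Hs; rewrite inE; by apply: flip_itv; exists s.
Qed.

End holonomy.

(** * Global sections from trivial holonomy *)

Definition locally_path_connected (R : realType) (Z : topologicalType) : Prop :=
  forall (z : Z) (V : set Z), nbhs z V ->
    \forall z' \near z, exists p : R -> Z, path_in V z z' p.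

Section global.
Context (R : realType) (G : groupType) (Z : topologicalType).
Local Open Scope group_scope.

(* Integrate the transport from the base point along arbitrary paths. *)
Lemma parallel_global (c : Z -> Z -> G) (x0 : Z) :
  flat setT c -> locally_path_connected R Z ->
  (forall z, exists p : R -> Z, path_in setT x0 z p) ->
  (forall l : R -> Z, loop_in setT x0 l -> holonomy c l 1) ->
  exists h, parallel setT c h.
Proof.
move=> fc lpc pc triv.
pose p z := projT1 (cid (pc z)).
have pP z : path_in setT x0 z (p z) by rewrite /p; case: cid.
have exh z : exists a, holonomy c (p z) a by apply: path_holonomy fc (pP z).
pose h z := projT1 (cid (exh z)).
have hP z : holonomy c (p z) (h z) by rewrite /h; case: cid.
(* The loop that follows [p z], then [q], then [p z'] backwards has trivial holonomy. So [h] changes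
   along any path [q] by the holonomy of [q], whatever paths were chosen to define it. *)
have step z z' q b : path_in setT z z' q -> holonomy c (q : R -> Z) b -> h z' = h z * b.
  move=> qP qb; have L := path_in_cat (pP z) (path_in_cat qP (path_in_rev (pP z'))).
  have [_ _ _ p1] := pP z; have [_ _ _ p'1] := pP z'; have [_ _ q0 q1] := qP.
  have e1 : q 1%R = path_rev (p z') 0%R by rewrite /path_rev subr0 p'1.
  have e2 : p z 1%R = path_cat q (path_rev (p z')) 0%R by rewrite path_cat0 p1 q0.
  have := holonomy_cat e2 (hP z) (holonomy_cat e1 qb (holonomy_rev (hP z'))).
  move=> /(holonomy_unique (triv _ L)); rewrite mulgA => /esym/divg1_eq ->//.
exists h => z _.
have [U [k [zU kP]]] := fc z I.
have := kP z (conj I (nbhs_singleton zU)); rewrite setTI in kP.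
apply: filterS3 zU (lpc z U zU) => z' Uz' [q qP].
rewrite setTI => /(_ Uz') kz' _.
rewrite (step z z' q _ _ (holonomy_parallel kP qP)); last exact: path_in_sub qP.
by rewrite kz' mulKg.
Qed.

End global.

Section connected_paths.
Context (R : realType) (Z : topologicalType).

Lemma connected_path_connected : connected [set: Z] -> locally_path_connected R Z ->
  forall p q : Z, exists l : R -> Z, path_in [set: Z] p q l.
Proof.
move=> cZ lpc p q.
pose f z : Prop := exists l : R -> Z, path_in [set: Z] p z l.
suff fqp : f q = f p.
  rewrite -/(f q) fqp.
  by exists (cst p); exact: path_in_cst.
apply: (locally_constant_connected cZ) => // z _.
have zT : nbhs z [set: Z] by exact: filterT.
have lpcz := lpc z setT zT.
apply: filterS lpcz => w [l lP] _.
apply/propext; split => -[l' l'P].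
  by exists (path_cat l' (path_rev l)); apply: path_in_cat l'P (path_in_rev lP).
by exists (path_cat l' l); apply: path_in_cat l'P lP.
Qed.

End connected_paths.

Section homotopic_comp.
Context (R : realType) (X Y : topologicalType).

Lemma homotopic_comp (A : set X) (B : set Y) (f : X -> Y) (l l' : R -> X) :
  {within A, continuous f} -> f @` A `<=` B ->
  homotopic A l l' -> homotopic B (f \o l) (f \o l').
Proof.
move=> cf fAB [H [cH HA H0 H1] Hs]; exists (f \o H); last first.
  by move=> s sI /=; have [-> ->] := Hs s sI.
split.
- exact: within_continuous_compose cH HA cf.
- by move=> _ [st stI <-]; apply: fAB; exists (H st) => //; apply: HA; exists st.
- by move=> t tI /=; rewrite H0.
- by move=> t tI /=; rewrite H1.
Qed.

End homotopic_comp.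

(** * Convex sets of row vectors *)

Section row_vectors.
Context (R : realType) (n : nat).
Implicit Types (x y : 'rV[R]_n) (B : set 'rV[R]_n).

Definition line_path (x y : 'rV[R]_n) : R -> 'rV[R]_n := fun t => (1 - t) *: x + t *: y.

Definition convex_set (B : set 'rV[R]_n) : Prop :=
  forall x y t, B x -> B y -> `[0, 1]%classic t -> B (line_path x y t).

Lemma line_path_in B x y : convex_set B -> B x -> B y -> path_in B x y (line_path x y).
Proof.
move=> cB Bx By; split; rewrite /line_path ?subr0 ?subrr ?scale0r ?scale1r ?addr0 ?add0r//.
- apply: continuous_subspaceT => t; apply: cvgD; apply: cvgZ; try exact: cvg_cst.
    exact: continuous_flip.
  exact: cvg_id.
- by move=> _ [t tI <-]; exact: cB.
Qed.

Lemma convex_homotopic B x y (p q : R -> 'rV[R]_n) : convex_set B ->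
  path_in B x y p -> path_in B x y q -> homotopic B p q.
Proof.
move=> cB [cp pB p0 p1] [cq qB q0 q1].
exists (fun st => line_path (p st.2) (q st.2) st.1); last first.
  move=> s sI /=; rewrite p0 p1 q0 q1 /line_path.
  by rewrite -!scalerDl subrK !scale1r.
split.
- have c2 (f : R -> 'rV[R]_n) : {within `[0, 1], continuous f} ->
      {within (`[0, 1] `*` `[0, 1] : set (R * R)), continuous (f \o snd)}.
    move=> cf; apply: (within_continuous_compose (f := snd) _ _ cf).
      by apply: continuous_subspaceT => st; exact: cvg_snd.
    by move=> _ [[s t] [sI tI] <-].
  have /subspace_continuousP c2p := c2 p cp.
  have /subspace_continuousP c2q := c2 q cq.
  have c1 (st : R * R) : (fun st => st.1) @ within (`[0, 1] `*` `[0, 1]) (nbhs st) --> st.1.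
    by apply: cvg_within_filter; exact: cvg_fst.
  apply/subspace_continuousP => st stI; apply: cvgD; apply: cvgZ.
  + by apply: cvgB; [exact: cvg_cst|exact: c1].
  + exact: c2p.
  + exact: c1.
  + exact: c2q.
- by move=> _ [[s t] [sI tI] <-]; apply: cB => //; [apply: pB|apply: qB]; exists t.
- by move=> t tI; rewrite /line_path /= subr0 scale1r scale0r addr0.
- by move=> t tI; rewrite /line_path /= subrr scale0r scale1r add0r.
Qed.

Lemma convex_setT : convex_set setT. Proof. by []. Qed.

Lemma ball_convex x (e : R) : convex_set (ball x e).
Proof.
move=> y z t [e0 xy] [_ xz] tI; split=> // i j.
have := xy i j; have := xz i j; rewrite /ball/= !mxE.
move: (x i j) (y i j) (z i j) => a b d ad ab.
move: tI; rewrite /= in_itv/= => /andP[t0 t1].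
rewrite (_ : a - _ = (1 - t) * (a - b) + t * (a - d)); last by ring.
rewrite (le_lt_trans (ler_normD _ _))// !normrM (ger0_norm t0) ger0_norm; last lra.
have [->|t0'] := eqVneq t 0; first by rewrite mul0r addr0 subr0 mul1r.
have tp : 0 < t by rewrite lt_neqAle eq_sym t0'.
have : t * `|a - d| < t * e by rewrite ltr_pM2l.
have : (1 - t) * `|a - b| <= (1 - t) * e by rewrite ler_wpM2l ?subr_ge0// ltW.
lra.
Qed.

Lemma row_vector_lpc : locally_path_connected R 'rV[R]_n.
Proof.
move=> x V /nbhs_ballP[e /= e0 eV].
have : nbhs x (ball x e) by exact: nbhsx_ballx.
apply: filterS => y xy; exists (line_path x y).
apply: path_in_sub eV _; apply: line_path_in => //; first exact: ball_convex.
exact: ballxx.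
Qed.

(** Straight-line homotopies contract every loop at 0, so [parallel_global] applies. *)
Lemma row_vector_parallel (G : groupType) (c : 'rV[R]_n -> 'rV[R]_n -> G) :
  flat setT c -> exists h, parallel setT c h.
Proof.
move=> fc; have := @parallel_global R G _ c 0 fc row_vector_lpc; apply.
  by move=> z; exists (line_path 0 z); exact: line_path_in.
move=> l lP; have lc : homotopic [set: 'rV[R]_n] (cst 0) l.
  exact: convex_homotopic (path_in_cst R I) lP.
apply: (free_homotopic_holonomy fc (homotopic_free _ lc)) => //.
exact: holonomy_cst fc I.
Qed.

Lemma convex_connected B : convex_set B -> connected B.
Proof.
move=> cB; have [[x Bx]|B0] := pselect (B !=set0); last first.
  by move=> D D0 [C _ E]; exfalso; apply: B0; case: D0 => d; rewrite E => -[? _]; exists d.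
have -> : B = \bigcup_(y in B) (line_path x y @` `[0, 1]).
  apply/seteqP; split => [y By|_ [y By [t tI <-]]]; last exact: cB.
  exists y => //; exists 1; first by apply: itv01P; lra.
  by rewrite /line_path subrr scale0r add0r scale1r.
apply: bigcup_connected.
  exists x => y By; exists 0; first by apply: itv01P; lra.
  by rewrite /line_path subr0 scale0r addr0 scale1r.
move=> y By; apply: connected_continuous_connected; first exact: segment_connected.
by have [] := line_path_in cB Bx By.
Qed.

End row_vectors.

(** * The unit circle and branches of the angle *)

Section circle.
Context (R : realType).
Implicit Types (t : R) (y : 'rV[R]_2).

Definition enorm (n : nat) (y : 'rV[R]_n) : R := Num.sqrt (sqnorm y).

Definition direction (y : 'rV[R]_2) : 'rV[R]_2 := (enorm y)^-1 *: y.

Lemma sqnorm_ge0 n (y : 'rV[R]_n) : 0 <= sqnorm y.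
Proof. by apply: sumr_ge0 => i _; exact: sqr_ge0. Qed.

Lemma sqnormZ n (a : R) (y : 'rV[R]_n) : sqnorm (a *: y) = a ^+ 2 * sqnorm y.
Proof. by rewrite /sqnorm mulr_sumr; apply: eq_bigr => i _; rewrite mxE exprMn. Qed.

Lemma sqnorm0 n : sqnorm (0 : 'rV[R]_n) = 0.
Proof. by rewrite /sqnorm big1// => i _; rewrite mxE expr0n. Qed.

Lemma sqnorm_eq0 n (y : 'rV[R]_n) : sqnorm y = 0 -> y = 0.
Proof.
move=> y0; apply/rowP => i; rewrite mxE.
have /psumr_eq0P/(_ y0 i isT)/eqP : forall i : 'I_n, true -> 0 <= y 0 i ^+ 2.
  by move=> j _; exact: sqr_ge0.
by rewrite sqrf_eq0 => /eqP.
Qed.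

Lemma sqnorm2E y : sqnorm y = y 0 0 ^+ 2 + y 0 1 ^+ 2.
Proof. by rewrite /sqnorm !big_ord_recl big_ord0 addr0; congr (y 0 _ ^+ 2 + y 0 _ ^+ 2); exact: val_inj. Qed.

Lemma row2P y y' : y 0 0 = y' 0 0 -> y 0 1 = y' 0 1 -> y = y'.
Proof.
move=> e0 e1; apply/rowP => -[[|[|//]] i].
  by rewrite (_ : Ordinal i = 0) //; exact: val_inj.
by rewrite (_ : Ordinal i = 1) //; exact: val_inj.
Qed.

Lemma enorm_gt0 n (y : 'rV[R]_n) : y != 0 -> 0 < enorm y.
Proof.
move=> y0; rewrite sqrtr_gt0 lt_neqAle sqnorm_ge0 andbT eq_sym.
by apply: contra_neq y0; exact: sqnorm_eq0.
Qed.

Lemma enorm_ge0 n (y : 'rV[R]_n) : 0 <= enorm y.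
Proof. exact: sqrtr_ge0. Qed.

Lemma enorm_sqr n (y : 'rV[R]_n) : enorm y ^+ 2 = sqnorm y.
Proof. by rewrite sqr_sqrtr// sqnorm_ge0. Qed.

Lemma enormZ n (a : R) (y : 'rV[R]_n) : 0 <= a -> enorm (a *: y) = a * enorm y.
Proof. by move=> a0; rewrite /enorm sqnormZ sqrtrM ?sqr_ge0// sqrtr_sqr ger0_norm. Qed.

Lemma enorm1 n (y : 'rV[R]_n) : sqnorm y = 1 -> enorm y = 1.
Proof. by rewrite /enorm => ->; rewrite sqrtr1. Qed.

Lemma direction_id y : sqnorm y = 1 -> direction y = y.
Proof. by move=> /enorm1 y1; rewrite /direction y1 invr1 scale1r. Qed.

Lemma sqnorm_direction y : y != 0 -> sqnorm (direction y) = 1.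
Proof.
move=> /enorm_gt0 y0; rewrite sqnormZ -enorm_sqr exprVn mulVf//.
by rewrite expf_neq0// gt_eqF.
Qed.

Lemma directionZ (a : R) y : 0 < a -> direction (a *: y) = direction y.
Proof.
move=> a0; rewrite /direction enormZ ?ltW// scalerA invfM mulrC mulrA.
by rewrite divff ?gt_eqF// mul1r.
Qed.

Lemma scale_direction y : y != 0 -> enorm y *: direction y = y.
Proof. by move=> /enorm_gt0 y0; rewrite scalerA divff ?scale1r// gt_eqF. Qed.

Lemma unit_circle0 t : unit_circle t 0 0 = cos (2 * pi * t).
Proof. by rewrite mxE. Qed.

Lemma unit_circle1 t : unit_circle t 0 1 = sin (2 * pi * t).
Proof. by rewrite mxE. Qed.

Lemma sqnorm_unit_circle t : sqnorm (unit_circle t) = 1.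
Proof. by rewrite sqnorm2E unit_circle0 unit_circle1 cos2Dsin2. Qed.

Lemma unit_circle_periodic1 t : unit_circle (t + 1) = unit_circle t.
Proof.
have e : 2 * pi * (t + 1) = 2 * pi * t + pi *+ 2 :> R by rewrite mulr2n; ring.
by apply: row2P; rewrite ?unit_circle0 ?unit_circle1 e ?cosD2pi ?sinD2pi.
Qed.

Lemma cos_period (z : int) (x : R) : cos (2 * pi * (x + z%:~R)) = cos (2 * pi * x).
Proof.
have nat_period (n : nat) (w : R) : cos (2 * pi * (w + n%:R)) = cos (2 * pi * w).
  elim: n w => [|n IH] w; first by rewrite addr0.
  rewrite -[RHS]IH -[RHS]cosD2pi; congr cos; rewrite -addn1 natrD mulr2n; ring.
case: z => n; first exact: nat_period.
by rewrite -[LHS](nat_period n.+1) NegzE mulrNz subrK.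
Qed.

(** Only the fractional part [d] of the difference matters: [cos (2 * pi * d) = 1] forces
    [sin (pi * d) = 0], while the sine is positive strictly between 0 and [pi]. *)
Lemma unit_circle_eq t t' : unit_circle t = unit_circle t' ->
  exists z : int, t' = t + z%:~R.
Proof.
move=> tt'; exists (Num.floor (t' - t)).
pose d := t' - t - (Num.floor (t' - t))%:~R.
have /andP[d0 d1] : 0 <= d < 1.
  have := floor_itv (t' - t); rewrite intrD.
  by rewrite /d => /andP[? ?]; apply/andP; split; lra.
suff : d = 0 by rewrite /d; lra.
have c1 : cos (2 * pi * (t' - t)) = 1.
  rewrite mulrBr cosB -!unit_circle0 -!unit_circle1 tt' -!expr2.
  by rewrite unit_circle0 unit_circle1 cos2Dsin2.
have {}c1 : cos (2 * pi * d) = 1.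
  rewrite -(cos_period (Num.floor (t' - t)) d) (_ : d + _ = t' - t)//.
  by rewrite /d; lra.
have s0 : sin (pi * d) = 0.
  have := c1; rewrite (_ : 2 * pi * d = (pi * d) *+ 2); last by rewrite mulr2n; ring.
  rewrite cos_mulr2n => c2; apply: cos1sin0.
  have : cos (pi * d) ^+ 2 = 1 by move: c2; rewrite mulr2n; lra.
  by move=> c3; rewrite -sqrtr_sqr c3 sqrtr1.
apply/eqP; rewrite eq_le d0 andbT leNgt; apply/negP => dp.
have : 0 < pi * d < pi.
  by rewrite mulr_gt0 ?pi_gt0//= -[ltRHS]mulr1 ltr_pM2l ?pi_gt0.
by move=> /sin_gt0_pi; rewrite s0 ltxx.
Qed.

Lemma unit_circle_surj y : sqnorm y = 1 -> exists t, unit_circle t = y.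
Proof.
rewrite sqnorm2E => y1.
have y01 : -1 <= y 0 0 <= 1.
  rewrite -ler_norml -(@ler_pXn2r _ 2) ?nnegrE// expr1n real_normK ?num_real//.
  by rewrite -y1 lerDl sqr_ge0.
have pi0 : 2 * pi != 0 :> R by rewrite mulf_neq0// gt_eqF// pi_gt0.
have s1 : sin (acos (y 0 0)) = `|y 0 1|.
  by rewrite sin_acos// -sqrtr_sqr; congr Num.sqrt; rewrite -y1; ring.
have c1 : cos (acos (y 0 0)) = y 0 0 by apply: acosK; rewrite in_itv.
have [y0|y0] := leP 0 (y 0 1).
  exists (acos (y 0 0) / (2 * pi)).
  by apply: row2P; rewrite ?unit_circle0 ?unit_circle1 [_ * (_ / _)]mulrC mulfVK// s1 ger0_norm.
exists (- (acos (y 0 0) / (2 * pi))).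
apply: row2P; rewrite ?unit_circle0 ?unit_circle1 mulrN [_ * (_ / _)]mulrC mulfVK//.
  by rewrite cosN.
by rewrite sinN s1 ltr0_norm// opprK.
Qed.

Lemma cvg_mx (T : Type) (F : set_system T) (FF : Filter F) (m n : nat)
    (f : T -> 'M[R]_(m, n)) (M : 'M[R]_(m, n)) :
  (forall i j, (fun s : T => f s i j) @ F --> M i j) -> f @ F --> M.
Proof.
move=> fM P [Q MQ QP]; rewrite /nbhs/=.
have : F [set s | forall ij : 'I_m * 'I_n, Q ij.1 ij.2 (f s ij.1 ij.2)].
  by apply: filter_forall => -[i j]; exact: fM (MQ i j).
apply: filterS => s Qs; apply: QP => i j; exact: (Qs (i, j)).
Qed.

Lemma continuous_unit_circle : continuous (@unit_circle R).
Proof.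
move=> t; apply: cvg_mx => i j.
have c : {for t, continuous (fun t : R => 2 * pi * t)}.
  by apply: cvgM; [exact: cvg_cst|exact: cvg_id].
rewrite !mxE; under eq_fun do rewrite mxE.
by case: ifP => _; apply: continuous_comp => //; [exact: continuous_cos|exact: continuous_sin].
Qed.

Lemma sqnorm_continuous n : continuous (@sqnorm R n).
Proof.
apply: (@continuous_big R 'I_n +%R 0 xpredT _ _ (index_enum 'I_n) (fun i (x : 'rV[R]_n) => x 0 i ^+ 2)).
  by move=> u; apply: cvgD; [exact: cvg_fst|exact: cvg_snd].
move=> i _ z; apply: (@continuous_comp _ _ _ (fun x : 'rV[R]_n => x 0 i) (fun a => a ^+ 2)).
  exact: coord_continuous.
exact: exprn_continuous.
Qed.

Lemma enorm_continuous n : continuous (@enorm n).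
Proof.
move=> y; apply: continuous_comp; first exact: sqnorm_continuous.
exact: sqrt_continuous.
Qed.

Lemma direction_continuous y : y != 0 -> {for y, continuous direction}.
Proof.
move=> y0; apply: (@cvgZ R _ _ (nbhs y) _ (fun y => (enorm y)^-1) id); last exact: cvg_id.
apply: (@cvgV R _ (nbhs y) _ (@enorm 2)); last exact: enorm_continuous.
by rewrite gt_eqF// enorm_gt0.
Qed.

(* The branch of the angle on the half plane around y is computed by an
   arctangent in the rotated frame. *)
Lemma local_angle y t : y != 0 -> unit_circle t = direction y ->
  exists2 theta : 'rV[R]_2 -> R, {for y, continuous theta} /\ theta y = t &
    \forall y' \near y, unit_circle (theta y') = direction y'.
Proof.
move=> y0 ty; pose c := unit_circle t.
have c1 : c 0 0 ^+ 2 + c 0 1 ^+ 2 = 1 by rewrite -sqnorm2E sqnorm_unit_circle.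
pose u1 (y : 'rV[R]_2) := c 0 0 * y 0 0 + c 0 1 * y 0 1.
pose u2 (y : 'rV[R]_2) := c 0 0 * y 0 1 - c 0 1 * y 0 0.
have yc : y = enorm y *: c by rewrite /c ty scale_direction.
have cc (a : R) i : continuous (fun y : 'rV[R]_2 => a * y 0 i).
  move=> z; apply: (@cvgM _ _ (nbhs z) _ (cst a) (fun y => y 0 i)).
    exact: cvg_cst.
  exact: coord_continuous.
have cu1 : continuous u1.
  move=> z; apply: (@cvgD _ _ _ (nbhs z) _ (fun y => c 0 0 * y 0 0) (fun y => c 0 1 * y 0 1));
  exact: cc.
have cu2 : continuous u2.
  move=> z; apply: (@cvgB _ _ _ (nbhs z) _ (fun y => c 0 0 * y 0 1) (fun y => c 0 1 * y 0 0));
  exact: cc.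
have yE i : y 0 i = enorm y * c 0 i by rewrite {1}yc mxE.
have u1y : u1 y = enorm y.
  by rewrite /u1 !yE -[RHS]mulr1 -c1; ring.
have u2y : u2 y = 0 by rewrite /u2 !yE; ring.
have u1p : 0 < u1 y by rewrite u1y enorm_gt0.
have pi0 : 2 * pi != 0 :> R by rewrite mulf_neq0// gt_eqF// pi_gt0.
exists (fun y => t + atan (u2 y / u1 y) / (2 * pi)); first split.
- apply: (@cvgD _ _ _ (nbhs y) _ (cst t)); first exact: cvg_cst.
  apply: (@cvgM _ _ (nbhs y) _ (fun y => atan (u2 y / u1 y))); last exact: cvg_cst.
  apply: (@continuous_comp _ _ _ (fun y => u2 y / u1 y)); last exact: continuous_atan.
  apply: (@cvgM _ _ (nbhs y) _ u2 (fun y => (u1 y)^-1)); first exact: cu2.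
  by apply: (@cvgV _ _ (nbhs y) _ u1); [rewrite gt_eqF|exact: cu1].
- by rewrite u2y mul0r atan0 mul0r addr0.
have u1n : \forall y' \near y, 0 < u1 y' := cu1 y _ (lt_nbhsr u1p).
apply: filterS u1n => z z1.
set v := u2 z / u1 z.
have zn : enorm z = u1 z * Num.sqrt (1 + v ^+ 2).
  rewrite -[u1 z in RHS]gtr0_norm// -sqrtr_sqr -sqrtrM ?sqr_ge0//.
  congr Num.sqrt; rewrite mulrDr mulr1 -exprMn /v mulrCA divff ?gt_eqF// mulr1.
  rewrite sqnorm2E /u1 /u2 -[LHS]mul1r -c1; ring.
have sp : 0 < Num.sqrt (1 + v ^+ 2) by rewrite sqrtr_gt0 ltr_pwDl// sqr_ge0.
have ca : cos (atan v) = (Num.sqrt (1 + v ^+ 2))^-1 by exact: cos_atan.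
have sa : sin (atan v) = v / Num.sqrt (1 + v ^+ 2).
  have := atanK v; rewrite /tan ca invrK => {2}<-.
  by rewrite mulfK// gt_eqF.
have e : 2 * pi * (t + atan v / (2 * pi)) = 2 * pi * t + atan v.
  by rewrite mulrDr [_ * (_ / _)]mulrC mulfVK.
have cE : c 0 0 = cos (2 * pi * t) by rewrite unit_circle0.
have sE : c 0 1 = sin (2 * pi * t) by rewrite unit_circle1.
have z0E : z 0 0 = c 0 0 * u1 z - c 0 1 * u2 z.
  by rewrite -[LHS]mul1r -c1 /u1 /u2; ring.
have z1E : z 0 1 = c 0 1 * u1 z + c 0 0 * u2 z.
  by rewrite -[LHS]mul1r -c1 /u1 /u2; ring.
have spn := lt0r_neq0 sp; have z1n := lt0r_neq0 z1.
apply: row2P; rewrite ?unit_circle0 ?unit_circle1 e [RHS]mxE zn ?cosD ?sinD ca sa -cE -sE.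
  by rewrite z0E -[u2 z](mulfVK z1n) -/v; field; rewrite spn z1n.
by rewrite z1E -[u2 z](mulfVK z1n) -/v; field; rewrite spn z1n.
Qed.

End circle.

(** * Block coordinates and congruence modulo integers *)

Section row_mx_continuity.
Context (R : realType).

Lemma cvg_coord (T : Type) (F : set_system T) (FF : Filter F) (m n : nat)
    (f : T -> 'M[R]_(m, n)) (M : 'M[R]_(m, n)) i j :
  f @ F --> M -> (fun s : T => f s i j) @ F --> M i j.
Proof. by move=> fM; apply: (cvg_comp f (fun M : 'M[R]_(m, n) => M i j) fM); exact: coord_continuous. Qed.

Lemma cvg_row_mx (T : Type) (F : set_system T) (FF : Filter F) (m n p : nat)
    (f : T -> 'M[R]_(m, n)) (g : T -> 'M[R]_(m, p)) (M : 'M[R]_(m, n)) (N : 'M[R]_(m, p)) :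
  f @ F --> M -> g @ F --> N -> (fun s => row_mx (f s) (g s)) @ F --> row_mx M N.
Proof.
move=> fM gN; apply: cvg_mx => i j.
case: (split_ordP j) => k ->; rewrite ?row_mxEl ?row_mxEr.
  by under eq_fun do rewrite row_mxEl; exact: cvg_coord.
by under eq_fun do rewrite row_mxEr; exact: cvg_coord.
Qed.

Lemma lsubmx_continuous (n p : nat) :
  continuous (lsubmx : 'rV[R]_(n + p) -> 'rV[R]_n).
Proof.
move=> a; apply: (@cvg_mx _ _ (nbhs a)) => i j; rewrite mxE; under eq_fun do rewrite mxE.
exact: coord_continuous.
Qed.

Lemma rsubmx_continuous (n p : nat) :
  continuous (rsubmx : 'rV[R]_(n + p) -> 'rV[R]_p).
Proof.
move=> a; apply: (@cvg_mx _ _ (nbhs a)) => i j; rewrite mxE; under eq_fun do rewrite mxE.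
exact: coord_continuous.
Qed.

Lemma int_norm_lt1 (z : int) : `|z%:~R : R| < 1 -> z = 0.
Proof.
rewrite -intr_norm -[1](mulr1z) ltr_int ltNge -gtz0_ge1 normr_gt0 negbK.
by move=> /eqP.
Qed.

Lemma torus_eq_near n (x y : 'rV[R]_n) :
  (forall i, `|x 0 i - y 0 i| < 1) -> torus_eq x y -> x = y.
Proof.
move=> xy [z yE]; apply/rowP => i; have := xy i.
rewrite yE !mxE opprD addrA subrr sub0r normrN => /int_norm_lt1 ->.
by rewrite addr0.
Qed.

Lemma torus_eq_unit_square n (x : 'rV[R]_n) :
  exists2 y, torus_eq x y & forall i, 0 <= y 0 i <= 1.
Proof.
exists (\row_i (x 0 i - (Num.floor (x 0 i))%:~R)).
  by exists (\row_i - Num.floor (x 0 i)); apply/rowP => i; rewrite !mxE mulrNz.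
move=> i; rewrite mxE; have := floor_itv (x 0 i); rewrite intrD => /andP[? ?].
by apply/andP; split; lra.
Qed.

End row_mx_continuity.

(** * Topology of a single tube *)

(** The topological content of [tubular_nbhd]: [phi] induces an open embedding of the product of the
    2-torus and the plane. *)
Definition tube_chart (R : realType) (Z : topologicalType)
    (phi : 'rV[R]_(2 + 2) -> Z) : Prop :=
  [/\ continuous phi,
      forall x y, phi x = phi y <->
        torus_eq (lsubmx x) (lsubmx y) /\ rsubmx x = rsubmx y &
      forall V, open V -> open (phi @` V)].

Section tube_chart.
Context (R : realType) (Z : topologicalType) (phi : 'rV[R]_(2 + 2) -> Z).
Context (phiP : tube_chart phi).

Let cphi : continuous phi. Proof. by case: phiP. Qed.

(** Openness of [phi] allows neighbourhoods to be tested in tube coordinates; every local statement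
    inside a tube is reduced to [R^4] in this way. *)
Lemma tube_chart_near (a : 'rV[R]_(2 + 2)) (P : set Z) :
  (\forall a' \near a, P (phi a')) -> \forall z \near phi a, P z.
Proof.
move=> aP; have [_ _ ophi] := phiP.
have oV : open (phi @` interior [set a' | P (phi a')]).
  by apply: ophi; exact: open_interior.
have aV : (phi @` interior [set a' | P (phi a')]) (phi a) by exists a.
apply: filterS (open_nbhs_nbhs (conj oV aV)) => _ [b /interior_subset Pb <-].
exact: Pb.
Qed.

(** The radius 1/2 makes [phi] injective on the ball: two of its points differ by less than 1 in
    each coordinate, so a congruence modulo integers between them is an equality. *)
Lemma tube_chart_section (a : 'rV[R]_(2 + 2)) : exists sec : Z -> 'rV[R]_(2 + 2),
  \forall a' \near a, sec (phi a') = a'.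
Proof.
have [_ phiE _] := phiP.
exists (fun z => xget 0 [set b | ball a (2^-1 : R) b /\ phi b = z]).
have : nbhs a (ball a (2^-1 : R)) by apply: nbhsx_ballx; rewrite invr_gt0.
apply: filterS => b ab.
case: xgetP => [c _ [ac /phiE [lcb rcb]]|/(_ b)]; last by case.
rewrite -[c]hsubmxK -[b]hsubmxK rcb; congr row_mx.
apply: torus_eq_near lcb => i; rewrite !mxE.
have [_ /(_ 0 (lshift 2 i))] := ab; have [_ /(_ 0 (lshift 2 i))] := ac.
rewrite /ball/= !ltr_norml; lra.
Qed.

(** A choice of coordinates that is in no way continuous. It enters only through expressions that do
    not change when the torus coordinates move by integers. *)
Definition tube_lift (z : Z) : 'rV[R]_(2 + 2) := xget 0 [set a | phi a = z].

Lemma tube_liftK a : phi (tube_lift (phi a)) = phi a.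
Proof. by rewrite /tube_lift; case: xgetP => [b _ //|/(_ a)]; case. Qed.

Lemma tube_lift_rsubmx a : rsubmx (tube_lift (phi a)) = rsubmx a.
Proof. by have [_ phiE _] := phiP; have /phiE[] := tube_liftK a. Qed.

Lemma tube_lift_lsubmx a : torus_eq (lsubmx (tube_lift (phi a))) (lsubmx a).
Proof. by have [_ phiE _] := phiP; have /phiE[] := tube_liftK a. Qed.

Definition tube_fibre (D : set 'rV[R]_2) : set Z := phi @` [set a | D (rsubmx a)].

Lemma tube_fibreE D a : tube_fibre D (phi a) <-> D (rsubmx a).
Proof.
have [_ phiE _] := phiP; split=> [[b Db /phiE [_ <-]]//|Da].
by exists a.
Qed.

Lemma tube_fibre_compact D : closed D -> (forall y, D y -> sqnorm y <= 1) ->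
  compact (tube_fibre D).
Proof.
move=> clD D1; have [_ phiE _] := phiP.
(* The torus coordinates can be taken in [[0, 1]] and those of the disk lie in [[-1, 1]], so one
   compact box contains representatives of all the points. *)
pose K := [set v : 'rV[R]_(2 + 2) | forall i, `[(-1), 1]%classic (v ord0 i)].
have cK : compact K.
  by apply: (@rV_compact R _ (fun=> `[(-1), 1]%classic)) => i; exact: segment_compact.
suff -> : tube_fibre D = phi @` (K `&` [set a | D (rsubmx a)]).
  apply: continuous_compact; first exact: continuous_subspaceT.
  apply: compact_closedI => //.
  by apply: closed_comp clD => a _; exact: rsubmx_continuous.
apply/seteqP; split => [_ [a /= Da <-]|_ [a [_ Da] <-]]; last by exists a.
have [x ax x01] := torus_eq_unit_square (lsubmx a).
exists (row_mx x (rsubmx a)); last first.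
  apply/phiE; rewrite row_mxKl row_mxKr; split=> //.
  have [z ->] := ax; exists (- z); apply/rowP => i.
  by rewrite !mxE mulrNz addrK.
split; rewrite /= ?row_mxKr//.
move=> i; case: (split_ordP i) => k ->; rewrite ?row_mxEl ?row_mxEr /= in_itv/=.
  by have := x01 k; lra.
have y1 : (rsubmx a) 0 k ^+ 2 <= 1.
  apply: le_trans (D1 _ Da); rewrite /sqnorm (bigD1 k)//= lerDl.
  by apply: sumr_ge0 => j _; exact: sqr_ge0.
by rewrite -ler_norml -(@ler_pXn2r _ 2) ?nnegrE// expr1n real_normK ?num_real.
Qed.

Lemma sqnorm_le_closed : closed [set y : 'rV[R]_2 | sqnorm y <= 1].
Proof.
rewrite (_ : mkset _ = @sqnorm R 2 @^-1` [set t | t <= 1])//.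
by apply: closed_comp; [move=> y _; exact: sqnorm_continuous|exact: closed_le].
Qed.

Lemma sqnorm_eq_closed : closed [set y : 'rV[R]_2 | sqnorm y = 1].
Proof.
rewrite (_ : mkset _ = @sqnorm R 2 @^-1` [set t | t = 1])//.
by apply: closed_comp; [move=> y _; exact: sqnorm_continuous|exact: closed_eq].
Qed.

Lemma sqnorm_lt_open : open [set y : 'rV[R]_2 | sqnorm y < 1].
Proof.
rewrite (_ : mkset _ = @sqnorm R 2 @^-1` [set t | t < 1])//.
by apply: open_comp; [move=> y _; exact: sqnorm_continuous|exact: open_lt].
Qed.

Definition open_tube : set Z := tube_fibre [set y | sqnorm y < 1].

Lemma open_tube_open : open open_tube.
Proof.
have [_ _ ophi] := phiP; apply: ophi.
apply: (@open_comp _ _ (rsubmx : 'rV[R]_(2 + 2) -> _) _ _ sqnorm_lt_open).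
by move=> a _; exact: rsubmx_continuous.
Qed.

Lemma tube_compact : compact (tube phi).
Proof. exact: (@tube_fibre_compact _ sqnorm_le_closed). Qed.

Lemma tube_boundary_compact : compact (tube_boundary phi).
Proof.
by apply: (@tube_fibre_compact _ sqnorm_eq_closed) => y /= ->.
Qed.

Definition tube_core : set Z := tube_fibre [set 0].

Lemma tube_core_compact : compact tube_core.
Proof.
apply: tube_fibre_compact => [|y /= ->]; last by rewrite sqnorm0 ler01.
apply: compact_closed; last exact: compact_set1.
exact: norm_hausdorff.
Qed.

Lemma boundary_param_continuous : continuous (boundary_param phi).
Proof.
move=> a; rewrite /boundary_param.
apply: (@continuous_comp _ _ _ (fun x : 'rV[R]_(2 + 1) =>
  row_mx (lsubmx x) (unit_circle (rsubmx x 0 0)))); last exact: cphi.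
apply: (@cvg_row_mx R _ (nbhs a) _ 1 2 2 lsubmx); first exact: lsubmx_continuous.
apply: (@continuous_comp _ _ _ (fun x : 'rV[R]_(2 + 1) => rsubmx x 0 0) (@unit_circle R)).
  by apply: (@cvg_coord R _ (nbhs a) _ 1 1 rsubmx); exact: rsubmx_continuous.
exact: continuous_unit_circle.
Qed.

Lemma boundary_param_boundary x : tube_boundary phi (boundary_param phi x).
Proof.
exists (row_mx (lsubmx x) (unit_circle (rsubmx x 0 0))) => //=.
by rewrite row_mxKr sqnorm_unit_circle.
Qed.

Lemma boundary_param_surj z : tube_boundary phi z -> exists x, boundary_param phi x = z.
Proof.
move=> [a /= /unit_circle_surj[t ta] <-]; exists (row_mx (lsubmx a) (const_mx t)).
by rewrite /boundary_param row_mxKl row_mxKr mxE ta hsubmxK.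
Qed.

Lemma tube_boundary_connected : connected (tube_boundary phi).
Proof.
have -> : tube_boundary phi = boundary_param phi @` setT.
  apply/seteqP; split => [z /boundary_param_surj[x <-]|_ [x _ <-]].
    by exists x.
  exact: boundary_param_boundary.
apply: connected_continuous_connected.
  by apply: (@convex_connected R (2 + 1)); exact: convex_setT.
by apply: continuous_subspaceT; exact: boundary_param_continuous.
Qed.

End tube_chart.

Lemma near_comp (X Y : topologicalType) (f : X -> Y) (x : X) (P : set Y) :
  {for x, continuous f} -> (\forall y \near f x, P y) -> \forall x' \near x, P (f x').
Proof. by move=> cf fP; exact: cf. Qed.

Lemma within_continuousU (X Y : topologicalType) (A B : set X) (f : X -> Y) :
  (forall z, A z -> ~ B z -> \forall z' \near z, B z' -> A z') ->
  (forall z, B z -> ~ A z -> \forall z' \near z, A z' -> B z') ->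
  {within A, continuous f} -> {within B, continuous f} ->
  {within A `|` B, continuous f}.
Proof.
move=> AB BA /within_continuousP cA /within_continuousP cB.
apply/within_continuousP => z P ABz fP.
have [Az|Az] := pselect (A z); have [Bz|Bz] := pselect (B z).
- have := cA z P Az fP; have := cB z P Bz fP.
  by apply: filterS2 => w wB wA [/wA|/wB].
- have := cA z P Az fP; have := AB z Az Bz.
  by apply: filterS2 => w wB wA [/wA|/wB/wA].
- have := cB z P Bz fP; have := BA z Bz Az.
  by apply: filterS2 => w wA wB [/wA/wB|/wB].
- by case: ABz.
Qed.

(** * Extension of a local system over a tube *)

Section extension.
Context (R : realType) (G : groupType) (Z : topologicalType).
Context (phi : 'rV[R]_(2 + 2) -> Z) (phiP : tube_chart phi).
Context (A : set Z) (c : Z -> Z -> G).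
Context (hZ : hausdorff_space Z) (clA : closed A).
Context (AT : A `&` tube phi = tube_boundary phi) (fc : flat A c).
Context (hol : holonomy c (fun t : R => phi (row_mx 0 (unit_circle t))) 1%g).

Let phiE : forall x y, phi x = phi y <->
  torus_eq (lsubmx x) (lsubmx y) /\ rsubmx x = rsubmx y.
Proof. by case: phiP. Qed.

(** Radial projection to the boundary of the tube, meaningful only off the core, where the fibre
    coordinate has a direction. *)
Definition tube_retract (z : Z) : Z :=
  phi (row_mx (lsubmx (tube_lift phi z)) (direction (rsubmx (tube_lift phi z)))).

Lemma tube_retractE a :
  tube_retract (phi a) = phi (row_mx (lsubmx a) (direction (rsubmx a))).
Proof.
apply/phiE; rewrite !row_mxKl !row_mxKr (tube_lift_rsubmx phiP); split=> //.
exact: tube_lift_lsubmx.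
Qed.

Let base (z : Z) : Z := phi (row_mx (lsubmx (tube_lift phi z)) (unit_circle 0)).

Let baseE a : base (phi a) = phi (row_mx (lsubmx a) (unit_circle 0)).
Proof.
apply/phiE; rewrite !row_mxKl !row_mxKr; split=> //.
exact: tube_lift_lsubmx.
Qed.

Lemma boundary_sub : tube_boundary phi `<=` A.
Proof. by rewrite -AT => z []. Qed.

Let pt (x : 'rV[R]_2) (t : R) : 'rV[R]_(2 + 1) := row_mx x (const_mx t).

Let boundary_paramE x t : boundary_param phi (pt x t) = phi (row_mx x (unit_circle t)).
Proof. by rewrite /boundary_param row_mxKl row_mxKr mxE. Qed.

Lemma flat_boundary_param : flat setT (pull (boundary_param phi) c).
Proof.
apply: flat_pull fc.
  by apply: continuous_subspaceT; exact: boundary_param_continuous.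
by move=> _ [x _ <-]; apply: boundary_sub; exact: boundary_param_boundary.
Qed.

Context (k : 'rV[R]_(2 + 1) -> G).
Context (kP : parallel setT (pull (boundary_param phi) c) k).
Local Open Scope group_scope.

(** A deck transformation preserves the pulled back transport, so the translate of the section [k]
    over [R^3] is again a section, and uniqueness provides the left constant [a]. *)
Let translate (w : 'rV[R]_(2 + 1)) : (forall x, boundary_param phi (x + w)%R = boundary_param phi x) ->
  exists a, forall x, k (x + w)%R = a * k x.
Proof.
move=> hw.
have kwP : parallel setT (pull (boundary_param phi) c) (k \o (fun x => x + w)%R).
  have cw : {within [set: 'rV[R]_(2 + 1)], continuous (fun x => x + w)%R}.
    by apply: continuous_subspaceT => x; apply: (@cvgD _ _ _ (nbhs x) _ id (cst w));
      [exact: cvg_id|exact: cvg_cst].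
  apply: eq_parallel (parallel_pull cw (@subsetT _ _) kP) => //.
  by move=> x y _ _; rewrite /pull !hw.
have cT : connected [set: 'rV[R]_(2 + 1)] by apply: convex_connected; exact: convex_setT.
have [a ha] := parallel_unique cT kP kwP.
by exists a => x; exact: ha.
Qed.

(** The deck transformation along the meridian has constant 1, by the trivial holonomy [hol]. This
    is where the hypothesis on the meridian enters: [k] becomes a function of the point of the
    circle. *)
Let period1 x t : k (pt x (t + 1)%R) = k (pt x t).
Proof.
have [|a ha] := @translate (pt 0%R 1%R).
  move=> y; rewrite /boundary_param /pt.
  have -> : lsubmx (y + row_mx 0 (const_mx 1))%R = lsubmx y :> 'rV[R]_2.
    by apply/rowP => i; rewrite !mxE (unsplitK (inl i)) mxE addr0.
  have -> : rsubmx (y + row_mx 0 (const_mx 1))%R 0%R 0%R = (rsubmx y 0%R 0%R + 1)%R :> R.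
    by rewrite !mxE (unsplitK (inr 0%R)) mxE.
  by rewrite unit_circle_periodic1.
have ptD y s : pt y (s + 1)%R = (pt y s + pt 0 1)%R.
  by rewrite /pt add_row_mx addr0; congr row_mx; apply/rowP => i; rewrite !mxE.
suff a1 : a = 1 by rewrite ptD ha a1 mul1g.
have mP : @parallel G R `[0%R, 1%R] (pull (fun t : R => phi (row_mx 0%R (unit_circle t))) c)
    (fun t => k (pt 0%R t)).
  have cpt : {within `[0%R, 1%R], continuous (pt 0%R)}.
    apply: continuous_subspaceT => s.
    apply: (@cvg_row_mx R _ (nbhs s) _ 1 2 1 (cst 0%R)); first exact: cvg_cst.
    apply: (@cvg_mx R _ (nbhs s)) => i j; rewrite mxE; under eq_fun do rewrite mxE.
    exact: cvg_id.
  apply: eq_parallel (parallel_pull cpt (@subsetT _ _) kP) => //.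
  by move=> s t' _ _; rewrite /pull !boundary_paramE.
have := parallel_holonomy hol mP.
have -> : pt 0%R 1%R = pt 0%R (0 + 1)%R by rewrite add0r.
rewrite mulg1 ptD ha => e.
by apply: (mulIg (k (pt 0%R 0%R))); rewrite mul1g.
Qed.

Let periodz x t (z : int) : k (pt x (t + z%:~R)%R) = k (pt x t).
Proof.
have nat_period (n : nat) s : k (pt x (s + n%:R)%R) = k (pt x s).
  elim: n => [|n IH]; first by rewrite addr0.
  by rewrite -addn1 natrD addrA period1.
case: z => n; first exact: nat_period.
by rewrite -[LHS](nat_period n.+1) NegzE mulrNz subrK.
Qed.

Let k_circle x t t' : unit_circle t = unit_circle t' -> k (pt x t) = k (pt x t').
Proof. by move=> /unit_circle_eq[z ->]; rewrite periodz. Qed.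

(** Along the torus directions the holonomy may be nontrivial; the constant is nevertheless the same
    at all angles, so it disappears from quotients of values of [k] over one point of the torus. *)
Let k_torus x x' : torus_eq x x' -> exists a, forall t, k (pt x' t) = a * k (pt x t).
Proof.
move=> xx'; have [z x'E] := xx'.
have [|a ha] := @translate (pt (map_mx intr z) 0%R).
  move=> y; apply/phiE; rewrite !row_mxKl !row_mxKr; split.
    exists (- z)%R; apply/rowP => i.
    by rewrite !mxE (unsplitK (inl i)) mxE mulrNz addrK.
  by congr unit_circle; rewrite !mxE (unsplitK (inr 0%R)) mxE addr0.
exists a => t; rewrite -ha x'E; congr k.
by rewrite /pt add_row_mx; congr row_mx; apply/rowP => i; rewrite !mxE addr0.
Qed.

(** A choice with no continuity. Its value 0 at the centre is the base angle used on the core. *)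
Let angle (y : 'rV[R]_2) : R :=
  if y == 0%R then 0%R else xget 0%R [set t | unit_circle t = direction y].

Let angleE y : y != 0%R -> unit_circle (angle y) = direction y.
Proof.
move=> y0; rewrite /angle (negbTE y0).
have [t ty] := unit_circle_surj (sqnorm_direction y0).
by case: xgetP => [s _ //|/(_ t)]; case.
Qed.

(** The future section in tube coordinates: the value of [k] at the radial projection, continued to
    the core by the value at angle 0. *)
Let kappa (a : 'rV[R]_(2 + 2)) : G := k (pt (lsubmx a) (angle (rsubmx a))).

(** Transport along the meridian circle from angle 0 to the angle of [z]. The constant of [k_torus]
    cancels, which makes this a function of [z] and not of its lift. *)
Let twist (z : Z) : G :=
  (k (pt (lsubmx (tube_lift phi z)) 0%R))^-1 * kappa (tube_lift phi z).

Let twistE a : twist (phi a) = (k (pt (lsubmx a) 0%R))^-1 * kappa a.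
Proof.
rewrite /twist /kappa (tube_lift_rsubmx phiP).
have [b hb] := k_torus (tube_lift_lsubmx phiP a).
by rewrite !hb invgM -mulgA mulKg.
Qed.

Definition tube_fold (z : Z) : Z := if pselect (A z) then z else tube_retract z.

Lemma tube_foldA z : A z -> tube_fold z = z.
Proof. by rewrite /tube_fold; case: pselect. Qed.

Lemma tube_fold_tube a : (sqnorm (rsubmx a) <= 1)%R -> tube_fold (phi a) = tube_retract (phi a).
Proof.
rewrite /tube_fold => a1; case: pselect => // Aa.
have : (A `&` tube phi) (phi a) by split=> //; exists a.
rewrite AT => /(tube_fibreE phiP [set y | sqnorm y = 1%R]) /= y1.
by rewrite tube_retractE direction_id// hsubmxK.
Qed.

Let core : set Z := tube_core phi.

(* On the core torus, transport goes along the base circle at angle 0 and then,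
   through [twist], along the meridian circle of the end point. *)
Definition tube_extend (z z' : Z) : G :=
  if pselect (core z) then c (base z) (base z') * twist z'
  else c (tube_fold z) (tube_fold z').

Let coreP a : core (phi a) <-> rsubmx a = 0%R.
Proof. exact: (tube_fibreE phiP [set 0%R]). Qed.

(** The discontinuity of [angle] does no harm: at a core point only the base point at angle 0 has to
    move continuously, and [twist] accounts exactly for the rest. *)
Let kappa_core a : rsubmx a = 0%R ->
  \forall a' \near a, kappa a' = kappa a * tube_extend (phi a) (phi a').
Proof.
move=> a0; have := kP (I : setT (pt (lsubmx a) 0%R)) => kP0.
have cp : {for a, continuous (fun b : 'rV[R]_(2 + 2) => pt (lsubmx b) 0%R)}.
  apply: (@cvg_row_mx R _ (nbhs a) _ 1 2 1 lsubmx); last exact: cvg_cst.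
  exact: lsubmx_continuous.
have := near_comp cp kP0; apply: filterS => b /(_ I) kb.
rewrite /tube_extend; case: pselect => [?|Ca]; last by case: Ca; apply/coreP.
rewrite /=; have -> : kappa a = k (pt (lsubmx a) 0%R).
  by rewrite /kappa a0 /angle eqxx.
by rewrite !baseE -!boundary_paramE twistE mulgA -kb mulVKg.
Qed.

(** Near a point off the core [angle] is replaced by a continuous branch [theta]. The two give the
    same point of the circle, hence the same value of [k]. *)
Let kappa_off a : rsubmx a != 0%R -> (sqnorm (rsubmx a) < 1)%R ->
  \forall a' \near a, kappa a' = kappa a * tube_extend (phi a) (phi a').
Proof.
move=> a0 a1.
have [theta [cth tha] thP] := local_angle a0 (angleE a0).
have cp : {for a, continuous (fun b : 'rV[R]_(2 + 2) => pt (lsubmx b) (theta (rsubmx b)))}.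
  apply: (@cvg_row_mx R _ (nbhs a) _ 1 2 1 lsubmx); first exact: lsubmx_continuous.
  apply: (@cvg_mx R _ (nbhs a)) => i j; rewrite mxE; under eq_fun do rewrite mxE.
  by apply: (@continuous_comp _ _ _ rsubmx); first exact: rsubmx_continuous.
have := near_comp cp (kP (I : setT (pt (lsubmx a) (theta (rsubmx a))))).
have := near_comp (@rsubmx_continuous R 2 2 a) (open_nbhs_nbhs (conj (@sqnorm_lt_open R) a1)).
have := near_comp (@rsubmx_continuous R 2 2 a) thP.
apply: filterS3 => b thb b1 /(_ I) kb.
(* The direction of the zero vector is computed as 0, which is not on the unit circle. *)
have b0 : rsubmx b != 0%R.
  apply/eqP => b0; have := sqnorm_unit_circle (theta (rsubmx b)).
  by rewrite thb b0 /direction scaler0 sqnorm0 => /esym/eqP; rewrite oner_eq0.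
have -> : kappa b = k (pt (lsubmx b) (theta (rsubmx b))).
  by apply: k_circle; rewrite angleE.
rewrite kb tha /kappa; congr (_ * _).
rewrite /tube_extend; case: pselect => [/coreP/eqP|?] /=; first by rewrite (negbTE a0).
rewrite !tube_fold_tube ?ltW// !tube_retractE /pull !boundary_paramE.
by rewrite angleE// thb.
Qed.

Lemma tube_core_A z : A z -> ~ core z.
Proof.
move=> Az [a /= a0 az]; have : (A `&` tube phi) z.
  by split=> //; exists a => //=; rewrite a0 sqnorm0.
rewrite AT -az => /(tube_fibreE phiP [set y | sqnorm y = 1%R]) /=.
by rewrite a0 sqnorm0 => /esym/eqP; rewrite oner_eq0.
Qed.

(** The tube without its core is not closed, but the separation conditions for pasting hold all the
    same, because [A] avoids the core. *)
Lemma tube_fold_continuous : {within A `|` (tube phi `\` core), continuous tube_fold}.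
Proof.
have clT : closed (tube phi) := compact_closed hZ (tube_compact phiP).
have [AT' TA'] := closed_separated clA clT.
apply: within_continuousU.
- move=> z Az nT; have : ~ tube phi z.
    by move=> Tz; apply: nT; split=> //; exact: tube_core_A.
  by move=> /(AT' _ Az); apply: filterS => w wTA [/wTA].
- move=> z [Tz Cz] nA; have := TA' _ Tz nA; apply: filterS => w wAT Aw.
  by split; [exact: wAT|exact: tube_core_A].
- apply: (within_continuous_eq (f := id)); first by move=> z /tube_foldA ->.
  by apply: continuous_subspaceT => z; exact: cvg_id.
apply: (within_continuous_eq (f := tube_retract)).
  by move=> _ [[a a1 <-] _]; rewrite tube_fold_tube.
apply: within_continuous_at => _ [[a a1 <-] Ca] P; rewrite tube_retractE => aP.
apply: (tube_chart_near phiP).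
have a0 : rsubmx a != 0%R by apply/eqP => a0; apply: Ca; apply/coreP.
have cp : {for a, continuous (fun b : 'rV[R]_(2 + 2) =>
    phi (row_mx (lsubmx b) (direction (rsubmx b))))}.
  apply: (@continuous_comp _ _ _ (fun b : 'rV[R]_(2 + 2) =>
    row_mx (lsubmx b) (direction (rsubmx b))) phi); last by have [cphi _ _] := phiP; exact: cphi.
  apply: (@cvg_row_mx R _ (nbhs a) _ 1 2 2 lsubmx); first exact: lsubmx_continuous.
  apply: (@continuous_comp _ _ _ rsubmx); first exact: rsubmx_continuous.
  exact: direction_continuous.
have := near_comp cp aP; apply: filterS => b.
by rewrite /= tube_retractE.
Qed.

(** Near the core, [kappa] read through a local inverse of [phi] is a section. Elsewhere the
    transport is the pullback of [c] by [tube_fold], so that flatness is inherited. *)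
Lemma tube_extend_flat : flat (A `|` tube phi) tube_extend.
Proof.
move=> z ATz.
have clC : closed core := compact_closed hZ (tube_core_compact phiP).
have [[a /= a0 az]|Cz] := pselect (core z).
  have [sec secP] := tube_chart_section phiP a.
  have a1 : (sqnorm (rsubmx a) < 1)%R by rewrite a0 sqnorm0.
  have a1P := near_comp (@rsubmx_continuous R 2 2 a)
    (open_nbhs_nbhs (conj (@sqnorm_lt_open R) a1)).
  pose V := interior [set b | sec (phi b) = b /\ (sqnorm (rsubmx b) < 1)%R].
  have oV : open V by exact: open_interior.
  have Va : V a by apply: filterS2 secP a1P.
  exists (phi @` V), (kappa \o sec); split.
    by have [_ _ ophi] := phiP; apply: open_nbhs_nbhs; split; [exact: ophi|exists a].
  move=> _ [_ [b Vb <-]]; apply: (tube_chart_near phiP).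
  have [sb b1] := interior_subset Vb.
  have Vnb := open_nbhs_nbhs (conj oV Vb).
  have kb : \forall a' \near b, kappa a' = kappa b * tube_extend (phi b) (phi a').
    have [b0|b0] := eqVneq (rsubmx b) 0%R; first exact: kappa_core.
    exact: kappa_off.
  apply: filterS2 Vnb kb => b' /interior_subset[sb' _] kb' _ /=.
  by rewrite sb sb' kb'.
have foldA : tube_fold @` (A `|` (tube phi `\` core)) `<=` A.
  move=> _ [w [Aw|[[a a1 <-] Ca]] <-]; first by rewrite tube_foldA.
  rewrite tube_fold_tube// tube_retractE; apply: boundary_sub.
  apply/(tube_fibreE phiP [set y | sqnorm y = 1%R]).
  rewrite /= row_mxKr sqnorm_direction//.
  by apply/eqP => a0; apply: Ca; apply/coreP.
have Dz : (A `|` (tube phi `\` core)) z by case: ATz; [left|right].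
have [U [h [zU hP]]] := flat_pull tube_fold_continuous foldA fc Dz.
exists (U `&` ~` core), h; split.
  by apply: filterI => //; apply: open_nbhs_nbhs; split=> //; exact: closed_openC.
apply: eq_parallel (parallel_sub _ hP) => //.
  by move=> w w' [_ [_ Cw]] _; rewrite /tube_extend; case: pselect.
by move=> w [[Aw|Tw] [Uw Cw]]; split=> //; [left|right].
Qed.

Lemma tube_extend_eq z z' : A z -> A z' -> tube_extend z z' = c z z'.
Proof.
move=> Az Az'; rewrite /tube_extend; case: pselect => [/(tube_core_A Az)//|?] /=.
by rewrite !tube_foldA.
Qed.

End extension.

(** The auxiliary section [k] is available because the boundary torus is covered by the contractible
    space [R^3]. *)
Lemma flat_extend_tube (R : realType) (G : groupType) (Z : topologicalType)
    (phi : 'rV[R]_(2 + 2) -> Z) (A : set Z) (c : Z -> Z -> G) :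
  tube_chart phi -> hausdorff_space Z -> closed A ->
  A `&` tube phi = tube_boundary phi -> flat A c ->
  holonomy c (fun t : R => phi (row_mx 0 (unit_circle t))) 1%g ->
  exists2 c' : Z -> Z -> G, flat (A `|` tube phi) c' &
    forall z z', A z -> A z' -> c' z z' = c z z'.
Proof.
move=> phiP hZ clA AT fc hol.
have [k kP] := row_vector_parallel (flat_boundary_param phiP AT fc).
exists (tube_extend phi A c k); first exact: (tube_extend_flat phiP hZ clA AT fc hol kP).
by move=> z z' Az Az'; exact: tube_extend_eq.
Qed.

(** * Families of disjoint tubes and their exteriors *)

Lemma connected_locally_constant (Z : topologicalType) (A : set Z) :
  (forall f : Z -> Prop,
    (forall z, A z -> \forall z' \near z, A z' -> f z' = f z) ->
    forall x y, A x -> A y -> f x = f y) ->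
  connected A.
Proof.
move=> cA D [d Dd] [U oU DU] [V clV DV]; apply/seteqP; split=> [z|z Az].
  by rewrite DU => -[].
have Ad : A d by move: Dd; rewrite DU => -[].
suff <- : D d = D z by [].
apply: cA => // w Aw.
have [Dw|Dw] := pselect (D w).
  have Uw : U w by move: Dw; rewrite DU => -[].
  apply: filterS (open_nbhs_nbhs (conj oU Uw)) => w' Uw' Aw'.
  by apply/propext; split => // _; rewrite DU.
have Vw : (~` V) w by move=> Vw; apply: Dw; rewrite DV.
have oV : open (~` V) by exact: closed_openC.
apply: filterS (open_nbhs_nbhs (conj oV Vw)) => w' Vw' Aw'.
by apply/propext; split => //; rewrite {1}DV => -[].
Qed.

(** A locally constant function on [A] is constant on the connected intersection, so it continues by
    that constant over [B], and connectedness of the union concludes. *)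
Lemma connected_setUl (Z : topologicalType) (A B : set Z) : closed A -> closed B ->
  connected (A `|` B) -> connected (A `&` B) -> connected A.
Proof.
move=> clA clB cAB cI; apply: connected_locally_constant => f fA x y Ax Ay.
have [AB BA] := closed_separated clA clB.
have [p pI] : exists p, forall z, (A `&` B) z -> f z = p.
  have [[w Iw]|I0] := pselect (A `&` B !=set0); last first.
    by exists True => z Iz; exfalso; apply: I0; exists z.
  exists (f w) => z Iz.
  apply: (locally_constant_connected cI) => // u [Au Bu].
  by apply: filterS (fA u Au) => v fv [Av _]; exact: fv.
pose f' z := if pselect (A z) then f z else p.
have f'A z : A z -> f' z = f z by rewrite /f'; case: pselect.
have f'nA z : ~ A z -> f' z = p by rewrite /f'; case: pselect.
have f'B z : B z -> f' z = p.
  by move=> Bz; have [Az|/f'nA//] := pselect (A z); rewrite f'A// pI.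
rewrite -!f'A//.
apply: (locally_constant_connected cAB); [|by left|by left] => z ABz.
have [Az|nAz] := pselect (A z); have [Bz|nBz] := pselect (B z).
- apply: filterS (fA z Az) => w fw [Aw|Bw]; first by rewrite !f'A// fw.
  by rewrite !f'B.
- apply: filterS2 (fA z Az) (AB z Az nBz) => w fw BAw ABw.
  by rewrite !f'A//; [apply: fw|]; case: ABw => // /BAw.
- apply: filterS (BA z Bz nAz) => w ABw' ABw.
  by rewrite !f'B//; case: ABw => // /ABw'.
- by case: ABz.
Qed.

Section tubes.
Context (R : realType) (Z : topologicalType) (hZ : hausdorff_space Z).
Context (r : nat) (phi : 'I_r -> 'rV[R]_(2 + 2) -> Z).
Context (phiP : forall i, tube_chart (phi i)).
Context (disj : forall i j, i != j -> tube (phi i) `&` tube (phi j) = set0).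

Let clT i : closed (tube (phi i)) := compact_closed hZ (tube_compact (phiP i)).

Lemma open_tube_sub (psi : 'rV[R]_(2 + 2) -> Z) : open_tube psi `<=` tube psi.
Proof. by move=> _ [a /= /ltW a1 <-]; exists a. Qed.

Lemma tube_boundary_sub (psi : 'rV[R]_(2 + 2) -> Z) : tube_boundary psi `<=` tube psi.
Proof. by move=> _ [a /= a1 <-]; exists a => //=; rewrite a1. Qed.

Lemma tube_disjoint i j z : tube (phi i) z -> tube (phi j) z -> i = j.
Proof.
move=> iz jz; apply: contrapT => /eqP /disj ij0.
by have : (tube (phi i) `&` tube (phi j)) z; [by split|rewrite ij0].
Qed.

Lemma tube_boundaryP (i : 'I_r) (z : Z) : tube (phi i) z ->
  ~ open_tube (phi i) z -> tube_boundary (phi i) z.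
Proof.
move=> [a /= a1 <-] na; exists a => //=.
apply/eqP; rewrite eq_le a1/= leNgt; apply/negP => a1'.
by apply: na; exists a.
Qed.

Lemma tube_boundary_open (i : 'I_r) (z : Z) : tube_boundary (phi i) z ->
  ~ open_tube (phi i) z.
Proof.
move=> [a /= a1 <-] /(tube_fibreE (phiP i) [set y | sqnorm y < 1]) /=.
by rewrite a1 ltxx.
Qed.

(* Points on the boundary of a tube are limits of points just outside. *)
Lemma interior_tubes : interior (\bigcup_i tube (phi i)) = \bigcup_i open_tube (phi i).
Proof.
apply/seteqP; split => z; last first.
  move=> [i _ iz]; apply: filterS (open_nbhs_nbhs (conj (open_tube_open (phiP i)) iz)).
  by move=> w /open_tube_sub iw; exists i.
move=> zint; have [i _ iz] := interior_subset zint.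
exists i => //; apply: contrapT => nz.
have [a /= a1 az] := tube_boundaryP iz nz.
(* The other tubes are closed and miss [z], so near [z] the union of all tubes is the tube [i]
   alone. *)
have outer : \forall w \near z, forall j, j != i -> ~ tube (phi j) w.
  apply: filter_forall => j; have [->|ji] := eqVneq j i.
    exact: filterE.
  have oj : open (~` tube (phi j)) by apply: closed_openC.
  have zj : (~` tube (phi j)) z.
    by move=> jz; move: ji; rewrite (tube_disjoint jz iz) eqxx.
  by apply: filterS (open_nbhs_nbhs (conj oj zj)) => w ? _.
have inner : \forall w \near z, tube (phi i) w.
  apply: filterS2 outer zint => w wo [j _ jw].
  by have [<-//|/wo] := eqVneq j i; case.
(* The radial segment through [z]: as soon as its parameter exceeds 1 it leaves the tube. *)
pose b t := phi i (row_mx (lsubmx a) (t *: rsubmx a)).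
have cb : {for 1, continuous b}.
  apply: (@continuous_comp _ _ _ (fun t : R => row_mx (lsubmx a) (t *: rsubmx a)) (phi i)).
    apply: (@cvg_row_mx R _ (nbhs (1 : R)) _ 1 2 2 (cst (lsubmx a))); first exact: cvg_cst.
    by apply: cvgZr_tmp; exact: cvg_id.
  by have [cphi _ _] := phiP i; exact: cphi.
have b1 : b 1 = z by rewrite /b scale1r hsubmxK.
rewrite -b1 in inner.
have [e /= e0 eP] : exists2 e : R, 0 < e & forall t, `|1 - t| < e -> tube (phi i) (b t).
  by have /nbhs_ballP[e e0 eP] := near_comp cb inner; exists e => // t te; exact: eP.
have : tube (phi i) (b (1 + e / 2)).
  by apply: eP; rewrite opprD addNKr normrN gtr0_norm; lra.
move=> /(tube_fibreE (phiP i) [set y | sqnorm y <= 1]) /=.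
rewrite row_mxKr sqnormZ a1 mulr1; apply/negP; rewrite -ltNge.
by rewrite exprn_egt1// ltrDl divr_gt0.
Qed.

Lemma exteriorE : exterior phi = ~` \bigcup_i open_tube (phi i).
Proof. by rewrite /exterior interior_tubes. Qed.

(** Raising [k] from 0 to [r] refills the tubes one at a time, from the exterior to the whole
    space. *)
Definition partial_exterior (k : nat) : set Z :=
  ~` \bigcup_(i in [set i : 'I_r | (k <= i)%N]) open_tube (phi i).

Lemma partial_exterior0 : partial_exterior 0 = exterior phi.
Proof. by rewrite exteriorE /partial_exterior; congr (~` _); apply: eq_bigcupl. Qed.

Lemma partial_exterior_full : partial_exterior r = setT.
Proof.
by apply/seteqP; split => // z _ [i /= ri _]; move: (ltn_ord i); rewrite ltnNge ri.
Qed.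

Lemma partial_exterior_closed k : closed (partial_exterior k).
Proof. by apply: open_closedC; apply: bigcup_open => i _; exact: open_tube_open. Qed.

Lemma partial_exteriorS (i : 'I_r) :
  partial_exterior i.+1 = partial_exterior i `|` tube (phi i).
Proof.
apply/seteqP; split => [z Az|z [Az|iz] [j /= ij jz]].
- have [/open_tube_sub iz|iz] := pselect (open_tube (phi i) z); first by right.
  left=> -[j /= ij jz]; apply: Az; exists j => //=.
  rewrite ltn_neqAle ij andbT; apply/negP => /eqP/val_inj ji.
  by apply: iz; rewrite ji.
- by apply: Az; exists j => //=; exact: ltnW.
- have ji := tube_disjoint iz (open_tube_sub jz).
  by move: ij; rewrite ji ltnn.
Qed.

Lemma partial_exterior_tube (i : 'I_r) :
  partial_exterior i `&` tube (phi i) = tube_boundary (phi i).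
Proof.
apply/seteqP; split => [z [Az iz]|z iz].
  by apply: tube_boundaryP => // iz'; apply: Az; exists i => /=.
have iz' := tube_boundary_sub iz.
split=> // -[j _ jz]; have ij := tube_disjoint iz' (open_tube_sub jz).
by apply: tube_boundary_open iz _; rewrite ij.
Qed.

Lemma exterior_boundary (i : 'I_r) : tube_boundary (phi i) `<=` exterior phi.
Proof.
move=> z iz; rewrite exteriorE => -[j _ jz].
have ij := tube_disjoint (tube_boundary_sub iz) (open_tube_sub jz).
by apply: tube_boundary_open iz _; rewrite ij.
Qed.

(** The tubes are removed one at a time from the whole space; each meets what remains in its
    boundary torus, which is connected, so [connected_setUl] applies. *)
Lemma exterior_connected : connected [set: Z] -> connected (exterior phi).
Proof.
rewrite -partial_exterior0 -partial_exterior_full.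
have step k : (k <= r)%N -> connected (partial_exterior k) -> connected (partial_exterior 0).
  elim: k => // k IH kr cS; apply: (IH (ltnW kr)).
  apply: (@connected_setUl _ _ (tube (phi (Ordinal kr)))) => //.
  - exact: partial_exterior_closed.
  - by rewrite -(partial_exteriorS (Ordinal kr)).
  - rewrite (partial_exterior_tube (Ordinal kr)).
    exact: tube_boundary_connected.
exact: step.
Qed.

(** Each extension leaves the transport on the exterior unchanged. All the meridian circles lie
    there, so the condition on the remaining tubes persists through the induction. *)
Lemma flat_extend_tubes (G : groupType) (c : Z -> Z -> G) :
  flat (exterior phi) c ->
  (forall i, holonomy c (fun t : R => phi i (row_mx 0 (unit_circle t))) 1%g) ->
  exists2 c' : Z -> Z -> G, flat setT c' &
    forall z z', exterior phi z -> exterior phi z' -> c' z z' = c z z'.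
Proof.
rewrite -{1}partial_exterior0 -partial_exterior_full => fc hol.
have step k : (k <= r)%N -> exists2 c' : Z -> Z -> G, flat (partial_exterior k) c' &
    forall z z', exterior phi z -> exterior phi z' -> c' z z' = c z z'.
  elim: k => [|k IH] kr; first by exists c.
  have [c' fc' c'c] := IH (ltnW kr); pose i := Ordinal kr.
  have hol' : holonomy c' (fun t : R => phi i (row_mx 0 (unit_circle t))) 1%g.
    have [h hP h1] := hol i; exists h => //; apply: eq_parallel hP => // s t _ _.
    have ext u : exterior phi (phi i (row_mx 0 (unit_circle u))).
      apply: (exterior_boundary (i := i)).
      apply/(tube_fibreE (phiP i) [set y | sqnorm y = 1]).
      by rewrite /= row_mxKr sqnorm_unit_circle.
    by rewrite /pull c'c.
  have [c'' fc'' c''c'] := flat_extend_tube (phiP i) hZ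
    (@partial_exterior_closed k) (partial_exterior_tube i) fc' hol'.
  exists c''; first by rewrite (partial_exteriorS i).
  move=> z z' ez ez'; rewrite c''c' ?c'c//.
  - move: ez; rewrite exteriorE => ez -[j _ jz]; apply: ez; by exists j.
  - move: ez'; rewrite exteriorE => ez' -[j _ jz]; apply: ez'; by exists j.
exact: step.
Qed.

End tubes.

(** A torus exterior is the case of a family with one member, for which disjointness is vacuous. *)
Lemma torus_exteriorE (R : realType) (Z : topologicalType)
    (psi : 'rV[R]_(2 + 2) -> Z) :
  torus_exterior psi = exterior (fun _ : 'I_1 => psi).
Proof.
rewrite /torus_exterior /exterior; congr (~` interior _).
by apply/seteqP; split => [z psiz|z [_ _ psiz]//]; exists ord0.
Qed.

(** * Weak charts: small paths and small homotopies *)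

(* The chart k need not be onto B: only its one-sided inverse e matters. *)
Definition chart_in (R : realType) (X : topologicalType) (V : set X) (x : X) : Prop :=
  exists n (B : set 'rV[R]_n) (U : set X) (k : X -> 'rV[R]_n) (e : 'rV[R]_n -> X),
    [/\ nbhs x U, U `<=` V, {within U, continuous k} /\ k @` U `<=` B,
        convex_set B /\ {within B, continuous e} &
        e @` B `<=` V /\ forall u, U u -> e (k u) = u].

Section charts.
Context (R : realType) (X : topologicalType).

Lemma convex_setI n (A B : set 'rV[R]_n) : convex_set A -> convex_set B ->
  convex_set (A `&` B).
Proof. by move=> cA cB x y t [Ax Bx] [Ay By] tI; split; [exact: cA|exact: cB]. Qed.

Lemma chart_in_shrink (V W : set X) (x : X) : chart_in R V x -> nbhs x W ->
  chart_in R (V `&` W) x.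
Proof.
move=> [n [B [U [k [e [xU UV [ck kB] [cB ce] [eV ek]]]]]]] xW.
have Ux := nbhs_singleton xU.
have Bkx : B (k x) by apply: kB; exists x.
have eW : nbhs (e (k x)) W by rewrite ek.
have [d /= d0 dW] : exists2 d : R, 0 < d & ball (k x) d `<=` [set y | B y -> W (e y)].
  by have /nbhs_ballP := within_continuous_near ce Bkx eW.
have kx : nbhs (k x) (ball (k x) d) by exact: nbhsx_ballx.
exists n, (B `&` ball (k x) d), (U `&` W `&` [set u | U u -> ball (k x) d (k u)]), k, e.
split.
- by apply: filterI; [exact: filterI|exact: within_continuous_near ck Ux kx].
- by move=> u [[Uu Wu] _]; split=> //; exact: UV.
- split; first by apply: within_continuous_sub ck => u [[]].
  by move=> _ [u [[Uu Wu] kd] <-]; split; [apply: kB; exists u|exact: kd].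
- split; first by apply: convex_setI => //; exact: ball_convex.
  by apply: within_continuous_sub ce => u [].
- split; first by move=> _ [y [By dy] <-]; split; [apply: eV; exists y|exact: dW].
  by move=> u [[Uu _] _]; exact: ek.
Qed.

Lemma chart_in_sub (V W : set X) (x : X) : V `<=` W -> chart_in R V x -> chart_in R W x.
Proof.
move=> VW [n [B [U [k [e [xU UV kP eP [eV ek]]]]]]].
exists n, B, U, k, e; split=> //; first exact: subset_trans VW.
by split=> //; exact: subset_trans VW.
Qed.

Lemma chart_in_path (V : set X) (x : X) : chart_in R V x ->
  \forall x' \near x, exists p : R -> X, path_in V x x' p.
Proof.
move=> [n [B [U [k [e [xU UV [ck kB] [cB ce] [eV ek]]]]]]].
apply: filterS (xU) => y Uy.
have Bk u : U u -> B (k u) by move=> Uu; apply: kB; exists u.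
exists (e \o line_path (k x) (k y)).
have Ux := nbhs_singleton xU.
rewrite -{1}(ek x Ux) -{1}(ek y Uy).
by apply: path_in_comp ce eV _; apply: line_path_in => //; exact: Bk.
Qed.

(** The straight-line homotopy in [B] is mapped back by [e]. Its ends are the given paths, since
    these lie in [U], where [e] inverts [k]; the homotopy itself may leave [U] but not [V]. *)
Lemma chart_in_homotopic (V : set X) (x : X) : chart_in R V x ->
  exists2 U, nbhs x U & forall p q (l l' : R -> X),
    path_in U p q l -> path_in U p q l' -> homotopic V l l'.
Proof.
move=> [n [B [U [k [e [xU UV [ck kB] [cB ce] [eV ek]]]]]]].
exists U => // p q l l' lP l'P.
have [H [cH HA H0 H1] Hs] := homotopic_comp ce eV
  (convex_homotopic cB (path_in_comp ck kB lP) (path_in_comp ck kB l'P)).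
have I0 : `[0, 1]%classic (0 : R) by apply: itv01P; lra.
have I1 : `[0, 1]%classic (1 : R) by apply: itv01P; lra.
have el : forall t, `[0, 1]%classic t -> e (k (l t)) = l t.
  by move=> t tI; rewrite ek//; exact: path_in_mem lP tI.
exists H; last by move=> s sI; have := Hs s sI; rewrite /= !el.
split=> //.
- by move=> t tI; rewrite H0//= el//; move: tI; rewrite inE.
- move=> t tI; rewrite H1//= ek//; apply: (path_in_mem l'P).
  by move: tI; rewrite inE.
Qed.

Lemma chart_locally_path_connected : (forall x, chart_in R [set: X] x) ->
  locally_path_connected R X.
Proof.
move=> cX x V xV; apply: chart_in_path.
by apply: chart_in_sub (chart_in_shrink (cX x) xV) => u [].
Qed.

End charts.

Lemma chart_in_is_chart (R : realType) (n : nat) (X : topologicalType)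
    (U : set X) (k : X -> 'rV[R]_n) (x : X) :
  is_chart U k -> U x -> chart_in R [set: X] x.
Proof.
move=> [oU kinj ck kopen] Ux.
have okU : open (k @` U) by exact: kopen.
have [d /= d0 dU] : exists2 d : R, 0 < d & ball (k x) d `<=` k @` U.
  have /nbhs_ballP// : nbhs (k x) (k @` U).
  by apply: open_nbhs_nbhs; split=> //; exists x.
pose B := ball (k x) d.
pose e y := xget x [set u | U u /\ k u = y].
have eP u : U u -> e (k u) = u.
  move=> Uu; rewrite /e; case: xgetP => [w _ [Uw kw]|/(_ u)]; last by case.
  by apply: kinj => //; exact: mem_set.
exists n, B, (U `&` [set u | B (k u)]), k, e; split=> //.
- apply: filterI; first exact: open_nbhs_nbhs.
  apply: near_comp; [exact: ck|exact: nbhsx_ballx].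
- split; last by move=> _ [u [_ Bu] <-].
  by apply: within_continuous_at => u [Uu _]; exact: ck.
- split; first exact: ball_convex.
  apply: within_continuous_at => y By P.
  have [u Uu uy] := dU _ By; rewrite -uy eP// => uP.
  have oV : open (k @` (U `&` interior P)).
    by apply: kopen; [apply: openI => //; exact: open_interior|move=> w []].
  have yV : (k @` (U `&` interior P)) (k u) by exists u.
  apply: filterS (open_nbhs_nbhs (conj oV yV)) => _ [w [Uw /interior_subset Pw] <-].
  by rewrite /= eP.
- by split=> // u [Uu _]; exact: eP.
Qed.

Lemma smooth_tube_chart (R : realType) (M : charted_space R 4)
    (f : 'rV[R]_2 -> M) (phi : 'rV[R]_(2 + 2) -> M) :
  tubular_nbhd f phi -> tube_chart phi.
Proof. by move=> [[cphi _] phiE ophi _ _]; split. Qed.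

(** * The 4-sphere *)

(** The segment between two nonzero orthogonal vectors misses 0. From dimension 3 on, any [x] and
    [y] have a common nonzero orthogonal vector, in the kernel of a matrix of rank at most 2, and
    are joined through it. *)
Lemma punctured_connected (R : realType) (n : nat) :
  (2 < n)%N -> connected [set x : 'rV[R]_n | x != 0].
Proof.
move=> n2; apply: connected_locally_constant => f fP x y x0 y0.
have orth (u w : 'rV[R]_n) : u != 0 -> w != 0 -> u *m w^T = 0 -> f u = f w.
  move=> u0 w0 uw.
  have seg t : `[0, 1]%classic t -> line_path u w t != 0.
    rewrite /= in_itv/= => /andP[t0 t1]; apply/eqP => l0.
    have dot (v : 'rV[R]_n) : v *m v^T = 0 -> v = 0.
      move=> /matrixP/(_ 0 0); rewrite !mxE => vv; apply: sqnorm_eq0.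
      by rewrite -[RHS]vv; apply: eq_bigr => i _; rewrite mxE expr2.
    have wu : w *m u^T = 0 by rewrite -[LHS]trmxK trmx_mul trmxK uw trmx0.
    have := congr1 (mulmx^~ u^T) l0; have := congr1 (mulmx^~ w^T) l0.
    rewrite /line_path /= !mulmxDl -!scalemxAl uw wu !scaler0 add0r addr0 !mul0mx.
    move=> /eqP; rewrite scaler_eq0 => /orP[/eqP t00|/eqP/dot w00]; last first.
      by move: w0; rewrite w00 eqxx.
    rewrite t00 subr0 scale1r => /dot u00; by move: u0; rewrite u00 eqxx.
  have cS : connected (line_path u w @` `[0, 1]).
    apply: connected_continuous_connected; first exact: segment_connected.
    by have [] := line_path_in (@convex_setT R n) (I : setT u) (I : setT w).
  apply: (locally_constant_connected cS).
  - move=> z [t tI tz]; have z0 : z != 0 by rewrite -tz; exact: seg.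
    apply: filterS (fP z z0) => z' fz' [t' t'I tz'].
    by apply: fz'; rewrite /= -tz'; exact: seg.
  - by exists 1; [apply: itv01P; lra|rewrite /line_path subrr scale0r add0r scale1r].
  - by exists 0; [apply: itv01P; lra|rewrite /line_path subr0 scale0r addr0 scale1r].
pose K := kermx (col_mx x y)^T.
have K0 : K != 0.
  rewrite -mxrank_eq0 mxrank_ker subn_eq0 -ltnNge mxrank_tr.
  exact: leq_ltn_trans (rank_leq_row _) n2.
have /rowV0Pn[w /sub_kermxP wK w0] := K0.
move: wK; rewrite tr_col_mx mul_mx_row -[0]row_mx0 => /eq_row_mx[wx wy].
by rewrite -(orth w x)// -(orth w y).
Qed.

Section sphere.
Context (R : realType).
Implicit Types (b : bool) (x : S4 R) (y : 'rV[R]_4).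

Let e (j : 'I_4) : 'I_5 := widen_ord (leqnSn 4) j.

Let eN j : (e j == ord_max) = false.
Proof. by apply/negbTE; rewrite -val_eqE/= neq_ltn ltn_ord. Qed.

Let inordE j : inord (e j) = j :> 'I_4.
Proof. by apply: val_inj; rewrite /= inordK. Qed.

(** [s b] is the height of the pole of projection and [sg b] the reflection built into the southern
    chart, so that one computation serves both charts. *)
Let s b : R := (-1) ^+ b.
Let sg b (j : 'I_4) : R := (-1) ^+ (b && (j == ord_max)).

Let s2 b : s b * s b = 1. Proof. by rewrite /s -signr_addb addbb. Qed.
Let sg2 b j : sg b j * sg b j = 1. Proof. by rewrite /sg -signr_addb addbb. Qed.

(* Projection from the north pole (b = false) or from the south pole. *)
Definition stereo b x : 'rV[R]_4 :=
  \row_j (sg b j * ((set_val x : 'rV[R]_5) 0 (e j) / (1 - s b * (set_val x : 'rV[R]_5) 0 ord_max))).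

(** Inverse stereographic projection, [y] to [(2 y, |y|^2 - 1) / (1 + |y|^2)], with the signs of the
    chosen pole. *)
Let inv_row b y : 'rV[R]_5 := \row_j
  (if j == ord_max then s b * ((sqnorm y - 1) / (1 + sqnorm y))
   else sg b (inord j) * (2 * y 0 (inord j) / (1 + sqnorm y))).

Let inv_last b y : inv_row b y 0 ord_max = s b * ((sqnorm y - 1) / (1 + sqnorm y)).
Proof. by rewrite mxE eqxx. Qed.

Let inv_coord b y j : inv_row b y 0 (e j) = sg b j * (2 * y 0 j / (1 + sqnorm y)).
Proof. by rewrite mxE eN inordE. Qed.

Let sqnorm5 (z : 'rV[R]_5) : sqnorm z = \sum_j z 0 (e j) ^+ 2 + z 0 ord_max ^+ 2.
Proof. by rewrite /sqnorm big_ord_recr. Qed.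

Let D_neq0 y : 1 + sqnorm y != 0.
Proof. by rewrite lt0r_neq0// ltr_pwDl// sqnorm_ge0. Qed.

Let inv_sphere b y : sphere4 (inv_row b y).
Proof.
rewrite /sphere4/= sqnorm5 inv_last.
under eq_bigr do rewrite inv_coord.
have -> : \sum_j (sg b j * (2 * y 0 j / (1 + sqnorm y))) ^+ 2 =
    (2 / (1 + sqnorm y)) ^+ 2 * sqnorm y.
  rewrite {3}/sqnorm mulr_sumr; apply: eq_bigr => j _.
  by rewrite exprMn expr2 sg2 mul1r mulrAC exprMn.
rewrite [(s b * _) ^+ 2]exprMn [s b ^+ 2]expr2 s2 mul1r; field; exact: D_neq0.
Qed.

Definition stereo_inv b y : S4 R := exist _ (inv_row b y) (mem_set (inv_sphere b y)).

Let U b : set (S4 R) := ~` height (s b).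

Let UE b x : U b x -> 1 - s b * (set_val x : 'rV[R]_5) 0 ord_max != 0.
Proof.
move=> Ux; apply/eqP => /eqP; rewrite subr_eq0 => /eqP e1; apply: Ux.
by rewrite /height/= -[LHS]mul1r -(s2 b) -mulrA -e1 mulr1.
Qed.

Let sphereE x : \sum_j (set_val x : 'rV[R]_5) 0 (e j) ^+ 2 =
  1 - (set_val x : 'rV[R]_5) 0 ord_max ^+ 2.
Proof.
have : sphere4 (set_val x) by exact: set_valP.
by rewrite /sphere4/= sqnorm5 => /(canRL (addrK _)).
Qed.

Lemma stereoK b x : U b x -> stereo_inv b (stereo b x) = x.
Proof.
move=> /UE Ux; apply: val_inj => /=.
set h := (set_val x : 'rV[R]_5) 0 ord_max in Ux *.
have nE : sqnorm (stereo b x) = (1 + s b * h) / (1 - s b * h).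
  rewrite /sqnorm; under eq_bigr do rewrite mxE exprMn expr2 sg2 mul1r exprMn.
  rewrite -mulr_suml sphereE -/h.
  have -> : 1 - h ^+ 2 = (1 + s b * h) * (1 - s b * h).
    have -> : h ^+ 2 = (s b * s b) * h ^+ 2 by rewrite s2 mul1r.
    ring.
  by field.
have DE : 1 + sqnorm (stereo b x) = 2 / (1 - s b * h) by rewrite nE; field.
apply/rowP => j; have [->|jn] := eqVneq j ord_max.
  rewrite inv_last DE nE -/h.
  have -> : h = s b * (s b * h) by rewrite mulrA s2 mul1r.
  congr (_ * _); rewrite mulrA s2 mul1r.
  by field; rewrite Ux.
have j4 : (j < 4)%N.
  by have := ltn_ord j; rewrite ltnS leq_eqVlt => /orP[/eqP j4|//]; move: jn; rewrite -val_eqE/= j4.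
have -> : j = e (Ordinal j4) by exact: val_inj.
rewrite inv_coord DE mxE -/h.
rewrite (_ : sg b _ * _ = (sg b (Ordinal j4) * sg b (Ordinal j4)) * (set_val x : 'rV[R]_5) 0 (e (Ordinal j4))).
  by rewrite sg2 mul1r.
by field; rewrite Ux.
Qed.

Lemma stereo_inv_dom b y : U b (stereo_inv b y).
Proof.
rewrite /U /height/= => /(congr1 ( *%R (s b))).
rewrite set_valE /= inv_last mulrA s2 mul1r => e1.
have : sqnorm y - 1 = 1 + sqnorm y by rewrite -[LHS](mulfVK (D_neq0 y)) e1 mul1r.
by lra.
Qed.

Lemma set_val_continuous : continuous (fun x : S4 R => (set_val x : 'rV[R]_5)).
Proof. exact: initial_continuous. Qed.

Lemma stereo_inv_continuous b : continuous (stereo_inv b).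
Proof.
apply: continuous_comp_initial => y.
apply: (@cvg_mx R _ (nbhs y)) => i j; rewrite set_valE /= mxE.
have cD : {for y, continuous (fun y : 'rV[R]_4 => (1 + sqnorm y)^-1)}.
  apply: (@cvgV R _ (nbhs y) _ (fun y => 1 + sqnorm y)); first exact: D_neq0.
  by apply: cvgD; [exact: cvg_cst|exact: sqnorm_continuous].
under eq_fun do rewrite mxE.
case: ifP => _.
  apply: (@cvgM _ _ (nbhs y) _ (cst (s b))); first exact: cvg_cst.
  apply: (@cvgM _ _ (nbhs y) _ (fun y => sqnorm y - 1)); last exact: cD.
  apply: (@cvgB _ _ _ (nbhs y) _ (@sqnorm R 4)); last exact: cvg_cst.
  exact: sqnorm_continuous.
apply: (@cvgM _ _ (nbhs y) _ (cst (sg b (inord j)))); first exact: cvg_cst.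
apply: (@cvgM _ _ (nbhs y) _ (fun y => 2 * y 0 (inord j))); last exact: cD.
apply: (@cvgM _ _ (nbhs y) _ (cst 2)); first exact: cvg_cst.
exact: coord_continuous.
Qed.

Let coord_cont j : continuous (fun x : S4 R => (set_val x : 'rV[R]_5) 0 j).
Proof.
move=> x; apply: (@cvg_coord R _ (nbhs x) _ 1 5 (fun x : S4 R => (set_val x : 'rV[R]_5))).
exact: set_val_continuous.
Qed.

Lemma stereo_continuous b x : U b x -> {for x, continuous (stereo b)}.
Proof.
move=> /UE Ux.
apply: (@cvg_mx R _ (nbhs x)) => i j; rewrite mxE.
under eq_fun do rewrite mxE.
apply: (@cvgM _ _ (nbhs x) _ (cst (sg b j))); first exact: cvg_cst.
apply: (@cvgM _ _ (nbhs x) _ (fun x => (set_val x : 'rV[R]_5) 0 (e j))).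
  exact: coord_cont.
apply: (@cvgV R _ (nbhs x) _ (fun x => 1 - s b * (set_val x : 'rV[R]_5) 0 ord_max)) => //.
apply: cvgB; first exact: cvg_cst.
apply: (@cvgM _ _ (nbhs x) _ (cst (s b))); first exact: cvg_cst.
exact: coord_cont.
Qed.

Lemma dom_open b : open (U b).
Proof.
apply: closed_openC.
rewrite (_ : height _ = (fun x : S4 R => (set_val x : 'rV[R]_5) 0 ord_max) @^-1` [set t | t = s b])//.
by apply: closed_comp; [move=> x _; exact: coord_cont|exact: closed_eq].
Qed.

Lemma dom_cover : U false `|` U true = setT.
Proof.
apply/seteqP; split => // x _.
have [xN|xN] := pselect (U false x); [by left|right => xS].
have {}xN : height (s false) x by exact: contrapT.
have : s false = s true by rewrite -xN -xS.
by rewrite /s expr0 expr1; lra.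
Qed.

Lemma sphere_chart x : chart_in R [set: S4 R] x.
Proof.
have [b Ubx] : exists b, U b x.
  have : setT x by []; rewrite -dom_cover => -[?|?]; by [exists false|exists true].
exists 4%N, setT, (U b), (stereo b), (stereo_inv b); split=> //.
- exact: open_nbhs_nbhs (conj (dom_open b) Ubx).
- by split=> //; apply: within_continuous_at => z; exact: stereo_continuous.
- by split=> //; apply: continuous_subspaceT; exact: stereo_inv_continuous.
- by split=> //; exact: stereoK.
Qed.

Lemma sphere_hausdorff : hausdorff_space (S4 R).
Proof.
move=> x y xy; apply: val_inj.
apply: (@norm_hausdorff R 'rV[R]_5) => A B xA yB.
have xA' : nbhs x (fun x : S4 R => A (set_val x)) by exact: set_val_continuous xA.
have yB' : nbhs y (fun x : S4 R => B (set_val x)) by exact: set_val_continuous yB.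
by have [z [Az Bz]] := xy _ _ xA' yB'; exists (set_val z).
Qed.

Lemma dom_connected b : connected (U b).
Proof.
have -> : U b = stereo_inv b @` setT.
  apply/seteqP; split=> [x Ux|_ [y _ <-]]; last exact: stereo_inv_dom.
  by exists (stereo b x) => //; rewrite stereoK.
apply: connected_continuous_connected.
  by apply: convex_connected; exact: convex_setT.
by apply: continuous_subspaceT; exact: stereo_inv_continuous.
Qed.

(** In the coordinates of projection from the north pole, the south pole is the origin. *)
Let overlapE : U false `&` U true = stereo_inv false @` [set y | y != 0].
Proof.
have hE y : (set_val (stereo_inv false y) : 'rV[R]_5) 0 ord_max = (sqnorm y - 1) / (1 + sqnorm y).
  by rewrite set_valE /= inv_last /s expr0 mul1r.
apply/seteqP; split=> [x [xN xS]|_ [y /= y0 <-]].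
  exists (stereo false x); last by rewrite stereoK.
  apply/eqP => x0; apply: xS; rewrite /height/= -[x](stereoK xN) hE x0.
  by rewrite sqnorm0 /s expr1 sub0r addr0 divr1.
split; first exact: stereo_inv_dom.
rewrite /U /height/= => /eqP; rewrite hE /s expr1 => /eqP e1.
have : sqnorm y - 1 = - (1 + sqnorm y) by rewrite -[LHS](mulfVK (D_neq0 y)) e1 mulN1r.
move=> e2; have /sqnorm_eq0 y00 : sqnorm y = 0 by lra.
by move: y0; rewrite y00 eqxx.
Qed.

Lemma overlap_connected : connected (U false `&` U true).
Proof.
rewrite overlapE; apply: connected_continuous_connected.
  exact: punctured_connected.
by apply: continuous_subspaceT; exact: stereo_inv_continuous.
Qed.

Lemma sphere_connected : connected [set: S4 R].
Proof.
rewrite -dom_cover; apply: connectedU; [|exact: dom_connected|exact: dom_connected].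
rewrite overlapE; exists (stereo_inv false (const_mx 1)), (const_mx 1) => //=.
by apply/eqP => /matrixP/(_ 0 0)/eqP; rewrite !mxE oner_eq0.
Qed.

(* The 4-sphere is a union of two cells with connected intersection. *)
Lemma sphere_parallel (G : groupType) (c : S4 R -> S4 R -> G) :
  flat setT c -> exists h, parallel setT c h.
Proof.
move=> fc.
have hemi b : exists h, parallel (U b) c h.
  have [|h hP] := @row_vector_parallel R 4 G (pull (stereo_inv b) c).
    by apply: flat_pull fc => //; apply: continuous_subspaceT; exact: stereo_inv_continuous.
  exists (h \o stereo b).
  have ck : {within U b, continuous (stereo b)}.
    by apply: within_continuous_at => z; exact: stereo_continuous.
  apply: eq_parallel (parallel_pull ck (@subsetT _ _) hP) => // x x' Ux Ux'.
  by rewrite /pull !stereoK.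
have [[h hP] [h' h'P]] := (hemi false, hemi true).
have [AB BA] := open_separated (dom_open false) (dom_open true).
rewrite -dom_cover.
exact: parallel_glue AB BA overlap_connected hP h'P.
Qed.

End sphere.

(** * Homotopies of paths and the group laws *)

Section homotopy_calculus.
Context (R : realType) (X : topologicalType).
Implicit Types (A : set X) (l : R -> X).

Lemma square_glue (H1 H2 : R * R -> X) :
  {within `[0, 1] `*` `[0, 1], continuous H1} ->
  {within `[0, 1] `*` `[0, 1], continuous H2} ->
  (forall t, `[0, 1]%classic t -> H1 (1, t) = H2 (0, t)) ->
  {within `[0, 1] `*` `[0, 1],
    continuous (fun st => path_cat (fun s => H1 (s, st.2)) (fun s => H2 (s, st.2)) st.1)}.
Proof.
move=> c1 c2 H12.
have cover : (`[0, 1] `*` `[0, 1] : set (R * R)) `<=`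
    (`[0, 2^-1] `*` `[0, 1]) `|` (`[2^-1, 1] `*` `[0, 1]).
  by move=> [s t] [/= /halves_cover [sI|sI] tI]; [left|right].
apply: within_continuous_sub cover _.
apply: withinU_continuous; [exact: closed_rectangle|exact: closed_rectangle| |].
- apply: (within_continuous_eq (f := H1 \o (fun st => (2 * st.1, st.2)))).
    by move=> [s t] [/= sI tI]; rewrite path_cat_left.
  apply: (within_continuous_compose _ _ c1).
    apply: continuous_subspaceT => st; apply: cvg_to_pair; last exact: cvg_snd.
    apply: (@continuous_comp _ _ _ fst (fun t : R => 2 * t)); first exact: cvg_fst.
    exact: continuous_double.
  move=> _ [[s t] [/= sI tI] <-]; split=> //=; apply: double_itv.
  by exists s.
- apply: (within_continuous_eq (f := H2 \o (fun st => (2 * st.1 - 1, st.2)))).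
    by move=> [s t] [/= sI tI]; rewrite path_cat_right//; exact: H12.
  apply: (within_continuous_compose _ _ c2).
    apply: continuous_subspaceT => st; apply: cvg_to_pair; last exact: cvg_snd.
    apply: (@continuous_comp _ _ _ fst (fun t : R => 2 * t - 1)); first exact: cvg_fst.
    exact: continuous_double_sub1.
  move=> _ [[s t] [/= sI tI] <-]; split=> //=; apply: double_sub1_itv.
  by exists s.
Qed.

Lemma path_cat_image (A : set X) l l' (t : R) : l 1 = l' 0 ->
  (forall s, `[0, 1]%classic s -> A (l s)) -> (forall s, `[0, 1]%classic s -> A (l' s)) ->
  `[0, 1]%classic t -> A (path_cat l l' t).
Proof.
move=> ll' lA l'A /halves_cover [] tI.
  by rewrite path_cat_left//; apply: lA; apply: double_itv; exists t.
by rewrite path_cat_right//; apply: l'A; apply: double_sub1_itv; exists t.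
Qed.

Lemma homotopic_refl A p q l : path_in A p q l -> homotopic A l l.
Proof.
move=> [cl lA l0 l1]; exists (l \o snd); last by [].
split=> //.
- apply: (within_continuous_compose (f := snd) _ _ cl).
    by apply: continuous_subspaceT => st; exact: cvg_snd.
  by move=> _ [[s t] [sI tI] <-].
- by move=> _ [[s t] [sI tI] <-]; apply: lA; exists t.
Qed.

Lemma homotopic_ends A l l' : homotopic A l l' -> l' 0 = l 0 /\ l' 1 = l 1.
Proof.
have I0 : (0 : R) \in `[0, 1] by rewrite in_itv/= lexx ler01.
have I1 : (1 : R) \in `[0, 1] by rewrite in_itv/= lexx ler01.
move=> [H [_ _ _ H1] Hs]; have [H10 H11] := Hs 1 I1.
by rewrite -H10 -H11 !H1.
Qed.

Lemma homotopic_sym A l l' : homotopic A l l' -> homotopic A l' l.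
Proof.
move=> ll'; have [e0 e1] := homotopic_ends ll'; have [H HP Hs] := ll'.
exists (fun st => H (1 - st.1, st.2)); first exact: is_homotopy_sym HP.
move=> s sI /=; rewrite e0 e1; apply: Hs.
by move: sI; rewrite !in_itv/=; lra.
Qed.

Lemma homotopic_trans A l1 l2 l3 : homotopic A l1 l2 -> homotopic A l2 l3 ->
  homotopic A l1 l3.
Proof.
move=> h12 h23; have [e0 e1] := homotopic_ends h12.
have [H [cH HA H0 H1] Hs] := h12; have [K [cK KA K0 K1] Ks] := h23.
exists (fun st => path_cat (fun s => H (s, st.2)) (fun s => K (s, st.2)) st.1).
  split.
  - by apply: square_glue => // t tI; rewrite H1// K0.
  - move=> _ [[s t] [sI tI] <-]; apply: path_cat_image => //=.
    + by rewrite H1// K0.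
    + by move=> s' s'I; apply: HA; exists (s', t).
    + by move=> s' s'I; apply: KA; exists (s', t).
  - by move=> t tI; rewrite path_cat0 H0.
  - by move=> t tI; rewrite path_cat1 K1.
have I0 : (0 : R) \in `[0, 1] by rewrite in_itv/= lexx ler01.
have I1 : (1 : R) \in `[0, 1] by rewrite in_itv/= lexx ler01.
move=> s sI; split.
- apply: (path_cat_image (A := [set x | x = l1 0])) => //=.
  + by rewrite H1// K0.
  + by move=> s' s'I; have [-> _] := Hs s' s'I.
  + by move=> s' s'I; have [-> _] := Ks s' s'I.
- apply: (path_cat_image (A := [set x | x = l1 1])) => //=.
  + by rewrite H1// K0.
  + by move=> s' s'I; have [_ ->] := Hs s' s'I.
  + by move=> s' s'I; have [_ ->] := Ks s' s'I.
Qed.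

Lemma homotopic_cat A l1 l1' l2 l2' : l1 1 = l2 0 ->
  homotopic A l1 l1' -> homotopic A l2 l2' ->
  homotopic A (path_cat l1 l2) (path_cat l1' l2').
Proof.
move=> l12 [H [cH HA H0 H1] Hs] [K [cK KA K0 K1] Ks].
have HK s : s \in `[0, 1] -> H (s, 1) = K (s, 0).
  by move=> sI; have [_ ->] := Hs s sI; have [-> _] := Ks s sI.
pose sw (st : R * R) := (st.2, st.1).
have csw : {within `[0, 1] `*` `[0, 1], continuous sw}.
  by apply: continuous_subspaceT => st; apply: cvg_to_pair; [exact: cvg_snd|exact: cvg_fst].
have swI : sw @` (`[0, 1] `*` `[0, 1]) `<=` `[0, 1] `*` `[0, 1].
  by move=> _ [[s t] [sI tI] <-].
exists (fun st => path_cat (fun t => H (st.1, t)) (fun t => K (st.1, t)) st.2).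
  split.
  - apply: (within_continuous_compose csw swI
      (square_glue (within_continuous_compose csw swI cH)
        (within_continuous_compose csw swI cK) _)).
    by move=> t tI; exact: HK.
  - move=> _ [[s t] [sI tI] <-]; apply: path_cat_image => //=; first exact: HK.
    + by move=> t' t'I; apply: HA; exists (s, t').
    + by move=> t' t'I; apply: KA; exists (s, t').
  - move=> t tI; rewrite /path_cat /=; case: ifPn => t2; rewrite ?H0 ?K0//.
      by move: tI; rewrite !in_itv/=; lra.
    by move: tI t2; rewrite !in_itv/=; lra.
  - move=> t tI; rewrite /path_cat /=; case: ifPn => t2; rewrite ?H1 ?K1//.
      by move: tI; rewrite !in_itv/=; lra.
    by move: tI t2; rewrite !in_itv/=; lra.
move=> s sI; rewrite !path_cat0 !path_cat1.
by have [-> _] := Hs s sI; have [_ ->] := Ks s sI.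
Qed.

Lemma eq_homotopic A l1 l1' l2 : (forall t, `[0, 1]%classic t -> l1 t = l1' t) ->
  homotopic A l1 l2 -> homotopic A l1' l2.
Proof.
move=> e [H [cH HA H0 H1] Hs]; exists H.
  by split=> // t tI; rewrite H0// e.
by move=> s sI; rewrite -!e//; [exact: Hs|apply: itv01P; lra|apply: itv01P; lra].
Qed.

(** Paths in the interval with common ends are homotopic there by convexity; the interval is
    realised as a set of row vectors with one entry in order to use [convex_homotopic]. The unit,
    inverse and associativity laws all follow. *)
Lemma homotopic_reparam A p q l (a b : R) (f g : R -> R) : path_in A p q l ->
  @path_in R R `[0, 1] a b f -> @path_in R R `[0, 1] a b g -> homotopic A (l \o f) (l \o g).
Proof.
move=> [cl lA _ _] fP gP.
pose B : set 'rV[R]_1 := [set v | `[0, 1]%classic (v 0 0)].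
have cB : convex_set B.
  move=> v w t; rewrite /B/= !in_itv/= !mxE => /andP[v0 v1] /andP[w0 w1] /andP[t0 t1].
  by apply/andP; split; nra.
have emb (c d : R) h : @path_in R R `[0, 1] c d h ->
    path_in B (const_mx c) (const_mx d) (fun t => const_mx (h t)).
  move=> hP; apply: (path_in_comp (f := fun t : R => const_mx t)) hP.
    apply: continuous_subspaceT => t; apply: (@cvg_mx R _ (nbhs t)) => i j.
    by rewrite mxE; under eq_fun do rewrite mxE; exact: cvg_id.
  by move=> _ [t tI <-]; rewrite /B/= mxE.
have cl' : {within B, continuous (fun v => l (v 0 0))}.
  apply: (within_continuous_compose (f := fun v : 'rV[R]_1 => v 0 0) _ _ cl).
    by apply: continuous_subspaceT; exact: coord_continuous.
  by move=> _ [v Bv <-].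
have l'A : (fun v : 'rV[R]_1 => l (v 0 0)) @` B `<=` A.
  by move=> _ [v Bv <-]; apply: lA; exists (v 0 0).
have := homotopic_comp cl' l'A (convex_homotopic cB (emb _ _ _ fP) (emb _ _ _ gP)).
by congr (homotopic _ _ _); apply: funext => t /=; rewrite mxE.
Qed.

Lemma path_cat_comp l (f g : R -> R) : path_cat (l \o f) (l \o g) = l \o path_cat f g.
Proof. by apply: funext => t; rewrite /path_cat /=; case: ifP. Qed.

Lemma unit_path_id : @path_in R R `[0, 1] 0 1 (id : R -> R).
Proof.
by split=> //; [apply: continuous_subspaceT => t; exact: cvg_id|move=> _ [t tI <-]].
Qed.

Lemma unit_path_cst (a : R) : 0 <= a <= 1 -> @path_in R R `[0, 1] a a (cst a : R -> R).
Proof. by move=> a01; apply: path_in_cst; exact: itv01P. Qed.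

Lemma unit_path_line (a b : R) : 0 <= a <= 1 -> 0 <= b <= 1 ->
  @path_in R R `[0, 1] a b (fun t => (1 - t) * a + t * b).
Proof.
move=> a01 b01; split; last 2 first.
- by rewrite subr0 mul1r mul0r addr0.
- by rewrite subrr mul0r mul1r add0r.
- apply: continuous_subspaceT => t; apply: cvgD; apply: cvgM; try exact: cvg_cst.
    exact: continuous_flip.
  exact: cvg_id.
- move=> _ [t + <-]; rewrite /= !in_itv/= => /andP[t0 t1].
  by apply/andP; split; nra.
Qed.

Lemma cat_cst_l A p q l : path_in A p q l -> homotopic A (path_cat (cst p) l) l.
Proof.
move=> lP; have [_ _ l0 _] := lP.
have -> : path_cat (cst p) l = l \o path_cat (cst 0) id.
  by rewrite -path_cat_comp -l0.
apply: (homotopic_reparam (g := id) lP _ unit_path_id).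
by apply: path_in_cat unit_path_id; apply: unit_path_cst; lra.
Qed.

Lemma cat_cst_r A p q l : path_in A p q l -> homotopic A (path_cat l (cst q)) l.
Proof.
move=> lP; have [_ _ _ l1] := lP.
have -> : path_cat l (cst q) = l \o path_cat id (cst 1).
  by rewrite -path_cat_comp -l1.
apply: (homotopic_reparam (g := id) lP _ unit_path_id).
by apply: (path_in_cat unit_path_id); apply: unit_path_cst; lra.
Qed.

Lemma cat_rev A p q l : path_in A p q l ->
  homotopic A (path_cat l (path_rev l)) (cst p).
Proof.
move=> lP; have [_ _ l0 _] := lP.
have -> : path_cat l (path_rev l) = l \o path_cat id (path_rev id).
  by rewrite -path_cat_comp.
rewrite -l0; apply: (homotopic_reparam (g := cst 0) lP _ (unit_path_cst _)); last lra.
exact: path_in_cat unit_path_id (path_in_rev unit_path_id).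
Qed.

Lemma rev_cat A p q l : path_in A p q l ->
  homotopic A (path_cat (path_rev l) l) (cst q).
Proof. by move=> /path_in_rev/cat_rev; rewrite path_rev_inv. Qed.

Lemma cat_assoc A p q s x l1 l2 l3 : path_in A p q l1 -> path_in A q s l2 ->
  path_in A s x l3 ->
  homotopic A (path_cat l1 (path_cat l2 l3)) (path_cat (path_cat l1 l2) l3).
Proof.
move=> P1 P2 P3; have P12 := path_in_cat P1 P2; have P := path_in_cat P12 P3.
set l := path_cat (path_cat l1 l2) l3 in P *.
have [_ _ l10 l11] := P1; have [_ _ l20 l21] := P2; have [_ _ l30 l31] := P3.
(* In [l] the three paths occupy the intervals cut at 1/4 and 1/2. The affine maps onto these
   intervals, concatenated with the other bracketing, form the reparametrisation that relates the
   two products. *)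
pose f1 (t : R) := (1 - t) * 0 + t * 4^-1.
pose f2 (t : R) := (1 - t) * 4^-1 + t * 2^-1.
pose f3 (t : R) := (1 - t) * 2^-1 + t * 1.
have f1P : @path_in R R `[0, 1] 0 4^-1 f1 by apply: unit_path_line; lra.
have f2P : @path_in R R `[0, 1] 4^-1 2^-1 f2 by apply: unit_path_line; lra.
have f3P : @path_in R R `[0, 1] 2^-1 1 f3 by apply: unit_path_line; lra.
have e1 t : `[0, 1]%classic t -> l (f1 t) = l1 t.
  rewrite /= in_itv/= => tI; rewrite /l !path_cat_left /f1 /= ?in_itv/=; [|lra|lra].
  by congr l1; field.
have e2 t : `[0, 1]%classic t -> l (f2 t) = l2 t.
  rewrite /= in_itv/= => tI; rewrite /l path_cat_left /f2 /= ?in_itv/=; last lra.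
  rewrite path_cat_right ?l11 ?l20//= ?in_itv/=; last lra.
  by congr l2; field.
have e3 t : `[0, 1]%classic t -> l (f3 t) = l3 t.
  rewrite /= in_itv/= => tI.
  rewrite /l path_cat_right ?path_cat1 ?l21 ?l30//= /f3 ?in_itv/=; last lra.
  by congr l3; field.
have e t : `[0, 1]%classic t ->
    (l \o path_cat f1 (path_cat f2 f3)) t = path_cat l1 (path_cat l2 l3) t.
  rewrite -!path_cat_comp => tI; rewrite /path_cat /=.
  move: tI; rewrite /= in_itv/= => /andP[t0 t1].
  case: ifPn => ht; first by rewrite e1//= in_itv/=; lra.
  case: ifPn => ht'; first by rewrite e2//= in_itv/=; lra.
  by rewrite e3//= in_itv/=; lra.
apply: (eq_homotopic e); apply: (homotopic_reparam (g := id) P _ unit_path_id).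
exact: path_in_cat f1P (path_in_cat f2P f3P).
Qed.

End homotopy_calculus.

(** * The fundamental group and the universal local system *)

Section fundamental_group.
Local Open Scope quotient_scope.
Context (R : realType) (X : topologicalType) (x0 : X).

Record based_loop := BasedLoop {
  loop_fun : R -> X;
  loop_funP : loop_in [set: X] x0 loop_fun }.

HB.instance Definition _ := gen_eqMixin based_loop.
HB.instance Definition _ := gen_choiceMixin based_loop.

Definition loop_rel (a b : based_loop) : bool :=
  `[< homotopic [set: X] (loop_fun a) (loop_fun b) >].

Lemma loop_rel_refl : reflexive loop_rel.
Proof. by move=> a; apply/asboolP; exact: homotopic_refl (loop_funP a). Qed.

Lemma loop_rel_sym : symmetric loop_rel.
Proof. by move=> a b; apply/asboolP/asboolP; exact: homotopic_sym. Qed.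

Lemma loop_rel_trans : transitive loop_rel.
Proof.
by move=> b a c /asboolP ab /asboolP bc; apply/asboolP; exact: homotopic_trans bc.
Qed.

Canonical loop_equiv := EquivRel loop_rel loop_rel_refl loop_rel_sym loop_rel_trans.

Definition fundamental_group := {eq_quot loop_equiv}.

HB.instance Definition _ := Choice.on fundamental_group.

Lemma cst_loop : loop_in [set: X] x0 (cst x0 : R -> X).
Proof. exact: path_in_cst. Qed.

(* The class of l, or the trivial class if l is not a loop at x0. *)
Definition loop_class (l : R -> X) : fundamental_group :=
  \pi_({eq_quot loop_equiv}) (if pselect (loop_in [set: X] x0 l) is left lP then BasedLoop lP
       else BasedLoop cst_loop).

Lemma loop_class_eq (l l' : R -> X) : loop_in [set: X] x0 l -> loop_in [set: X] x0 l' ->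
  loop_class l = loop_class l' <-> homotopic [set: X] l l'.
Proof.
move=> lP l'P; rewrite /loop_class; do 2![case: pselect => // ?].
by split=> [/eqmodP/asboolP //|ll']; apply/eqmodP/asboolP.
Qed.

Definition class_loop (a : fundamental_group) : R -> X :=
  loop_fun (repr (a : {eq_quot loop_equiv})).

Lemma class_loopP a : loop_in [set: X] x0 (class_loop a).
Proof. exact: loop_funP. Qed.

Lemma class_loopK a : loop_class (class_loop a) = a.
Proof.
rewrite /loop_class; case: pselect => [P|/(_ (class_loopP a))//].
rewrite -[RHS]reprK; apply/eqmodP/asboolP => /=.
exact: homotopic_refl (class_loopP a).
Qed.

Let mul a b := loop_class (path_cat (class_loop a) (class_loop b)).
Let inv a := loop_class (path_rev (class_loop a)).
Let one := loop_class (cst x0).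

Let classK (l : R -> X) : loop_in [set: X] x0 l -> homotopic [set: X] (class_loop (loop_class l)) l.
Proof.
move=> lP; apply/(loop_class_eq (class_loopP _) lP); exact: class_loopK.
Qed.

Let loop_cat (l l' : R -> X) : loop_in [set: X] x0 l -> loop_in [set: X] x0 l' ->
  loop_in [set: X] x0 (path_cat l l').
Proof. exact: path_in_cat. Qed.

Let class_mul (l l' : R -> X) : loop_in [set: X] x0 l -> loop_in [set: X] x0 l' ->
  mul (loop_class l) (loop_class l') = loop_class (path_cat l l').
Proof.
move=> lP l'P; apply/loop_class_eq; [exact: loop_cat (class_loopP _) (class_loopP _)|exact: loop_cat|].
apply: homotopic_cat; [|exact: classK|exact: classK].
by have [_ _ _ ->] := class_loopP (loop_class l); have [_ _ -> _] := class_loopP (loop_class l').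
Qed.

Let mulA : associative mul.
Proof.
move=> a b d; rewrite -(class_loopK a) -(class_loopK b) -(class_loopK d).
have [aP bP dP] := And3 (class_loopP a) (class_loopP b) (class_loopP d).
rewrite !class_mul//; try exact: loop_cat.
apply/loop_class_eq; [exact: loop_cat aP (loop_cat bP dP)|exact: loop_cat (loop_cat aP bP) dP|].
exact: cat_assoc aP bP dP.
Qed.

Let mul1 : left_id one mul.
Proof.
move=> a; rewrite -[RHS]class_loopK -{1}(class_loopK a).
have aP := class_loopP a; rewrite /one class_mul//; last exact: cst_loop.
apply/loop_class_eq => //; first exact: loop_cat cst_loop aP.
exact: cat_cst_l aP.
Qed.

Let mulr1 : right_id one mul.
Proof.
move=> a; rewrite -[RHS]class_loopK -{1}(class_loopK a).
have aP := class_loopP a; rewrite /one class_mul//; last exact: cst_loop.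
apply/loop_class_eq => //; first exact: loop_cat aP cst_loop.
exact: cat_cst_r aP.
Qed.

Let mulV : left_inverse one inv mul.
Proof.
move=> a; rewrite -{2}(class_loopK a) /inv /one.
have aP := class_loopP a; have raP := path_in_rev aP; rewrite class_mul//.
apply/loop_class_eq; [exact: loop_cat raP aP|exact: cst_loop|].
exact: rev_cat aP.
Qed.

Let mulrV : right_inverse one inv mul.
Proof.
move=> a; rewrite -{1}(class_loopK a) /inv /one.
have aP := class_loopP a; have raP := path_in_rev aP; rewrite class_mul//.
apply/loop_class_eq; [exact: loop_cat aP raP|exact: cst_loop|].
exact: cat_rev aP.
Qed.

HB.instance Definition _ := isGroup.Build fundamental_group mulA mul1 mulr1 mulV mulrV.

Lemma loop_classM (l l' : R -> X) : loop_in [set: X] x0 l -> loop_in [set: X] x0 l' ->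
  loop_class (path_cat l l') = (loop_class l * loop_class l')%g.
Proof. by move=> lP l'P; rewrite -class_mul. Qed.

End fundamental_group.

Section criterion.
Context (R : realType) (X : topologicalType) (x0 : X).
Context (chart : forall x : X, chart_in R [set: X] x).
Context (cX : connected [set: X]).
Local Open Scope group_scope.

Let lpc : locally_path_connected R X := chart_locally_path_connected chart.

(** The path chosen for the base point itself is constant, so that closing up a loop at [x0] does
    not change its class. *)
Let kappa (z : X) : R -> X :=
  if pselect (z = x0) then cst x0
  else projT1 (cid (connected_path_connected cX lpc x0 z)).

Let kappaP z : path_in [set: X] x0 z (kappa z).
Proof.
rewrite /kappa; case: pselect => [zx|?] /=; last by case: cid.
by rewrite zx; exact: path_in_cst.
Qed.

Let kappa0 : kappa x0 = cst x0.
Proof. by rewrite /kappa; case: pselect. Qed.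

Let close (l : R -> X) : R -> X :=
  path_cat (path_cat (kappa (l 0%R)) l) (path_rev (kappa (l 1%R))).

(** A retraction of the fundamental groupoid to the group at [x0], given by the chosen paths. *)
Definition path_class (l : R -> X) : fundamental_group R x0 := loop_class x0 (close l).

Let closeP z w (l : R -> X) : path_in [set: X] z w l -> loop_in [set: X] x0 (close l).
Proof.
move=> lP; have [_ _ l0 l1] := lP; rewrite /close l0 l1.
exact: path_in_cat (path_in_cat (kappaP z) lP) (path_in_rev (kappaP w)).
Qed.

Lemma path_class_homotopic z w (l l' : R -> X) : path_in [set: X] z w l ->
  path_in [set: X] z w l' -> homotopic [set: X] l l' -> path_class l = path_class l'.
Proof.
move=> lP l'P ll'; have [[_ _ l0 l1] [_ _ l'0 l'1]] := (lP, l'P).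
apply/loop_class_eq; [exact: closeP lP|exact: closeP l'P|].
have [_ _ k0 k1] := kappaP z.
rewrite /close l0 l1 l'0 l'1; apply: homotopic_cat.
- by rewrite path_cat1 l1; have [_ _ -> _] := path_in_rev (kappaP w).
- apply: homotopic_cat => //; first by rewrite k1 l0.
  exact: homotopic_refl (kappaP z).
- exact: homotopic_refl (path_in_rev (kappaP w)).
Qed.

(** The path chosen for the middle point is run backwards and then forwards, and cancels; the rest
    is rebracketing. *)
Lemma path_class_cat z w v (l l' : R -> X) : path_in [set: X] z w l -> path_in [set: X] w v l' ->
  path_class (path_cat l l') = path_class l * path_class l'.
Proof.
move=> lP l'P; have [[_ _ l0 l1] [_ _ l'0 l'1]] := (lP, l'P).
have llP := path_in_cat lP l'P.
rewrite /path_class -loop_classM; [|exact: closeP lP|exact: closeP l'P].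
have [K W V] := And3 (kappaP z) (kappaP w) (kappaP v).
have [Wi Vi] := (path_in_rev W, path_in_rev V).
apply/loop_class_eq; [exact: closeP llP|exact: path_in_cat (closeP lP) (closeP l'P)|].
rewrite /close path_cat0 path_cat1 l0 l1 l'0 l'1.
have A := path_in_cat K lP.
apply: homotopic_sym.
apply: homotopic_trans (homotopic_sym (cat_assoc A Wi (path_in_cat (path_in_cat W l'P) Vi))) _.
have inner : homotopic [set: X] (path_cat (path_rev (kappa w))
    (path_cat (path_cat (kappa w) l') (path_rev (kappa v)))) (path_cat l' (path_rev (kappa v))).
  apply: homotopic_trans (cat_assoc Wi (path_in_cat W l'P) Vi) _.
  apply: homotopic_cat; last exact: homotopic_refl Vi.
    by rewrite !path_cat1 l'1; have [_ _ -> _] := Vi.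
  apply: homotopic_trans (cat_assoc Wi W l'P) _.
  apply: homotopic_trans _ (cat_cst_l l'P).
  apply: homotopic_cat; last exact: homotopic_refl l'P.
    by rewrite path_cat1 l'0; have [_ _ _ ->] := W.
  exact: rev_cat W.
apply: homotopic_trans (homotopic_cat _ (homotopic_refl A) inner) _.
  by rewrite !path_cat1 path_cat0 l1; have [_ _ -> _] := Wi.
apply: homotopic_trans (cat_assoc A l'P Vi) _.
apply: homotopic_cat; last exact: homotopic_refl Vi.
  by rewrite path_cat1 l'1; have [_ _ -> _] := Vi.
exact: homotopic_sym (cat_assoc K lP l'P).
Qed.

Let nb (x : X) : set X := projT1 (cid2 (chart_in_homotopic (chart x))).

Let nb_nbhs x : nbhs x (nb x).
Proof. by rewrite /nb; case: cid2. Qed.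

Let nb_homotopic x p q (l l' : R -> X) :
  path_in (nb x) p q l -> path_in (nb x) p q l' -> homotopic [set: X] l l'.
Proof. by rewrite /nb; case: cid2 => U /= _ UP; exact: UP. Qed.

(** Any path inside [nb x] will do, as two of them with the same ends are homotopic in [X]. The
    default concerns only points that cannot be reached from [x] within [nb x]. *)
Let short (x z : X) : R -> X := xget (cst x) [set l | path_in (nb x) x z l].

Let shortP x z (l : R -> X) : path_in (nb x) x z l -> path_in (nb x) x z (short x z).
Proof. by move=> lP; rewrite /short; case: xgetP => // /(_ l). Qed.

(* The universal local system: its holonomy along a loop is the class of the loop. *)
Definition universal_transport (x z : X) : fundamental_group R x0 :=
  path_class (short x z).

Lemma universal_transport_short x z (l : R -> X) : path_in (nb x) x z l ->
  path_class l = universal_transport x z.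
Proof.
move=> lP; have sP := shortP lP.
have sub : nb x `<=` [set: X] by [].
by apply: path_class_homotopic (path_in_sub sub lP) (path_in_sub sub sP) (nb_homotopic lP sP).
Qed.

(** Near [x] the transport out of [x] is itself a section: a short path to [z] followed by a short
    path to [w] stays in [nb x], so its class is that of a short path to [w]. *)
Lemma universal_flat : flat setT universal_transport.
Proof.
move=> x _; pose V := interior (nb x).
have oV : open V by exact: open_interior.
have xV : nbhs x V by apply: open_nbhs_nbhs; split=> //; exact: nb_nbhs.
have sub (A : set X) : A `<=` [set: X] by [].
exists [set z | exists p : R -> X, path_in V x z p], (universal_transport x).
split; first exact: lpc.
move=> z [_ [p pP]].
have pV : path_in (nb x) x z p by apply: path_in_sub pP; exact: interior_subset.
have Vz : V z.
  by have [_ _ _ <-] := pP; apply: path_in_mem pP _; apply: itv01P; lra.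
have nbz : nbhs z (V `&` nb z).
  by apply: filterI; [exact: open_nbhs_nbhs|exact: nb_nbhs].
apply: filterS (lpc nbz) => w [q qP] _.
have qx : path_in (nb x) z w q.
  by apply: path_in_sub qP => u [/interior_subset].
have qz : path_in (nb z) z w q by apply: path_in_sub qP => u [].
rewrite -(universal_transport_short (path_in_cat pV qx)).
rewrite (path_class_cat (path_in_sub (sub _) pV) (path_in_sub (sub _) qx)).
by rewrite (universal_transport_short pV) (universal_transport_short qz).
Qed.

Let seg_path (l : R -> X) z w (s t : R) : path_in [set: X] z w l ->
  `[0%R, 1%R]%classic s -> `[0%R, 1%R]%classic t ->
  path_in [set: X] (l s) (l t) (l \o (fun u => (1 - u) * s + u * t)%R).
Proof.
move=> [cl lA _ _] sI tI.
apply: (path_in_comp cl lA); apply: unit_path_line.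
  by move: sI; rewrite /= in_itv.
by move: tI; rewrite /= in_itv.
Qed.

(** The classes of the initial segments of [l] form a section along [l], so the holonomy of a loop
    at [x0] is its own class. *)
Lemma path_class_parallel z w (l : R -> X) : path_in [set: X] z w l ->
  @parallel _ R `[0%R, 1%R] (pull l universal_transport)
    (fun t => path_class (l \o (fun u => (1 - u) * 0 + u * t)%R)).
Proof.
move=> lP t tI; have [cl _ _ _] := lP.
have I0 : `[0%R, 1%R]%classic (0%R : R) by apply: itv01P; lra.
have /nbhs_ballP[e /= e0 eP] := within_continuous_near cl tI (nb_nbhs (l t)).
apply/nbhs_ballP; exists e => // t' te t'I.
have tt' : path_in (nb (l t)) (l t) (l t') (l \o (fun u => (1 - u) * t + u * t')%R).
  have [c _ p0 p1] := seg_path lP tI t'I; split=> //.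
  move=> _ [u uI <-] /=; apply: eP.
    move: te uI; rewrite /ball/= in_itv/= => te /andP[u0 u1].
    rewrite (_ : t - _ = u * (t - t'))%R; last by ring.
    rewrite normrM ger0_norm//; apply: le_lt_trans te.
    by rewrite ler_piMl.
  move: tI t'I uI; rewrite /= !in_itv/= => /andP[? ?] /andP[? ?] /andP[? ?].
  by apply/andP; split; nra.
rewrite /pull -(universal_transport_short tt').
have P1 := seg_path lP I0 tI; have P2 := seg_path lP tI t'I.
rewrite -(path_class_cat P1 P2).
apply: (path_class_homotopic (seg_path lP I0 t'I) (path_in_cat P1 P2)).
rewrite path_cat_comp; apply: (homotopic_reparam lP).
  by apply: unit_path_line; [lra|move: t'I; rewrite /= in_itv].
apply: path_in_cat.
  by apply: unit_path_line; [lra|move: tI; rewrite /= in_itv].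
by apply: unit_path_line; [move: tI; rewrite /= in_itv|move: t'I; rewrite /= in_itv].
Qed.

(** Along [l] a global section and the classes of initial segments differ by a left constant. The
    global section has equal values at the two ends, so the class of all of [l] equals that of the
    constant loop. *)
Lemma loop_trivial (l : R -> X) :
  (exists h, parallel setT universal_transport h) ->
  loop_in [set: X] x0 l -> pi1_trivial_class [set: X] l.
Proof.
move=> [h hP] lP; have [cl lA l0 l1] := lP.
have I0 : `[0%R, 1%R]%classic (0%R : R) by apply: itv01P; lra.
have I1 : `[0%R, 1%R]%classic (1%R : R) by apply: itv01P; lra.
have [a ha] := parallel_unique (@segment_connected R _ _) (parallel_pull cl lA hP)
  (path_class_parallel lP).
have := ha 0%R I0; have := ha 1%R I1; rewrite /= l0 l1 => <-.
have -> : l \o (fun u => (1 - u) * 0 + u * 0)%R = cst x0.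
  by apply: funext => u /=; rewrite !mulr0 addr0.
have -> : l \o (fun u => (1 - u) * 0 + u * 1)%R = l.
  by apply: funext => u /=; rewrite mulr0 add0r mulr1.
have cP := path_in_cst R (I : [set: X] x0).
move=> /(loop_class_eq (closeP cP) (closeP lP)) => e.
rewrite /pi1_trivial_class l0.
have close_id m : loop_in [set: X] x0 m -> homotopic [set: X] (close m) m.
  move=> mP; have [_ _ m0 m1] := mP; rewrite /close m0 m1 kappa0.
  have -> : path_rev (cst x0) = cst x0 :> (R -> X) by [].
  exact: homotopic_trans (cat_cst_r (path_in_cat cP mP)) (cat_cst_l mP).
apply: homotopic_trans (homotopic_sym (close_id _ lP)) _.
exact: homotopic_trans (homotopic_sym e) (close_id _ cP).
Qed.

End criterion.

(** For each base point [p] the hypothesis is applied to the universal local system at [p], with the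
    fundamental group at [p] as structure group. *)
Lemma simply_connected_parallel (R : realType) (X : topologicalType) :
  [set: X] !=set0 -> connected [set: X] -> (forall x : X, chart_in R [set: X] x) ->
  (forall (G : groupType) (c : X -> X -> G), flat setT c ->
    exists h, parallel setT c h) ->
  simply_connected R X.
Proof.
move=> X0 cX chart triv; split=> //.
  exact: connected_path_connected cX (chart_locally_path_connected chart).
move=> p l lP; exact: loop_trivial (triv _ _ (@universal_flat R X p chart cX)) lP.
Qed.

(** * Points, topology and sections of the glued space *)

Section gluing.
Local Open Scope quotient_scope.
Context (X Y : topologicalType) (r : nat) (W : set X) (C : 'I_r -> set Y)
  (D : 'I_r -> set X) (g : 'I_r -> X -> Y).
Context (w0 : set_type W) (y0 : forall i, set_type (C i)).
Context (DW : forall i, D i `<=` W) (gC : forall i x, D i x -> C i (g i x)).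
Context (Ddisj : forall i j x, D i x -> D j x -> i = j).
Context (ginj : forall i x x', D i x -> D i x' -> g i x = g i x' -> x = x').

Let Q : Type := {eq_quot (glue_equiv W C D g)}.
Let GS : topologicalType := glued_space W C D g.

(** Made total on [X] by sending the points outside [W] to the class of [w0], so that relative
    continuity on [W] can be used instead of maps out of a subtype. *)
Definition glue_base (x : X) : GS :=
  \pi_Q (existT (piece W C) None (insubd w0 x : set_type W)).

Definition glue_cap (i : 'I_r) (y : Y) : GS :=
  \pi_Q (existT (piece W C) (Some i) (insubd (y0 i) y : set_type (C i))).

Let base_val (w : set_type W) : glue_base (set_val w) = \pi_Q (existT (piece W C) None w).
Proof. by rewrite /glue_base set_valE valKd. Qed.

Let cap_val i (y : set_type (C i)) :
  glue_cap i (set_val y) = \pi_Q (existT (piece W C) (Some i) y).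
Proof. by rewrite /glue_cap set_valE valKd. Qed.

Lemma glue_cover (z : GS) : (exists2 x, W x & z = glue_base x) \/
  (exists i, exists2 y, C i y & z = glue_cap i y).
Proof.
have : \pi_Q (repr (z : Q)) = z by rewrite reprK.
case: (repr (z : Q)) => -[i|] y <-.
  by right; exists i, (set_val y); [exact: set_valP|rewrite cap_val].
by left; exists (set_val y); [exact: set_valP|rewrite base_val].
Qed.

Let base_cap i (w : set_type W) (y : set_type (C i)) :
  D i (set_val w) -> g i (set_val w) = set_val y ->
  glue_base (set_val w) = glue_cap i (set_val y).
Proof.
move=> Dw gw; rewrite base_val cap_val; apply/eqmodP/asboolP.
by apply: rst_step; constructor.
Qed.

Lemma glue_eq i x : D i x -> glue_base x = glue_cap i (g i x).
Proof.
move=> Dx; have Wx := DW Dx; have Cy := gC Dx.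
exact: (@base_cap i (exist _ x (mem_set Wx)) (exist _ (g i x) (mem_set Cy))).
Qed.

(* A point of a cap that is glued is represented by the corresponding point of W. *)
Let nf (a : {k & piece W C k}) : X + 'I_r * Y :=
  match a with
  | existT None w => inl (set_val (w : set_type W))
  | existT (Some i) y =>
      let y' := set_val (y : set_type (C i)) in
      let S := [set x | D i x /\ g i x = y'] in
      if pselect (S !=set0) then inl (xget (set_val w0) S) else inr (i, y')
  end.

Let nf_glue a b : glue_step D g a b -> nf a = nf b.
Proof.
case=> i x y Dx gx /=; case: pselect => [?|S0] /=; last first.
  by exfalso; apply: S0; exists (set_val x).
congr inl; case: xgetP => [x' _ [Dx' gx']|/(_ (set_val x))]; last by case.
by apply: ginj Dx Dx' _; rewrite gx gx'.
Qed.

(** The normal form is invariant under each gluing step, hence under the generated equivalence; all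
    the descriptions of coincidences in the quotient are read off from it. *)
Let nf_eq a b : \pi_Q a = \pi_Q b -> nf a = nf b.
Proof.
move=> /eqmodP/asboolP; elim=> {a b} [a b|//|//|a b d _ -> _ ->//]; exact: nf_glue.
Qed.

Let nf_cap i (y : set_type (C i)) x : nf (existT (piece W C) (Some i) y) = inl x ->
  D i x /\ g i x = set_val y.
Proof.
rewrite /=; case: pselect => [[x' x'S]|?] //= [<-].
by case: xgetP => [//|/(_ x')].
Qed.

Let nf_capr i (y : set_type (C i)) p : nf (existT (piece W C) (Some i) y) = inr p ->
  p = (i, set_val y).
Proof. by rewrite /=; case: pselect => [?|?] //= [<-]. Qed.

Let subW x : W x -> exists w : set_type W, x = set_val w.
Proof. by move=> Wx; exists (exist _ x (mem_set Wx)). Qed.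

Let subC i y : C i y -> exists y' : set_type (C i), y = set_val y'.
Proof. by move=> Cy; exists (exist _ y (mem_set Cy)). Qed.

Lemma glue_base_inj x x' : W x -> W x' -> glue_base x = glue_base x' -> x = x'.
Proof.
by move=> /subW[w ->] /subW[w' ->]; rewrite !base_val => /nf_eq[].
Qed.

Lemma glue_base_cap i x y : W x -> C i y -> glue_base x = glue_cap i y ->
  D i x /\ g i x = y.
Proof.
move=> /subW[w ->] /subC[y' ->]; rewrite base_val cap_val => /nf_eq /esym.
exact: nf_cap.
Qed.

Lemma glue_cap_inj i j y y' : C i y -> C j y' -> glue_cap i y = glue_cap j y' ->
  i = j /\ y = y'.
Proof.
move=> /subC[u ->] /subC[u' ->]; rewrite !cap_val => /nf_eq e.
case E : (nf (existT (piece W C) (Some j) u')) => [x|p].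
  have [Dj gj] := nf_cap E; rewrite E in e; have [Di gi] := nf_cap e.
  have ij := Ddisj Di Dj; split=> //; rewrite -gi -gj.
  by move: ij => <-.
rewrite E in e; have := nf_capr E; rewrite (nf_capr e) => ij.
by split; [exact: (congr1 fst ij)|exact: (congr1 snd ij)].
Qed.

Lemma glue_base_continuous : {within W, continuous glue_base}.
Proof.
apply/subspace_sigL_continuousP.
rewrite (_ : sigL W glue_base = \pi_(quotient_topology Q) \o existT (piece W C) None).
  move=> w; apply: continuous_comp; first exact: existT_continuous.
  exact: pi_continuous.
by apply: funext => w; rewrite /sigL /= base_val.
Qed.

Lemma glue_cap_continuous i : {within C i, continuous (glue_cap i)}.
Proof.
apply/subspace_sigL_continuousP.
rewrite (_ : sigL (C i) (glue_cap i) = \pi_(quotient_topology Q) \o existT (piece W C) (Some i)).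
  move=> w; apply: continuous_comp; first exact: existT_continuous.
  exact: pi_continuous.
by apply: funext => w; rewrite /sigL /= cap_val.
Qed.

Lemma glue_open (S : set GS) :
  (forall x, W x -> S (glue_base x) -> \forall x' \near x, W x' -> S (glue_base x')) ->
  (forall i y, C i y -> S (glue_cap i y) ->
    \forall y' \near y, C i y' -> S (glue_cap i y')) ->
  open S.
Proof.
move=> SW SC; rewrite /open/= /quotient_open; apply/sigT_openP => -[i|].
  rewrite openE => /= y Sy; have Cy : C i (set_val y) := set_valP y.
  have cv : continuous (set_val : set_type (C i) -> Y) by exact: initial_continuous.
  have := near_comp (cv y) (SC i _ Cy _); rewrite cap_val => /(_ Sy).
  apply: filterS => y' /(_ (set_valP y')); by rewrite cap_val.
rewrite openE => /= y Sy; have Cy : W (set_val y) := set_valP y.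
have cv : continuous (set_val : set_type W -> X) by exact: initial_continuous.
have := near_comp (cv y) (SW _ Cy _); rewrite base_val => /(_ Sy).
apply: filterS => y' /(_ (set_valP y')); by rewrite base_val.
Qed.

Lemma glue_connected : connected W -> (forall i, connected (C i)) ->
  (forall i, D i !=set0) -> connected [set: GS].
Proof.
move=> cW cC D0; apply: connected_locally_constant => f fP.
have fW x x' : W x -> W x' -> f (glue_base x) = f (glue_base x').
  move=> Wx Wx'; apply: (locally_constant_connected cW (f := f \o glue_base)) => // w Ww.
  have := within_continuous_near glue_base_continuous Ww (fP (glue_base w) I).
  by apply: filterS => w' fw' /fw'; exact.
have fC i y y' : C i y -> C i y' -> f (glue_cap i y) = f (glue_cap i y').
  move=> Cy Cy'; apply: (locally_constant_connected (cC i) (f := f \o glue_cap i)) => // w Cw.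
  have := within_continuous_near (@glue_cap_continuous i) Cw (fP (glue_cap i w) I).
  by apply: filterS => w' fw' /fw'; exact.
have all z : f z = f (glue_base (set_val w0)).
  have [[x Wx ->]|[i [y Cy ->]]] := glue_cover z.
    by apply: fW => //; exact: set_valP.
  have [x Dx] := D0 i; rewrite -(fW _ _ (DW Dx) (set_valP w0)).
  by rewrite (glue_eq Dx); apply: fC => //; exact: gC.
by move=> z z' _ _; rewrite (all z) (all z').
Qed.

Lemma glue_parallel (G : groupType) (c : GS -> GS -> G) (hW : X -> G) (hC : 'I_r -> Y -> G) :
  flat setT c -> parallel W (pull glue_base c) hW ->
  (forall i, parallel (C i) (pull (glue_cap i) c) (hC i)) ->
  (forall i x, D i x -> hW x = hC i (g i x)) ->
  exists h, parallel setT c h.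
Proof.
move=> fc hWP hCP hWC.
pose rel z a := (exists2 x, W x /\ z = glue_base x & a = hW x) \/
  (exists i, exists2 y, C i y /\ z = glue_cap i y & a = hC i y).
pose h z : G := xget 1%g [set a | rel z a].
have rel_fun z a b : rel z a -> rel z b -> a = b.
  move=> [[x [Wx zx] ->]|[i [y [Cy zy] ->]]] [[x' [Wx' zx'] ->]|[i' [y' [Cy' zy'] ->]]].
  - by rewrite (glue_base_inj Wx Wx')// -zx -zx'.
  - have [Dx gx] := glue_base_cap Wx Cy' (etrans (esym zx) zy').
    by rewrite (hWC _ _ Dx) gx.
  - have [Dx gx] := glue_base_cap Wx' Cy (etrans (esym zx') zy).
    by rewrite (hWC _ _ Dx) gx.
  - by have [-> ->] := glue_cap_inj Cy Cy' (etrans (esym zy) zy').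
have hE z a : rel z a -> h z = a.
  move=> za; rewrite /h; case: xgetP => [b _ zb|/(_ a)//].
  exact: rel_fun zb za.
have hbase x : W x -> h (glue_base x) = hW x.
  by move=> Wx; apply: hE; left; exists x.
have hcap i y : C i y -> h (glue_cap i y) = hC i y.
  by move=> Cy; apply: hE; right; exists i, y.
exists h => z _; have [U [k [zU]]] := fc z I; rewrite setTI => kP.
(* The candidate [h] is compared with a local section [k]. Their ratio is locally constant on each
   piece, and openness in the quotient is tested piece by piece, so its level set near [z] is open
   even when [z] lies on a seam. *)
pose ratio u := (h u * (k u)^-1)%g.
pose S := interior U `&` [set u | ratio u = ratio z].
have oS : open S.
  apply: glue_open => [x Wx [Ux rx]|i y Cy [Uy ry]].
  - have xU := open_nbhs_nbhs (conj (@open_interior _ U) Ux).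
    have := within_continuous_near glue_base_continuous Wx xU.
    have := within_continuous_near glue_base_continuous Wx (kP _ (interior_subset Ux)).
    apply: filterS3 (hWP x Wx) => x' hx' kx' Ux' Wx'; split; first exact: Ux'.
    rewrite /= -rx /ratio hbase// hbase// hx'// kx'//; last exact: interior_subset (Ux' _).
    by rewrite invgM mulgA mulgK.
  - have yU := open_nbhs_nbhs (conj (@open_interior _ U) Uy).
    have := within_continuous_near (@glue_cap_continuous i) Cy yU.
    have := within_continuous_near (@glue_cap_continuous i) Cy (kP _ (interior_subset Uy)).
    apply: filterS3 (hCP i y Cy) => y' hy' ky' Uy' Cy'; split; first exact: Uy'.
    rewrite /= -ry /ratio hcap// hcap// hy'// ky'//; last exact: interior_subset (Uy' _).
    by rewrite invgM mulgA mulgK.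
have Sz : S z by split.
have := kP z (nbhs_singleton zU).
apply: filterS2 (open_nbhs_nbhs (conj oS Sz)) => u [Uu ru] ku _.
have := ku (interior_subset Uu) => {}ku.
by rewrite -(mulgVK (k u) (h u)) -/(ratio u) ru /ratio ku mulgA mulgVK.
Qed.

End gluing.

(** * Charts of the glued space *)

Lemma chart_in_open_embedding (R : realType) (X : topologicalType) (n : nat)
    (B : set 'rV[R]_n) (e : 'rV[R]_n -> X) (b : 'rV[R]_n) :
  open B -> convex_set B -> {within B, continuous e} ->
  (forall a a', B a -> B a' -> e a = e a' -> a = a') ->
  (forall O, open O -> O `<=` B -> open (e @` O)) ->
  B b -> chart_in R [set: X] (e b).
Proof.
move=> oB cB ce einj eopen Bb.
pose k z := xget b [set a | B a /\ e a = z].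
have kE a : B a -> k (e a) = a.
  move=> Ba; rewrite /k; case: xgetP => [a' _ [Ba' ea']|/(_ a)]; last by case.
  exact: einj.
exists n, B, (e @` B), k, e; split=> //.
- by apply: open_nbhs_nbhs; split; [exact: eopen|exists b].
- split; last by move=> _ [_ [a Ba <-] <-]; rewrite kE.
  apply/within_continuousP => _ P [a Ba <-]; rewrite kE// => aP.
  have oO : open (e @` (B `&` interior P)).
    by apply: eopen => [|? []//]; apply: openI => //; exact: open_interior.
  have Oa : (e @` (B `&` interior P)) (e a) by exists a.
  apply: filterS (open_nbhs_nbhs (conj oO Oa)) => _ [a' [Ba' /interior_subset Pa'] <-] _.
  by rewrite kE.
- by split=> // _ [a Ba <-]; rewrite kE.
Qed.

Lemma chart_in_open_map (R : realType) (Z X : topologicalType) (V : set Z)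
    (f : Z -> X) (x : Z) :
  open V -> {within V, continuous f} ->
  (forall z z', V z -> V z' -> f z = f z' -> z = z') ->
  (forall O, open O -> O `<=` V -> open (f @` O)) ->
  V x -> chart_in R [set: Z] x -> chart_in R [set: X] (f x).
Proof.
move=> oV cf finj fopen Vx chx.
have [n [B [U [k [e [xU UV [ck kB] [cB ce] [eV ek]]]]]]] :=
  chart_in_shrink chx (open_nbhs_nbhs (conj oV Vx)).
have {}UV : interior U `<=` V by move=> z /interior_subset/UV[].
have {}eV : e @` B `<=` V by move=> z /eV[].
pose p z := xget x [set w | V w /\ f w = z].
have pE w : V w -> p (f w) = w.
  move=> Vw; rewrite /p; case: xgetP => [w' _ [Vw' e1]|/(_ w)]; last by case.
  exact: finj.
have Ux : interior U x by [].
exists n, B, (f @` interior U), (k \o p), (f \o e); split=> //.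
- apply: open_nbhs_nbhs; split; last by exists x.
  by apply: fopen => //; exact: open_interior.
- split; last first.
    move=> _ [_ [u uU <-] <-] /=; rewrite pE; last exact: UV.
    by apply: kB; exists u => //; exact: interior_subset.
  apply/within_continuousP => _ P [u uU <-] /=; rewrite pE; last exact: UV.
  move=> kP; have uS := within_continuous_near ck (interior_subset uU) kP.
  pose S := [set u' | U u' -> P (k u')].
  have oO : open (f @` (interior U `&` interior S)).
    by apply: fopen => [|z [/UV]//]; apply: openI; exact: open_interior.
  have Ou : (f @` (interior U `&` interior S)) (f u) by exists u.
  apply: filterS (open_nbhs_nbhs (conj oO Ou)) => _ [u' [uU' /interior_subset Su'] <-] _.
  rewrite /= pE; last exact: UV.
  by apply: Su'; exact: interior_subset.
- by split=> //; exact: within_continuous_compose ce eV cf.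
- split=> // _ [u uU <-] /=; rewrite pE; last exact: UV.
  by rewrite ek//; exact: interior_subset.
Qed.

(** Continuity of the inverse of an injection of a compact set into a Hausdorff space, stated
    without the inverse: the image of the points of [A] outside the interior of [P] is closed and
    misses [g x]. *)
Lemma compact_inverse_near (X Y : topologicalType) (A : set X) (g : X -> Y) (x : X)
    (P : set X) :
  compact A -> hausdorff_space Y -> {within A, continuous g} ->
  (forall x x', A x -> A x' -> g x = g x' -> x = x') -> A x -> nbhs x P ->
  \forall y \near g x, forall x', A x' -> g x' = y -> P x'.
Proof.
move=> cA hY cg ginj Ax xP.
pose K := A `&` ~` interior P.
have cK : compact K.
  by apply: compact_closedI => //; apply: open_closedC; exact: open_interior.
have clgK : closed (g @` K).
  apply: compact_closed => //; apply: continuous_compact cK.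
  by apply: within_continuous_sub cg => u [].
have ngx : (~` (g @` K)) (g x).
  move=> [x' [Ax' Px'] gx']; apply: Px'; rewrite (ginj _ _ Ax' Ax gx').
  exact: xP.
have oK : open (~` (g @` K)) by exact: closed_openC.
apply: filterS (open_nbhs_nbhs (conj oK ngx)) => y ny x' Ax' gx'.
apply: contrapT => Px'; apply: ny; exists x' => //; split=> // /interior_subset.
exact: Px'.
Qed.

Section tube_scale.
Context (R : realType) (Z : topologicalType) (psi : 'rV[R]_(2 + 2) -> Z).
Context (psiP : tube_chart psi).

(** Applied to boundary points with factors at least 1, this sweeps out a collar of the boundary in
    the exterior of the tube. *)
Definition tube_scale (t : R) (z : Z) : Z :=
  psi (row_mx (lsubmx (tube_lift psi z)) (t *: rsubmx (tube_lift psi z))).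

Lemma tube_scaleE t b : tube_scale t (psi b) = psi (row_mx (lsubmx b) (t *: rsubmx b)).
Proof.
have [_ psiE _] := psiP.
apply/psiE; rewrite !row_mxKl !row_mxKr (tube_lift_rsubmx psiP); split=> //.
exact: tube_lift_lsubmx.
Qed.

Lemma cvg_tube_scale (T : Type) (F : set_system T) (FF : Filter F) (t : T -> R)
    (z : T -> Z) (t1 : R) (b1 : 'rV[R]_(2 + 2)) :
  t @ F --> t1 -> z @ F --> psi b1 ->
  (fun s => tube_scale (t s) (z s)) @ F --> tube_scale t1 (psi b1).
Proof.
move=> tF zF P; rewrite tube_scaleE => mP.
pose m (tb : R * 'rV[R]_(2 + 2)) := psi (row_mx (lsubmx tb.2) (tb.1 *: rsubmx tb.2)).
have cm : {for (t1, b1), continuous m}.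
  apply: (@continuous_comp _ _ _ (fun tb : R * 'rV[R]_(2 + 2) =>
    row_mx (lsubmx tb.2) (tb.1 *: rsubmx tb.2)) psi); last by have [cpsi _ _] := psiP; exact: cpsi.
  apply: (@cvg_row_mx R _ (nbhs (t1, b1)) _ 1 2 2 (fun tb => lsubmx tb.2)
    (fun tb => tb.1 *: rsubmx tb.2)).
    apply: (@continuous_comp _ _ _ snd (lsubmx : 'rV[R]_(2 + 2) -> _)).
      exact: cvg_snd.
    exact: lsubmx_continuous.
  apply: (@cvgZ R _ _ (nbhs (t1, b1)) _ fst); first exact: cvg_fst.
  apply: (@continuous_comp _ _ _ snd (rsubmx : 'rV[R]_(2 + 2) -> _)).
    exact: cvg_snd.
  exact: rsubmx_continuous.
have [[/= T1 V1] [tT bV] TV] := near_comp cm mP.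
have zV : \forall z' \near psi b1, exists2 b, V1 b & psi b = z'.
  by apply: (tube_chart_near psiP); apply: filterS bV => b Vb; exists b.
have F1 : F [set s | T1 (t s)] := tF _ tT.
have F2 : F [set s | exists2 b, V1 b & psi b = z s] := zF _ zV.
suff : F [set s | P (tube_scale (t s) (z s))] by [].
apply: filterS2 F1 F2 => s Ts [b Vb bs]; rewrite /= -bs tube_scaleE.
exact: (TV (t s, b) (conj Ts Vb)).
Qed.

End tube_scale.

Lemma torus_exterior_open (R : realType) (Z : topologicalType)
    (psi : 'rV[R]_(2 + 2) -> Z) : hausdorff_space Z -> tube_chart psi ->
  torus_exterior psi = ~` open_tube psi.
Proof.
move=> hZ psiP; rewrite torus_exteriorE exteriorE//.
  by congr (~` _); apply/seteqP; split=> [z [_ _]//|z ?]; exists ord0.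
by move=> i j; rewrite !ord1 eqxx.
Qed.

Lemma open_tubeE (R : realType) (Z : topologicalType) (psi : 'rV[R]_(2 + 2) -> Z) b :
  tube_chart psi -> open_tube psi (psi b) <-> enorm (rsubmx b) < 1.
Proof.
move=> psiP; rewrite -(@expr_lt1 _ 2)// ?enorm_ge0// enorm_sqr.
exact: (tube_fibreE psiP [set y | sqnorm y < 1]).
Qed.

Lemma tube_boundaryE (R : realType) (Z : topologicalType) (psi : 'rV[R]_(2 + 2) -> Z) b :
  tube_chart psi -> tube_boundary psi (psi b) <-> enorm (rsubmx b) = 1.
Proof.
move=> psiP; split=> [/(tube_fibreE psiP [set y | sqnorm y = 1])/enorm1//|b1].
by exists b => //=; rewrite -enorm_sqr b1 expr1n.
Qed.

Section seam.
Context (R : realType) (X Y : topologicalType) (r : nat).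
Context (phi : 'I_r -> 'rV[R]_(2 + 2) -> X) (psi : 'I_r -> 'rV[R]_(2 + 2) -> Y).
Context (g : 'I_r -> X -> Y).
Context (hX : hausdorff_space X) (hY : hausdorff_space Y).
Context (phiP : forall i, tube_chart (phi i)) (psiP : forall i, tube_chart (psi i)).
Context (disj : forall i j, i != j -> tube (phi i) `&` tube (phi j) = set0).
Context (gbij : forall i, set_bij (tube_boundary (phi i)) (tube_boundary (psi i)) (g i)).
Context (cg : forall i, {within tube_boundary (phi i), continuous (g i)}).

Let W := exterior phi.
Let C i := torus_exterior (psi i).
Let D i := tube_boundary (phi i).
Context (w0 : set_type W) (y0 : forall i, set_type (C i)).

Let base : X -> glued_space W C D g := @glue_base X Y r W C D g w0.
Let cap : 'I_r -> Y -> glued_space W C D g := @glue_cap X Y r W C D g y0.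

Lemma seam_sub i : D i `<=` W.
Proof. exact: exterior_boundary. Qed.

Lemma seam_map i x : D i x -> tube_boundary (psi i) (g i x).
Proof. by move=> Dx; have [gf _ _] := gbij i; exact: gf. Qed.

Lemma seam_cap i x : D i x -> C i (g i x).
Proof.
move=> /seam_map gx; rewrite /C torus_exterior_open//.
exact: tube_boundary_open.
Qed.

Lemma seam_disjoint i j x : D i x -> D j x -> i = j.
Proof.
by move=> /tube_boundary_sub Ti /tube_boundary_sub Tj; exact: (tube_disjoint disj) Ti Tj.
Qed.

Lemma seam_inj i x x' : D i x -> D i x' -> g i x = g i x' -> x = x'.
Proof.
by move=> Dx Dx'; have [_ gi _] := gbij i; apply: gi; exact: mem_set.
Qed.

Lemma seam_surj i y : tube_boundary (psi i) y -> exists2 x, D i x & g i x = y.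
Proof. by move=> Ty; have [_ _ gs] := gbij i; have [x Dx <-] := gs _ Ty; exists x. Qed.

Let base_eq := @glue_eq X Y r W C D g w0 y0 seam_sub seam_cap.
Let base_inj := @glue_base_inj X Y r W C D g w0 seam_inj.
Let base_cap := @glue_base_cap X Y r W C D g w0 y0 seam_inj.
Let cap_inj := @glue_cap_inj X Y r W C D g w0 y0 seam_disjoint seam_inj.
Let base_cont := @glue_base_continuous X Y r W C D g w0.
Let cap_cont := @glue_cap_continuous X Y r W C D g y0.
Let gopen := @glue_open X Y r W C D g w0 y0.

(** Off the closed tubes [W] is open in [X] and nothing is glued, so [base] is an open embedding
    there. *)
Lemma base_chart x : (forall x, chart_in R [set: X] x) -> W x ->
  (forall i, ~ D i x) -> chart_in R [set: glued_space W C D g] (base x).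
Proof.
move=> chX Wx nDx; pose W' : set X := ~` \bigcup_i tube (phi i).
have oW' : open W'.
  apply: closed_openC; apply: closed_bigcup => [|i _]; first exact: finite_finset.
  exact: compact_closed hX (tube_compact (phiP i)).
have W'W : W' `<=` W.
  by rewrite /W exteriorE// => z W'z [i _ iz]; apply: W'z; exists i => //; exact: open_tube_sub.
have W'D z i : W' z -> ~ D i z.
  by move=> W'z Dz; apply: W'z; exists i => //; exact: tube_boundary_sub.
have W'x : W' x.
  move=> [i _ ix]; apply: (nDx i); apply: tube_boundaryP ix _ => iox.
  by move: Wx; rewrite /W exteriorE// => Wx; apply: Wx; exists i.
apply: (chart_in_open_map oW') (chX x) => //.
- exact: within_continuous_sub W'W base_cont.
- by move=> z z' Vz Vz'; apply: base_inj; exact: W'W.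
move=> O oO OW'; apply: gopen => [z Wz [q Oq]|i y Cy [q Oq]].
- move=> /(base_inj (W'W _ (OW' _ Oq)) Wz) oz.
  by rewrite oz in Oq; apply: filterS (open_nbhs_nbhs (conj oO Oq)) => z' Oz' _; exists z'.
- move=> /(base_cap (W'W _ (OW' _ Oq)) Cy) [Do _].
  by exfalso; apply: (W'D q i) => //; exact: OW'.
Qed.

Lemma cap_chart i y : (forall y, chart_in R [set: Y] y) -> C i y ->
  ~ tube_boundary (psi i) y -> chart_in R [set: glued_space W C D g] (cap i y).
Proof.
move=> chY Cy nDy; pose C' : set Y := ~` tube (psi i).
have oC' : open C'.
  by apply: closed_openC; exact: compact_closed hY (tube_compact (psiP i)).
have CE : C i = ~` open_tube (psi i) by exact: torus_exterior_open.
have C'C : C' `<=` C i.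
  by rewrite CE => z C'z iz; apply: C'z; exact: open_tube_sub.
have C'y : C' y.
  move=> iy; apply: nDy; have [a /= a1 ay] := iy; exists a => //=.
  apply/eqP; rewrite eq_le a1 leNgt; apply/negP => a1'.
  by move: Cy; rewrite CE; apply; exists a.
apply: (chart_in_open_map oC') (chY y) => //.
- exact: within_continuous_sub C'C (@cap_cont i).
- by move=> z z' Vz Vz' /(cap_inj (C'C _ Vz) (C'C _ Vz'))[].
move=> O oO OC'; apply: gopen => [z Wz [q Oq] /esym|j z Cz [q Oq]].
- move=> /(base_cap Wz (C'C _ (OC' _ Oq))) [Dz goz].
  exfalso; apply: (OC' _ Oq); rewrite -goz; apply: tube_boundary_sub.
  exact: seam_map.
- move=> /(cap_inj (C'C _ (OC' _ Oq)) Cz) [ij oz].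
  rewrite oz in Oq; apply: filterS (open_nbhs_nbhs (conj oO Oq)) => z' Oz' _.
  by exists z' => //; rewrite ij.
Qed.

Section at_seam.
Context (i : 'I_r) (a0 : 'rV[R]_(2 + 2)) (a01 : enorm (rsubmx a0) = 1).

Let dir (a : 'rV[R]_(2 + 2)) : 'rV[R]_(2 + 2) :=
  row_mx (lsubmx a) (direction (rsubmx a)).

(* The cap side of the seam chart: radius t < 1 of the tube of phi is sent to
   radius 1/t of the tube of psi. *)
Let outer (a : 'rV[R]_(2 + 2)) : Y :=
  tube_scale (psi i) (enorm (rsubmx a))^-1 (g i (phi i (dir a))).

(** The tube chart of [phi], with the part of radius less than 1, which was removed, replaced by the
    collar in the cap. Both expressions agree at radius 1 by the gluing. *)
Let e (a : 'rV[R]_(2 + 2)) : glued_space W C D g :=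
  if 1 <= enorm (rsubmx a) then base (phi i a) else cap i (outer a).

Let dir_cont (a : 'rV[R]_(2 + 2)) : rsubmx a != 0 -> {for a, continuous dir}.
Proof.
move=> a_neq0; apply: (@cvg_row_mx R _ (nbhs a) _ 1 2 2 lsubmx); first exact: lsubmx_continuous.
apply: (@continuous_comp _ _ _ rsubmx); first exact: rsubmx_continuous.
exact: direction_continuous.
Qed.

Let dir_norm (a : 'rV[R]_(2 + 2)) : rsubmx a != 0 -> enorm (rsubmx (dir a)) = 1.
Proof. by move=> a_neq0; rewrite /dir row_mxKr; apply: enorm1; exact: sqnorm_direction. Qed.

Let dir_id (a : 'rV[R]_(2 + 2)) : enorm (rsubmx a) = 1 -> dir a = a.
Proof.
by move=> a1; rewrite /dir direction_id ?hsubmxK// -enorm_sqr a1 expr1n.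
Qed.

Let dirD (a : 'rV[R]_(2 + 2)) : rsubmx a != 0 -> D i (phi i (dir a)).
Proof. by move=> /dir_norm a1; apply/tube_boundaryE. Qed.

Let outer_lift (a : 'rV[R]_(2 + 2)) : rsubmx a != 0 -> exists b, [/\ enorm (rsubmx b) = 1,
  psi i b = g i (phi i (dir a)) &
  outer a = psi i (row_mx (lsubmx b) ((enorm (rsubmx a))^-1 *: rsubmx b))].
Proof.
move=> a_neq0; have [b /= b1 bE] := seam_map (dirD a_neq0).
by exists b; split; [exact: enorm1|by []|rewrite /outer -bE tube_scaleE].
Qed.

Let outer_seam (a : 'rV[R]_(2 + 2)) : enorm (rsubmx a) = 1 -> outer a = g i (phi i a).
Proof.
move=> a1; have a_neq0 : rsubmx a != 0.
  by apply/eqP => az; move: a1; rewrite az /enorm sqnorm0 sqrtr0 => /eqP; rewrite eq_sym oner_eq0.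
have [b [b1 bE ->]] := outer_lift a_neq0.
by rewrite a1 invr1 scale1r hsubmxK bE dir_id.
Qed.

Let norm_gt0 (a : 'rV[R]_(2 + 2)) : rsubmx a != 0 -> 0 < enorm (rsubmx a).
Proof. exact: enorm_gt0. Qed.

Let outer_norm (a b : 'rV[R]_(2 + 2)) : rsubmx a != 0 -> outer a = psi i b ->
  enorm (rsubmx b) = (enorm (rsubmx a))^-1.
Proof.
move=> a_neq0; have [b' [b'1 _ ->]] := outer_lift a_neq0.
have [_ psiE _] := psiP i; move=> /psiE[_]; rewrite row_mxKr => <-.
by rewrite enormZ ?b'1 ?mulr1// invr_ge0 enorm_ge0.
Qed.

Let outer_C (a : 'rV[R]_(2 + 2)) : rsubmx a != 0 -> enorm (rsubmx a) <= 1 -> C i (outer a).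
Proof.
move=> a_neq0 a1; rewrite /C torus_exterior_open//.
have [b [_ _ bE]] := outer_lift a_neq0; rewrite bE => /open_tubeE-/(_ (psiP i)).
rewrite (outer_norm a_neq0 bE) invf_lt1 ?norm_gt0//.
by rewrite ltNge a1.
Qed.

Let outer_cont (a : 'rV[R]_(2 + 2)) : rsubmx a != 0 -> {for a, continuous outer}.
Proof.
move=> a_neq0; have [b [_ bE _]] := outer_lift a_neq0.
suff : outer @ a --> tube_scale (psi i) (enorm (rsubmx a))^-1 (psi i b) by rewrite bE.
have cg' : {for a, continuous (fun a' => g i (phi i (dir a')))}.
  move=> P gP; have := within_continuous_near (@cg i) (dirD a_neq0) gP.
  have [cphi _ _] := phiP i.
  have cpd : {for a, continuous (phi i \o dir)}.
    by apply: continuous_comp; [exact: dir_cont|exact: cphi].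
  move=> /(near_comp cpd) near1.
  have near0 : \forall a' \near a, rsubmx a' != 0.
    have := near_comp (@enorm_continuous R 2 (rsubmx a)) (lt_nbhsr (norm_gt0 a_neq0)).
    move=> /(near_comp (@rsubmx_continuous R 2 2 a)); apply: filterS => a' pa'.
    by apply/eqP => az; move: pa'; rewrite az /enorm sqnorm0 sqrtr0 ltxx.
  suff : nbhs a [set a' | P (g i (phi i (dir a')))] by [].
  by apply: filterS2 near0 near1 => a' a'0; apply; exact: dirD.
apply: (@cvg_tube_scale R Y (psi i) (psiP i) _ (nbhs a) _); last by rewrite bE; exact: cg'.
apply: (@cvgV R _ (nbhs a) _ (fun a' : 'rV[R]_(2 + 2) => enorm (rsubmx a'))).
  by rewrite gt_eqF// norm_gt0.
apply: (@continuous_comp _ _ _ (rsubmx : 'rV[R]_(2 + 2) -> _) (@enorm R 2)).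
  exact: rsubmx_continuous.
exact: enorm_continuous.
Qed.

(** On a small ball the map [e] is continuous by pasting along radius 1 and injective on each side.
    Openness on the cap side is the hard point: it requires a continuous inverse of the gluing
    map. *)
Lemma seam_chart : chart_in R [set: glued_space W C D g] (base (phi i a0)).
Proof.
have [cphi phiE _] := phiP i; have [_ psiE _] := psiP i.
have a0_neq0 : rsubmx a0 != 0.
  by apply/eqP => az; move: a01; rewrite az /enorm sqnorm0 sqrtr0 => /eqP; rewrite eq_sym oner_eq0.
have [sec secP] := tube_chart_section (phiP i) a0.
have secdP : \forall a \near a0, sec (phi i (dir a)) = dir a.
  have := near_comp (P := fun b => sec (phi i b) = b) (dir_cont a0_neq0).
  by rewrite dir_id//; apply.
have neq0P : \forall a \near a0, rsubmx a != 0.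
  have := near_comp (@enorm_continuous R 2 (rsubmx a0)) (lt_nbhsr (norm_gt0 a0_neq0)).
  move=> /(near_comp (@rsubmx_continuous R 2 2 a0)); apply: filterS => a pa.
  by apply/eqP => az; move: pa; rewrite az /enorm sqnorm0 sqrtr0 ltxx.
have otherP : \forall a \near a0, forall j, j != i -> ~ tube (phi j) (phi i a).
  apply: (@filter_forall _ 'I_r (fun j a => j != i -> ~ tube (phi j) (phi i a)) (nbhs a0)) => j.
  have [->|ji] := eqVneq j i; first exact: filterE.
  have oj : open (~` tube (phi j)).
    by apply: closed_openC; exact: compact_closed hX (tube_compact (phiP j)).
  have zj : (~` tube (phi j)) (phi i a0).
    move=> jz; move: ji; rewrite (tube_disjoint disj jz (_ : tube (phi i) _)) ?eqxx//.
    by apply: tube_boundary_sub; apply/tube_boundaryE.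
  by apply: filterS (near_comp (@cphi a0) (open_nbhs_nbhs (conj oj zj))) => a ? _.
(* The ball is so small that [sec] recovers both [a] and its radial projection from their images,
   and that the core and the other tubes are avoided. *)
have /nbhs_ballP[d /= d0 dP] : nbhs a0 [set a | [/\ sec (phi i a) = a,
    sec (phi i (dir a)) = dir a, rsubmx a != 0 &
    forall j, j != i -> ~ tube (phi j) (phi i a)]].
  apply: filterS2 (filterI secP secdP) (filterI neq0P otherP).
  by move=> a [? ?] [? ?]; split.
pose B := ball a0 d.
have Bx a : B a -> rsubmx a != 0 by move=> /dP[].
have BW a : B a -> 1 <= enorm (rsubmx a) -> W (phi i a).
  move=> /dP[_ _ _ oth] a1; rewrite /W exteriorE// => -[j _].
  have [->|ji] := eqVneq j i; last by move=> /open_tube_sub; exact: oth.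
  by move=> /open_tubeE-/(_ (phiP i)); rewrite ltNge a1.
have WB a : W (phi i a) -> 1 <= enorm (rsubmx a).
  rewrite /W exteriorE// leNgt => na; apply/negP => a1; apply: na.
  by exists i => //; apply/open_tubeE.
have ebase a : 1 <= enorm (rsubmx a) -> e a = base (phi i a) by rewrite /e => ->.
have ecap a : B a -> enorm (rsubmx a) <= 1 -> e a = cap i (outer a).
  move=> Ba a1; rewrite /e; case: ifPn => // a1'.
  have aE : enorm (rsubmx a) = 1 by apply/eqP; rewrite eq_le a1.
  rewrite outer_seam//; apply: base_eq; exact/tube_boundaryE.
have nq a : {for a, continuous (fun a : 'rV[R]_(2 + 2) => enorm (rsubmx a))}.
  apply: (@continuous_comp _ _ _ (rsubmx : 'rV[R]_(2 + 2) -> _) (@enorm R 2)).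
    exact: rsubmx_continuous.
  exact: enorm_continuous.
(* Radius less than 1 becomes radius greater than 1 in the cap, off the seam, so such a point is
   never identified with a point of [W]. *)
have excl a x : B a -> enorm (rsubmx a) < 1 -> W x -> base x <> e a.
  move=> Ba a1 Wx; rewrite ecap ?ltW// => /(base_cap Wx (outer_C (Bx _ Ba) (ltW a1))) [Dx].
  move=> /esym gx; have [b [_ _ bE]] := outer_lift (Bx _ Ba).
  have := seam_map Dx; rewrite -gx bE => /tube_boundaryE-/(_ (psiP i)).
  rewrite (outer_norm (Bx _ Ba) bE) => ha.
  by move: a1; rewrite -[enorm _]invrK ha invr1 ltxx.
have B0 : B a0 by exact: ballxx.
have -> : base (phi i a0) = e a0 by rewrite ebase// a01.
apply: (@chart_in_open_embedding R _ _ B) B0.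
- exact: ball_open.
- exact: ball_convex.
- have BE : B `<=` (B `&` [set a | 1 <= enorm (rsubmx a)]) `|`
      (B `&` [set a | enorm (rsubmx a) <= 1]).
    by move=> a Ba; have [a1|/ltW a1] := leP (enorm (rsubmx a)) 1; [right|left].
  apply: within_continuous_sub BE _; apply: within_continuousU.
  + move=> a [Ba /= a1] na.
    have {}a1 : 1 < enorm (rsubmx a).
      by rewrite lt_neqAle a1 andbT; apply/eqP => ae; apply: na; split=> //=; rewrite -ae.
    by apply: filterS (near_comp (@nq a) (lt_nbhsr a1)) => a' /ltW a'1 [].
  + move=> a [Ba /= a1] na.
    have {}a1 : enorm (rsubmx a) < 1.
      by rewrite lt_neqAle a1 andbT; apply/eqP => ae; apply: na; split=> //=; rewrite ae.
    by apply: filterS (near_comp (@nq a) (lt_nbhsl a1)) => a' /ltW a'1 [].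
  + apply: (within_continuous_eq (f := base \o phi i)).
      by move=> a [_ /= a1]; rewrite ebase.
    apply: within_continuous_compose base_cont.
      by apply: within_continuous_at => a _; exact: cphi.
    by move=> _ [a [Ba a1] <-]; exact: BW.
  + apply: (within_continuous_eq (f := cap i \o outer)).
      by move=> a [Ba /= a1]; rewrite ecap.
    apply: within_continuous_compose (@cap_cont i).
      by apply: within_continuous_at => a [/Bx Ba _]; exact: outer_cont.
    by move=> _ [a [/Bx Ba a1] <-]; exact: outer_C.
- move=> a a' Ba Ba' ee.
  have [a1|a1] := leP 1 (enorm (rsubmx a)); have [a'1|a'1] := leP 1 (enorm (rsubmx a')).
  + move: ee; rewrite !ebase// => /(base_inj (BW _ Ba a1) (BW _ Ba' a'1)) pp.
    by have [<- _ _ _] := dP _ Ba; have [<- _ _ _] := dP _ Ba'; rewrite pp.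
  + by move: ee; rewrite ebase// => /(excl _ _ Ba' a'1 (BW _ Ba a1)).
  + by move: ee => /esym; rewrite ebase// => /(excl _ _ Ba a1 (BW _ Ba' a'1)).
  (* Both points are in the cap. Equal radii there give equal norms, injectivity of the gluing gives
     the same boundary point, and [sec] turns this into equal directions and torus coordinates. *)
  + move: ee; rewrite !ecap ?ltW//.
    move=> /(cap_inj (outer_C (Bx _ Ba) (ltW a1)) (outer_C (Bx _ Ba') (ltW a'1))) [_ oo].
    have [b [b1 bE ob]] := outer_lift (Bx _ Ba).
    have [b' [b'1 b'E ob']] := outer_lift (Bx _ Ba').
    move: (oo); rewrite ob' => /(outer_norm (Bx _ Ba)); rewrite row_mxKr.
    rewrite enormZ ?invr_ge0 ?enorm_ge0// b'1 mulr1 => /invr_inj nn.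
    move: oo; rewrite ob ob' => /psiE; rewrite !row_mxKl !row_mxKr nn => -[ll].
    have n0 : (enorm (rsubmx a))^-1 != 0.
      by rewrite invr_eq0 gt_eqF// norm_gt0// Bx.
    move=> /(scalerI n0) rr.
    have pp : psi i b = psi i b' by apply/psiE.
    have := seam_inj (dirD (Bx _ Ba)) (dirD (Bx _ Ba')).
    rewrite -bE -b'E => /(_ pp) dd.
    have [_ sa _ _] := dP _ Ba; have [_ sa' _ _] := dP _ Ba'.
    have : dir a = dir a' by rewrite -sa -sa' dd.
    rewrite /dir => /eq_row_mx[el ed].
    rewrite -[a]hsubmxK -[a']hsubmxK el.
    by rewrite -(scale_direction (Bx _ Ba)) -(scale_direction (Bx _ Ba')) ed nn.
- move=> V oV VB; apply: gopen => [x Wx [q Vq qe]|j y Cy [q Vq qe]].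
    have Bq := VB _ Vq.
    have [q1|q1] := leP 1 (enorm (rsubmx q)); last by case: (excl q x Bq q1 Wx).
    move: qe; rewrite ebase// => /(base_inj (BW _ Bq q1) Wx) <-.
    apply: (tube_chart_near (phiP i)).
    apply: filterS (open_nbhs_nbhs (conj oV Vq)) => a Va Wa; exists a => //.
    by rewrite ebase//; exact: WB.
  have Bq := VB _ Vq.
  have q1 : enorm (rsubmx q) <= 1.
    rewrite leNgt; apply/negP => q1; move: qe; rewrite ebase ?ltW//.
    move=> /(base_cap (BW _ Bq (ltW q1)) Cy) [Dq _].
    have [_ _ _ oth] := dP _ Bq.
    have [ji|ji] := eqVneq j i; last by apply: (oth j) => //; exact: tube_boundary_sub.
    by move: Dq; rewrite ji => /tube_boundaryE-/(_ (phiP i)) qE; move: q1; rewrite qE ltxx.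
  move: qe; rewrite ecap// => /(cap_inj (outer_C (Bx _ Bq) q1) Cy) [ij <-].
  subst j.
  have [b [b1 bE ob]] := outer_lift (Bx _ Bq).
  rewrite ob; set yb := row_mx _ _.
  have q0 := norm_gt0 (Bx _ Bq).
  have ybr : rsubmx yb = (enorm (rsubmx q))^-1 *: rsubmx b by rewrite /yb row_mxKr.
  have b_neq0 : rsubmx b != 0.
    by apply/eqP => bz; move: b1; rewrite bz /enorm sqnorm0 sqrtr0 => /eqP; rewrite eq_sym oner_eq0.
  have yb_neq0 : rsubmx yb != 0.
    by rewrite ybr scaler_eq0 negb_or b_neq0 andbT invr_eq0 gt_eqF.
  have dyb : dir yb = b.
    rewrite /dir ybr directionZ ?invr_gt0// direction_id; last by rewrite -enorm_sqr b1 expr1n.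
    by rewrite /yb row_mxKl hsubmxK.
  (* The inverse of the cap side of [e]: [p.2] is a point of the cap in coordinates of [psi], whose
     radius is inverted, and [p.1] is a boundary point of the tube of [phi] glued to its radial
     projection. *)
  pose F (p : 'rV[R]_(2 + 2) * 'rV[R]_(2 + 2)) : 'rV[R]_(2 + 2) :=
    row_mx (lsubmx p.1) ((enorm (rsubmx p.2))^-1 *: rsubmx p.1).
  have Fq : F (dir q, yb) = q.
    rewrite /F /= ybr enormZ ?b1 ?mulr1 ?invrK ?invr_ge0 ?enorm_ge0//.
    by rewrite /dir row_mxKl row_mxKr scale_direction ?hsubmxK// Bx.
  have cF : {for (dir q, yb), continuous F}.
    apply: (@cvg_row_mx R _ (nbhs (dir q, yb)) _ 1 2 2 (fun p => lsubmx p.1)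
      (fun p => (enorm (rsubmx p.2))^-1 *: rsubmx p.1)).
      apply: (@continuous_comp _ _ _ fst (lsubmx : 'rV[R]_(2 + 2) -> _)).
        exact: cvg_fst.
      exact: lsubmx_continuous.
    apply: (@cvgZ R _ _ (nbhs (dir q, yb)) _ (fun p => (enorm (rsubmx p.2))^-1)
      (fun p => rsubmx p.1)).
      apply: (@cvgV R _ (nbhs (dir q, yb)) _ (fun p => enorm (rsubmx p.2))).
        by rewrite gt_eqF// norm_gt0.
      apply: (@continuous_comp _ _ _ snd (fun a : 'rV[R]_(2 + 2) => enorm (rsubmx a))).
        exact: cvg_snd.
      exact: nq.
    apply: (@continuous_comp _ _ _ fst (rsubmx : 'rV[R]_(2 + 2) -> _)).
      exact: cvg_fst.
    exact: rsubmx_continuous.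
  have FV : nbhs (F (dir q, yb)) V by rewrite Fq; exact: open_nbhs_nbhs.
  have [[/= P1 P2] [dP1 yP2] P12] := near_comp cF FV.
  have phiP1 : nbhs (phi i (dir q)) (phi i @` P1).
    by apply: (tube_chart_near (phiP i)); apply: filterS dP1 => a Pa; exists a.
  (* For points of the cap near the given one, the preimage under [g i] of the radial projection
     stays near that of the given one, because the boundary torus is compact. *)
  have ginv := compact_inverse_near (tube_boundary_compact (phiP i)) hY (@cg i)
    (@seam_inj i) (dirD (Bx _ Bq)) phiP1.
  have cpd : {for yb, continuous (psi i \o dir)}.
    apply: continuous_comp; first exact: dir_cont.
    by have [cpsi _ _] := psiP i; exact: cpsi.
  have ginv' : \forall b' \near yb, forall x', D i x' -> g i x' = psi i (dir b') ->
      (phi i @` P1) x'.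
    apply: (near_comp (P := fun y => forall x', D i x' -> g i x' = y -> (phi i @` P1) x') cpd).
    by rewrite /= dyb bE.
  apply: (tube_chart_near (psiP i)); apply: filterS2 yP2 ginv' => b' P2b' gb' Cb'.
  have b'1 : 1 <= enorm (rsubmx b').
    rewrite leNgt; apply/negP => b'1; move: Cb'; rewrite /C torus_exterior_open//.
    by apply; apply/open_tubeE.
  have b'_neq0 : rsubmx b' != 0.
    by apply/eqP => bz; move: b'1; rewrite bz /enorm sqnorm0 sqrtr0 ler10.
  have b'0 := norm_gt0 b'_neq0.
  have Tb' : tube_boundary (psi i) (psi i (dir b')).
    by apply/tube_boundaryE; [exact: psiP|exact: dir_norm].
  have [x' Dx' gx'] := seam_surj Tb'.
  have [a P1a ax'] := gb' _ Dx' gx'.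
  have a1 : enorm (rsubmx a) = 1.
    by move: Dx'; rewrite -ax' => /tube_boundaryE-/(_ (phiP i)).
  have VF : V (F (a, b')) by exact: (P12 (a, b')).
  exists (F (a, b')) => //.
  have Fn : enorm (rsubmx (F (a, b'))) = (enorm (rsubmx b'))^-1.
    by rewrite /F row_mxKr /= enormZ ?a1 ?mulr1// invr_ge0 enorm_ge0.
  rewrite ecap; [|exact: VB|by rewrite Fn invf_le1].
  congr (cap i _); rewrite /outer Fn invrK.
  have -> : dir (F (a, b')) = a.
    rewrite /dir {2}/F row_mxKr /= directionZ ?invr_gt0// direction_id; last by rewrite -enorm_sqr a1 expr1n.
    by rewrite /F row_mxKl hsubmxK.
  rewrite ax' gx' tube_scaleE// /dir row_mxKl row_mxKr scale_direction//.
  by rewrite hsubmxK.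
Qed.

End at_seam.

End seam.

(** A gluing diffeomorphism is known through its lift [H] to [R^3]; a continuous branch of the angle
    lifts boundary points to [R^3] locally, and the continuity of [H] descends. *)
Lemma gluing_continuous (R : realType) (X Y : topologicalType)
    (phi : 'rV[R]_(2 + 2) -> X) (psi : 'rV[R]_(2 + 2) -> Y) (g : X -> Y) :
  tube_chart phi -> tube_chart psi -> gluing_diffeo phi psi g ->
  {within tube_boundary phi, continuous g}.
Proof.
move=> phiP psiP [_ [H [sH gH _]]].
(* This is smoothness at order 0. *)
have cH : continuous H by move=> z; exact: (sH 0%N z I).
apply/within_continuousP => _ P [a /= a1 <-] gP; apply: (tube_chart_near phiP).
have a_neq0 : rsubmx a != 0.
  by apply/eqP => az; move: a1; rewrite az sqnorm0 => /eqP; rewrite eq_sym oner_eq0.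
have [t ta] := unit_circle_surj (sqnorm_direction a_neq0).
have [theta [cth tha] thP] := local_angle a_neq0 ta.
pose pt (b : 'rV[R]_(2 + 2)) : 'rV[R]_(2 + 1) :=
  row_mx (lsubmx b) (const_mx (theta (rsubmx b))).
have cpt : {for a, continuous pt}.
  apply: (@cvg_row_mx R _ (nbhs a) _ 1 2 1 lsubmx); first exact: lsubmx_continuous.
  apply: (@cvg_mx R _ (nbhs a)) => i j; rewrite mxE; under eq_fun do rewrite mxE.
  by apply: (@continuous_comp _ _ _ rsubmx); first exact: rsubmx_continuous.
have ptE b : sqnorm (rsubmx b) = 1 -> unit_circle (theta (rsubmx b)) = direction (rsubmx b) ->
    g (phi b) = boundary_param psi (H (pt b)).
  move=> b1 tb; rewrite -gH; congr g.
  by rewrite /boundary_param row_mxKl row_mxKr mxE tb direction_id// hsubmxK.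
have cb : {for a, continuous (boundary_param psi \o (H \o pt))}.
  apply: continuous_comp; last exact: boundary_param_continuous.
  by apply: continuous_comp => //; exact: cH.
rewrite ptE// in gP; last by rewrite tha.
have := near_comp cb gP; have := near_comp (@rsubmx_continuous R 2 2 a) thP.
by apply: filterS2 => b tb Pb /(tube_fibreE phiP [set y | sqnorm y = 1]) b1; rewrite ptE.
Qed.

(** * Holonomy of the loops named in the theorem *)

Section loop_holonomy.
Context (R : realType) (G : groupType) (Z : topologicalType).
Local Open Scope group_scope.

Lemma trivial_class_holonomy (A : set Z) (c : Z -> Z -> G) (p : Z) (l : R -> Z) :
  flat A c -> loop_in A p l -> pi1_trivial_class A l -> holonomy c l 1.
Proof.
move=> fc lP /homotopic_sym lc; have [_ _ l0 l1] := lP.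
apply: (free_homotopic_holonomy fc (homotopic_free _ lc)); first by [].
apply: holonomy_cst fc _; rewrite l0 -l0.
by apply: path_in_mem lP _; apply: itv01P; lra.
Qed.

(** Inverting a loop inverts its holonomy, so the sign left free in [maps_basis] has no effect on
    triviality. *)
Lemma orient_holonomy (A : set Z) (c : Z -> Z -> G) (e : bool) (l l' : R -> Z) :
  flat A c -> free_homotopic A l (loop_orient e l') ->
  (holonomy c l 1 <-> holonomy c l' 1).
Proof.
move=> fc ll'; have eq_rev : holonomy c (loop_orient e l') 1 <-> holonomy c l' 1.
  case: e {ll'} => //=; split; first exact: holonomy_rev1.
  by move=> /holonomy_rev; rewrite invg1.
rewrite -eq_rev; split; first exact: free_homotopic_holonomy ll'.
exact: free_homotopic_holonomy (free_homotopic_sym ll').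
Qed.

Lemma meridian_holonomy (c : Z -> Z -> G) (phi : 'rV[R]_(2 + 2) -> Z) (l : R -> Z) :
  flat (tube_boundary phi) c -> is_meridian phi l -> holonomy c l 1 ->
  holonomy c (fun t : R => phi (row_mx 0%R (unit_circle t))) 1.
Proof.
move=> fc [lm|lm].
  by move/(orient_holonomy (e := false) fc lm).
by move/(orient_holonomy (e := true) fc lm).
Qed.

(** Loops with trivial holonomy behave as a normal subgroup: going out and back along a connecting
    path only conjugates the holonomy 1. The equations for the ends are carried along so that
    concatenations make sense. *)
Lemma normal_closure_holonomy (c : Z -> Z -> G) (x0 : Z) (S : set (R -> Z)) :
  flat setT c ->
  (forall l, S l -> holonomy c l 1 /\ l 0%R = l 1%R) ->
  forall l, normal_closure x0 S l -> [/\ l 0%R = x0, l 1%R = x0 & holonomy c l 1].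
Proof.
move=> fc SP l; elim=> {l}.
- by split=> //; exact: holonomy_cst fc I.
- move=> l p /SP[l1 ll] pP; have [_ _ p0 p1] := pP; have [a pa] := path_holonomy fc pP.
  split; [by rewrite path_cat0|by rewrite !path_cat1 /path_rev subrr|].
  have r0 : path_rev p 0%R = l 1%R by rewrite /path_rev subr0 p1.
  have e2 : p 1%R = path_cat l (path_rev p) 0%R by rewrite path_cat0 p1.
  have := holonomy_cat e2 pa (holonomy_cat (esym r0) l1 (holonomy_rev pa)).
  by rewrite mul1g mulgV.
- move=> l l' _ [l0 l1 lh] _ [l'0 l'1 l'h].
  split; [by rewrite path_cat0|by rewrite path_cat1|].
  by rewrite -[1]mul1g; apply: holonomy_cat => //; rewrite l1 l'0.
- move=> l _ [l0 l1 lh]; split; rewrite /path_rev ?subr0 ?subrr//.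
  by rewrite -invg1; exact: holonomy_rev.
- move=> l l' _ [l0 l1 lh] ll'; have [e0 e1] := homotopic_ends ll'.
  split; [by rewrite e0|by rewrite e1|].
  by apply: (free_homotopic_holonomy fc (homotopic_free _ ll')) => //; rewrite l0 l1.
Qed.

End loop_holonomy.

Lemma holonomy_transfer (R : realType) (G : groupType) (X Y : topologicalType)
    (A : set X) (g : X -> Y) (c : X -> X -> G) (c' : Y -> Y -> G) (p q : X) (l : R -> X) a :
  (forall x x', A x -> A x' -> c x x' = c' (g x) (g x')) -> path_in A p q l ->
  holonomy c l a <-> holonomy c' (g \o l) a.
Proof.
move=> cc' lP; split=> -[h hP ha]; exists h => //; apply: eq_parallel hP => // s t sI tI.
  by rewrite /pull cc'//; exact: path_in_mem lP _.
by rewrite /pull cc'//; exact: path_in_mem lP _.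
Qed.

(** * Transfer of holonomies between the manifold and the caps *)

Theorem lemma2p6 (R : realType) (M : charted_space R 4) (r : nat)
    (f : 'I_r -> 'rV[R]_2 -> M) (phi : 'I_r -> 'rV[R]_(2 + 2) -> M)
    (lambda eta rho : 'I_r -> R -> M)
    (T : 'I_r -> 'rV[R]_2 -> S4 R) (psi : 'I_r -> 'rV[R]_(2 + 2) -> S4 R)
    (mu u v : 'I_r -> R -> S4 R)
    (g : 'I_r -> M -> S4 R) (x0 : M)
    (HM : closed_oriented_manifold M)
    (HR : forall i, square_zero_torus (f i))
    (Hphi : forall i, tubular_nbhd (f i) (phi i))
    (Hdisjoint : forall i j, i != j -> tube (phi i) `&` tube (phi j) = set0)
    (Hbasis : forall i, boundary_basis (phi i) (lambda i) (eta i) (rho i))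
    (Hrho : forall i, is_meridian (phi i) (rho i))
    (HT : forall i, embedded_torus (T i))
    (Hpsi : forall i, tubular_nbhd (T i) (psi i))
    (HCbasis : forall i, boundary_basis (psi i) (mu i) (u i) (v i))
    (Hmu : forall i, is_meridian (psi i) (mu i))
    (Hv : forall i, pi1_trivial_class (torus_exterior (psi i)) (v i))
    (Hg : forall i, gluing_diffeo (phi i) (psi i) (g i))
    (Hgbasis : forall i, maps_basis (tube_boundary (psi i)) (g i)
      (lambda i) (eta i) (rho i) (u i) (mu i) (v i))
    (Heta : forall i, pi1_trivial_class [set: M] (eta i))
    (Hlambda : pi1_quotient_trivial x0 [set l | exists i, l = lambda i]) :
  simply_connected R
    (glued_space (exterior phi) (fun i => torus_exterior (psi i))
       (fun i => tube_boundary (phi i)) g).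
Proof.
have hM : hausdorff_space M by case: HM => -[].
have cM : connected [set: M] by case: HM => -[].
have chM x : chart_in R [set: M] x.
  have [[_ _ _ [chart cover] _] _] := HM; have [a aM ax] := cover x.
  exact: chart_in_is_chart (chart a aM) ax.
have hS := @sphere_hausdorff R.
have phiP i := smooth_tube_chart (Hphi i).
have psiP i := smooth_tube_chart (Hpsi i).
have gbij i : set_bij (tube_boundary (phi i)) (tube_boundary (psi i)) (g i) by case: (Hg i).
have cg i := gluing_continuous (phiP i) (psiP i) (Hg i).
pose W := exterior phi; pose C i := torus_exterior (psi i); pose D i := tube_boundary (phi i).
have D0 i : D i !=set0.
  by exists (boundary_param (phi i) 0); exact: boundary_param_boundary.
(* If [x0] is not in the exterior it lies in an open tube, and the boundary of that tube supplies a
   point of [W]. *)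
have [w Ww] : W !=set0.
  have [|nW] := pselect (W x0); first by exists x0.
  have [i _ _] : (\bigcup_i open_tube (phi i)) x0.
    by move: nW; rewrite /W exteriorE// => /contrapT.
  by have [x Dx] := D0 i; exists x; exact: exterior_boundary Dx.
have C0 i : exists y, C i y.
  by have [x Dx] := D0 i; exists (g i x); exact: (seam_cap hS psiP gbij) Dx.
pose w0 : set_type W := exist _ w (mem_set Ww).
pose y0 i : set_type (C i) := exist _ (projT1 (cid (C0 i))) (mem_set (projT2 (cid (C0 i)))).
pose base := @glue_base M (S4 R) r W C D g w0.
pose cap := @glue_cap M (S4 R) r W C D g y0.
have DW := @seam_sub R M r phi hM phiP Hdisjoint.
have gC := @seam_cap R M (S4 R) r phi psi g hS psiP gbij.
have Ddisj := @seam_disjoint R M r phi Hdisjoint.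
have ginj := @seam_inj R M (S4 R) r phi psi g gbij.
have base_cont : {within W, continuous base} by exact: glue_base_continuous.
have cap_cont i : {within C i, continuous (cap i)} by exact: glue_cap_continuous.
have base_eq i x : D i x -> base x = cap i (g i x) by exact: (glue_eq w0 y0 DW gC).
apply: simply_connected_parallel.
- by exists (base w).
- apply: (glue_connected w0 y0 DW gC); last exact: D0.
    exact: exterior_connected.
  move=> i; rewrite /C torus_exteriorE; apply: exterior_connected => //.
    by move=> j k; rewrite !ord1 eqxx.
  exact: sphere_connected.
- move=> z; have [[x Wx ->]|[i [y Cy ->]]] := glue_cover w0 y0 z.
    have [[i Dx]|nD] := pselect (exists i, D i x); last first.
      by apply: base_chart => // i Dx; apply: nD; exists i.
    have [a /= a1 <-] := Dx.
    by apply: (seam_chart hM hS) => //; exact: enorm1.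
  have [Ty|nT] := pselect (tube_boundary (psi i) y); last first.
    by apply: cap_chart => //; exact: sphere_chart.
  have [x Dx <-] := seam_surj gbij Ty.
  have [a /= a1 ax] := Dx; rewrite -(glue_eq w0 y0 DW gC Dx) -ax.
  by apply: (seam_chart hM hS) => //; exact: enorm1.
move=> G c fc.
pose cW := pull base c; pose cC i := pull (cap i) c.
have fW : flat W cW by apply: flat_pull base_cont _ fc.
have fC i : flat (C i) (cC i) by apply: flat_pull (cap_cont i) _ fc.
have fD i : flat (D i) cW by exact: flat_sub (DW i) fW.
have TC i : tube_boundary (psi i) `<=` C i.
  by move=> y /(seam_surj gbij)[x Dx <-]; exact: gC.
have fT i : flat (tube_boundary (psi i)) (cC i) by exact: flat_sub (TC i) (fC i).
have cWC i x x' : D i x -> D i x' -> cW x x' = cC i (g i x) (g i x').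
  by move=> Dx Dx'; rewrite /cW /cC /pull (base_eq _ _ Dx) (base_eq _ _ Dx').
have Dloop i : exists p, [/\ loop_in (D i) p (lambda i), loop_in (D i) p (eta i) &
    loop_in (D i) p (rho i)].
  by have [p _ [lP eP rP _]] := Hbasis i; exists p.
have [c' fc' c'W] : exists2 c' : M -> M -> G, flat setT c' &
    forall z z', W z -> W z' -> c' z z' = cW z z'.
  apply: flat_extend_tubes => // i.
  have [p [_ _ rP]] := Dloop i; have [q _ [_ _ vP _]] := HCbasis i.
  have [e1 [e2 [e3 [_ _ _ fv]]]] := Hgbasis i.
  (* Read backwards: the geometric meridian is reduced to [rho i], then across the gluing to [v i]
     up to orientation, which is null-homotopic in the cap. *)
  apply: (meridian_holonomy (fD i) (Hrho i)).
  apply/(holonomy_transfer _ (cWC i) rP); apply/(orient_holonomy (fT i) fv).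
  exact: trivial_class_holonomy (fC i) (path_in_sub (TC i) vP) (Hv i).
have c'D i (l : R -> M) p : loop_in (D i) p l -> holonomy c' l 1%g <-> holonomy cW l 1%g.
  move=> lP; have := holonomy_transfer 1%g (g := id) (c := c') (c' := cW) _ lP; apply.
  by move=> x x' Dx Dx'; rewrite c'W//; exact: (DW i).
have capP i : exists h, parallel (C i) (cC i) h.
  have [p [_ eP _]] := Dloop i; have [q _ [mP _ _ _]] := HCbasis i.
  have [e1 [e2 [e3 [_ _ fm _]]]] := Hgbasis i.
  (* The same transfer in the other direction: from [mu i] back to [eta i], whose contraction in [M]
     may cross the tubes. That is why the extended transport [c'] has to be constructed before the
     caps are treated. *)
  have m1 : holonomy (cC i) (fun t : R => psi i (row_mx 0 (unit_circle t))) 1%g.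
    apply: (meridian_holonomy (fT i) (Hmu i)).
    apply/(orient_holonomy (fT i) fm); apply/(holonomy_transfer _ (cWC i) eP).
    apply/(c'D _ _ _ eP).
    exact: trivial_class_holonomy fc' (path_in_sub (@subsetT _ _) eP) (Heta i).
  have dd (j k : 'I_1) : j != k -> tube (psi i) `&` tube (psi i) = set0.
    by rewrite !ord1 eqxx.
  have fE : flat (exterior (fun _ : 'I_1 => psi i)) (cC i).
    by rewrite -torus_exteriorE; exact: fC.
  have [c'' fc'' c''C] :=
    flat_extend_tubes hS (fun _ : 'I_1 => psiP i) dd fE (fun _ : 'I_1 => m1).
  have [h hP] := sphere_parallel fc''; exists h.
  apply: eq_parallel (parallel_sub (@subsetT _ (C i)) hP) => // y y' Cy Cy'.
  by apply: c''C; rewrite -torus_exteriorE.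
pose hC i := projT1 (cid (capP i)).
have hCP i : parallel (C i) (cC i) (hC i) by rewrite /hC; case: cid.
have [hM' hMP] : exists h, parallel setT c' h.
  apply: (@parallel_global R G M c' x0 fc').
  - exact: chart_locally_path_connected chM.
  - exact: connected_path_connected cM (chart_locally_path_connected chM) x0.
  move=> l lP.
  have [|_ _ //] := normal_closure_holonomy fc' _ (Hlambda l lP).
  move=> _ [i ->]; have [p [lamP _ _]] := Dloop i.
  split; last by have [_ _ -> ->] := lamP.
  apply/(c'D _ _ _ lamP); apply/(holonomy_transfer _ (cWC i) lamP).
  (* The image of [lambda i] is a loop in the cap, where a section is already available; its
     holonomy is the quotient of two equal values of that section. *)
  have glP : path_in (C i) (g i p) (g i p) (g i \o lambda i).
    by apply: path_in_comp (cg i) _ lamP => _ [x Dx <-]; exact: gC.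
  by have := holonomy_parallel (hCP i) glP; rewrite mulVg.
have hWP : parallel W cW hM'.
  by apply: eq_parallel (parallel_sub (@subsetT _ W) hMP).
have match_seam i : exists a, forall x, D i x -> hC i (g i x) = (a * hM' x)%g.
  apply: (parallel_unique (tube_boundary_connected (phiP i)) (parallel_sub (DW i) hWP)).
  have gTC : g i @` D i `<=` C i by move=> _ [x Dx <-]; exact: gC.
  apply: eq_parallel (parallel_pull (cg i) gTC (hCP i)) => // x x' Dx Dx'.
  by rewrite (cWC i).
pose a i := projT1 (cid (match_seam i)).
have aP i x : D i x -> hC i (g i x) = (a i * hM' x)%g.
  by move=> Dx; rewrite /a; case: cid => b bP; exact: bP.
apply: (glue_parallel (w0 := w0) (y0 := y0) Ddisj ginj (hW := hM')
  (hC := fun i y => ((a i)^-1 * hC i y)%g) fc hWP).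
- by move=> i; exact: parallel_mull.
- by move=> i x Dx; rewrite aP// mulKg.
Qed.
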